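(* Assume that the probability measure $\mu$ on $\mathbb{R}$ has compact support and is not concentrated at one point. Then $\mu$ satisfies a Poincaré inequality with $$\frac{2}{d^2(\mu)}\le\mathrm{Poin}(\mu)\le\frac{1}{\mathrm{Var}(\mu)},$$ where $d(\mu)=\mathrm{diam}(\mathrm{supp}(\mu))$ and $\mathrm{Var}(\mu)=\int x^2\mu(dx)-\left(\int x\,\mu(dx)\right)^2$. Equality on the left is attained only for the case $$\mu=\alpha\delta_a+(1-\alpha)\delta_b,\quad a<b,\quad 0<\alpha<1.$$ Equality on the right is attained only for the case of a semicircular law ($a\in\mathbb{R}$, $r>0$) $$\mu(dx)=\frac{1}{2\pi r^2}\mathbf{1}_{[a-2r,a+2r]}(x)\sqrt{4r^2-(x-a)^2}\,dx.$$ In addition, assume that $V$ is a $C^2$ potential on $\mathbb{R}$ such that for some positive integer $p$ and real $\rho>0$, $V(x)-\rho x^{2p}$ is convex, and that $\mu$ is the minimizer of $$\int V(x)\,\mu(dx)-\iint\log|x-y|\,\mu(dx)\mu(dy)$$ over all probability measures on $\mathbb{R}$. Then $$\frac{\left(p\,\rho\binom{2p}{p}\right)^{1/p}}{8}\le\mathrm{Poin}(\mu).$$ In particular, if $p=1$, then $\frac{\rho}{4}\le\mathrm{Poin}(\mu)$.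
   Context: A probability measure $\mu$ on $\mathbb{R}$ is said to satisfy a Poincaré inequality if there is a constant $C>0$ such that $$\iint\left(\frac{\phi(x)-\phi(y)}{x-y}\right)^2\mu(dx)\mu(dy)\ge C\,\mathrm{Var}_\mu(\phi)\quad\text{for every }\phi\in C_0^1(\mathbb{R}),$$ where $C_0^1(\mathbb{R})$ is the set of compactly supported $C^1$ functions, $\mathrm{Var}_\mu(\phi)=\int\phi^2d\mu-\left(\int\phi\,d\mu\right)^2$, and on the diagonal $x=y$ the quotient $\frac{\phi(x)-\phi(y)}{x-y}$ is interpreted as $\phi'(x)$. $\mathrm{Poin}(\mu)$ denotes the largest constant $C>0$ for which this holds. *)

(* Defs.v *)
(* MathComp-Analysis, over an arbitrary [R : realType]. *)
From HB Require Import structures.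
From mathcomp Require Export all_boot all_order all_algebra.
From mathcomp Require Export all_classical all_reals all_analysis.

Set Implicit Arguments.
Unset Strict Implicit.
Unset Printing Implicit Defensive.

Export Order.TTheory GRing.Theory Num.Theory.
Export numFieldNormedType.Exports.

Local Open Scope classical_set_scope.
Local Open Scope ring_scope.

Notation probR R := (probability (measurableTypeR R) R).

Definition C1 (R : realType) (f : R -> R) : Prop :=
  (forall x, derivable f x 1) /\ continuous (derive1 f).

Definition C2 (R : realType) (f : R -> R) : Prop :=
  (forall x, derivable f x 1) /\ C1 (derive1 f).

Definition compactly_supported (R : realType) (f : R -> R) : Prop :=
  compact (closure [set x | f x != 0]).

Definition supp (R : realType) (mu : probR R) : set R :=
  [set x | forall U : set R, open U -> U x -> (0 < mu U)%E].

(* Meaningful for nonempty bounded [A]; [sup] is 0 otherwise. *)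
Definition diam (R : realType) (A : set R) : R :=
  sup [set t | exists x y, [/\ A x, A y & t = `|x - y|]].

(* The integrals below are real-valued. They are used for [f] compactly
   supported and C^1, where all of them are finite, and for [f] the identity
   and [mu] compactly supported. *)
Definition Var (R : realType) (mu : probR R) (f : R -> R) : R :=
  \int[mu]_x (f x) ^+ 2 - (\int[mu]_x f x) ^+ 2.

Definition diffquot (R : realType) (f : R -> R) (x y : R) : R :=
  if x == y then derive1 f x else (f x - f y) / (x - y).

Definition free_dirichlet (R : realType) (mu : probR R) (f : R -> R) : R :=
  \int[(mu \x mu)%E]_z (diffquot f z.1 z.2) ^+ 2.

Definition poincare_inequality (R : realType) (mu : probR R) (C : R) : Prop :=
  0 < C /\
  forall phi : R -> R, C1 phi -> compactly_supported phi ->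
    C * Var mu phi <= free_dirichlet mu phi.

(* The admissible constants are closed under nonzero limits, so whenever this
   supremum is positive it is the largest one. It is 0 when no constant, or
   every constant (Dirac masses), is admissible. *)
Definition Poin (R : realType) (mu : probR R) : R :=
  sup [set C | poincare_inequality mu C].

Definition two_point_law (R : realType) (alpha a b : R) (A : set R) : \bar R :=
  (alpha%:E * \d_a A + (1 - alpha)%:E * \d_b A)%E.

Definition semicircle_pdf (R : realType) (a r x : R) : R :=
  (2 * pi * r ^+ 2)^-1 * \1_(`[a - 2 * r, a + 2 * r]) x *
  Num.sqrt (4 * r ^+ 2 - (x - a) ^+ 2).

Definition semicircle_law (R : realType) (a r : R)
    (A : set (measurableTypeR R)) : \bar R :=
  (\int[lebesgue_measure]_(x in A) (semicircle_pdf a r x)%:E)%E.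

(* [lne] is -oo at 0, unlike [ln], so the diagonal is not neglected. *)
Definition log_kernel (R : realType)
    (z : measurableTypeR R * measurableTypeR R) : \bar R :=
  lne (`|z.1 - z.2|%:E).

(* For heavy-tailed measures both terms of [\int V - \iint log] can be +oo.
   When [V] dominates a positive multiple of [x ^+ 2p], the single integrand
   [(V x + V y) / 2 - log |x - y|] is bounded below, and its integral, the usual
   meaning of the difference, is finite exactly when both terms are; it is +oo
   otherwise. *)
Definition log_energy (R : realType) (V : R -> R) (mu : probR R) : \bar R :=
  if `[< mu.-integrable setT (EFin \o V) /\
         (mu \x mu)%E.-integrable setT (@log_kernel R) >]
  then (\int[mu]_x (V x)%:E - \int[(mu \x mu)%E]_z log_kernel z)%E
  else +oo%E.

Definition energy_minimizer (R : realType) (V : R -> R) (mu : probR R) : Prop :=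
  forall nu : probR R, (log_energy V mu <= log_energy V nu)%E.

(* Main.v *)
From HB Require Import structures.
Require Import Defs.
From mathcomp Require Import ring lra zify measurable_realfun.

Set Implicit Arguments.
Unset Strict Implicit.
Unset Printing Implicit Defensive.

Local Open Scope classical_set_scope.
Local Open Scope ring_scope.

(** Let [K] be the support of [mu], [d] its diameter, and [D f] the double integral
    of the squared difference quotient of [f], to be compared with the variance,
    which is half the double integral of [(f x - f y) ^ 2].  By a cutoff outside of
    [K], all C^1 functions are admissible as test functions ([poincare_C1]).

    The bounds.  The lower one holds since [|x - y| <= d] on [K], and the upper one
    is the inequality at the identity, for which [D f = 1].

    Equality on the left.  If [mu] charges the open interior of the convex hull of
    [K], pairs with one point there are at distance less than [d] by a fixed amount,
    and the constant improves ([poincare_improved]); so [K] has only two points.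
    Conversely, for a law carried by [a] and [b], a cubic whose derivative vanishes
    at [a] and [b] is extremal ([two_point_Poin]).

    Equality on the right.  If it holds, the identity is extremal.  The first
    variation at the identity ([first_variation]), taken along powers of [x] minus
    the mean, is a recursion that determines all central moments from the variance
    ([cmoment_rec]), and moments determine a compactly supported measure by
    Weierstrass approximation.  The semicircular law with the same mean and variance
    satisfies the same recursion because equality holds for it as well: in the basis
    of Chebyshev polynomials of the second kind, a function with coefficients [c_k]
    has variance [\sum_(k > 0) c_k ^ 2], and [D f] is the same sum with weights [k],
    up to the variance of the law ([semicircle_poincare_poly]).

    The minimizer.  By the lower bound it suffices to bound the length [2 L] of the
    convex hull [[c - L, c + L]] of [K].  Perturbing [mu] shows that the effective
    potential [V x - 2 \int log |x - y| mu(dy)], whose mean under [mu] is called [l],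
    has mean at least [l] under every law on the hull with finite energy and finite
    interaction with [mu] ([first_order_condition]), and is at most [l] on [K]
    ([effective_potential_supp]).  It is convex in the gaps of [K], hence at most [l] on the whole hull
    ([effective_potential_hull]).  Integrating it against the arcsine laws of the
    hull and of the concentric interval of radius [s L], whose logarithmic potentials
    are explicit ([arcsine_potential]), gives
      [\int V (c + L cos t) - \int V (c + s L cos t) <= - 2 ln s],
    the integrals being means over a uniform angle ([arcsine_comparison]).  On the
    left-hand side the convex part of [V] contributes a nonnegative amount, and
    [rho x ^ 2p] at least [rho L ^ 2p m (1 - s ^ 2p)], where [m = 4 ^ -p C(2p, p)] is
    the mean of [cos^2p].  Comparing slopes at [s = 1] yields
    [p rho C(2p, p) L ^ 2p <= 4 ^ p] ([equilibrium_radius_le]), which is the claim. *)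

(** * Functions bounded on a set of full measure *)

Section bounded_on_full_set.
Context d (T : measurableType d) (R : realType) (m : probability T R).
Variable S : set T.
Hypotheses (mS : measurable S) (S0 : m (~` S) = 0%E).
Implicit Types f g : T -> R.

(** [f] is measurable and bounded on [S]. When [S] has full measure such functions
    are integrable; they form an algebra, which makes side conditions of
    integrability easy to propagate. *)
Definition bmeas f := measurable_fun setT f /\ exists M : R, forall x, S x -> `|f x| <= M.

Lemma bmeas_cst c : bmeas (fun=> c).
Proof. by split=> //; exists `|c|. Qed.

Lemma bmeasD f g : bmeas f -> bmeas g -> bmeas (fun x => f x + g x).
Proof.
move=> [mf [M1 f1]] [mg [M2 g2]]; split; first exact: measurable_funD.
exists (M1 + M2) => x Sx; apply: (le_trans (ler_normD _ _)).
by rewrite lerD// ?f1 ?g2.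
Qed.

Lemma bmeasM f g : bmeas f -> bmeas g -> bmeas (fun x => f x * g x).
Proof.
move=> [mf [M1 f1]] [mg [M2 g2]]; split; first exact: measurable_funM.
by exists (M1 * M2) => x Sx; rewrite normrM ler_pM// ?f1 ?g2.
Qed.

Lemma bmeasZ c f : bmeas f -> bmeas (fun x => c * f x).
Proof. by move=> ?; apply: bmeasM => //; exact: bmeas_cst. Qed.

Lemma bmeasN f : bmeas f -> bmeas (fun x => - f x).
Proof. by move=> /(bmeasZ (-1)); under eq_fun do rewrite mulN1r. Qed.

Lemma bmeasB f g : bmeas f -> bmeas g -> bmeas (fun x => f x - g x).
Proof. by move=> bf /bmeasN; exact: bmeasD. Qed.

Lemma bmeasX f n : bmeas f -> bmeas (fun x => f x ^+ n).
Proof.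
move=> bf; elim: n => [|n ih]; first by under eq_fun do rewrite expr0; exact: bmeas_cst.
by under eq_fun do rewrite exprS; exact: bmeasM.
Qed.

Lemma bmeas_sum (I : Type) (s : seq I) (P : pred I) (F : I -> T -> R) :
  (forall i, P i -> bmeas (F i)) -> bmeas (fun x => \sum_(i <- s | P i) F i x).
Proof.
move=> bF; elim: s => [|i s ih].
  by under eq_fun do rewrite big_nil; exact: bmeas_cst.
under eq_fun do rewrite big_cons.
case Pi: (P i); last exact: ih.
by apply: bmeasD => //; exact: bF.
Qed.

Lemma bmeas_integrable f : bmeas f -> m.-integrable setT (EFin \o f).
Proof.
move=> [mf [M fM]].
have mEf : measurable_fun setT (EFin \o f) by exact/measurable_EFinP.
apply/(negligible_integrable (measurableC mS) measurableT mEf S0).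
rewrite setTD setCK; apply: measurable_bounded_integrable => //.
- by rewrite (le_lt_trans (probability_le1 _ _)) ?ltry.
- exact: measurable_funTS.
- exists M; split; first exact: num_real.
  by move=> y My x Sx; apply: (le_trans (fM x Sx)); exact: ltW.
Qed.

Lemma bmeas_intS f : bmeas f -> \int[m]_x f x = \int[m]_(x in S) f x.
Proof.
move=> bf; rewrite /Rintegral.
rewrite (negligible_integral (measurableC mS) measurableT (bmeas_integrable bf) S0).
by rewrite setTD setCK.
Qed.

Lemma bmeas_eq f g : bmeas f -> bmeas g -> (forall x, S x -> f x = g x) ->
  \int[m]_x f x = \int[m]_x g x.
Proof.
move=> bf bg fg; rewrite !bmeas_intS//; apply: eq_Rintegral => x.
by rewrite inE => /fg.
Qed.

Lemma bmeas_le f g : bmeas f -> bmeas g -> (forall x, S x -> f x <= g x) ->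
  \int[m]_x f x <= \int[m]_x g x.
Proof.
move=> bf bg fg; rewrite !bmeas_intS//; apply: le_Rintegral => //.
  by apply: integrableS (bmeas_integrable bf).
by apply: integrableS (bmeas_integrable bg).
Qed.

Lemma Rint_cst c : \int[m]_x c = c.
Proof. by rewrite Rintegral_cst// [X in fine X]probability_setT/= mulr1. Qed.

Lemma bmeas_intD f g : bmeas f -> bmeas g ->
  \int[m]_x (f x + g x) = \int[m]_x f x + \int[m]_x g x.
Proof. by move=> bf bg; rewrite RintegralD//; exact: bmeas_integrable. Qed.

Lemma bmeas_intB f g : bmeas f -> bmeas g ->
  \int[m]_x (f x - g x) = \int[m]_x f x - \int[m]_x g x.
Proof. by move=> bf bg; rewrite RintegralB//; exact: bmeas_integrable. Qed.

Lemma bmeas_intZ c f : bmeas f -> \int[m]_x (c * f x) = c * \int[m]_x f x.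
Proof. by move=> bf; rewrite RintegralZl//; exact: bmeas_integrable. Qed.

Lemma bmeas_intZr c f : bmeas f -> \int[m]_x (f x * c) = \int[m]_x f x * c.
Proof. by move=> bf; rewrite RintegralZr//; exact: bmeas_integrable. Qed.

Lemma bmeas_int_sum (I : Type) (s : seq I) (P : pred I) (F : I -> T -> R) :
  (forall i, P i -> bmeas (F i)) ->
  \int[m]_x (\sum_(i <- s | P i) F i x) = \sum_(i <- s | P i) \int[m]_x F i x.
Proof.
move=> bF; elim: s => [|i s ih].
  by under eq_Rintegral do rewrite big_nil; rewrite Rint_cst big_nil.
under eq_Rintegral do rewrite big_cons.
rewrite big_cons; case: ifPn => // Pi.
by rewrite bmeas_intD ?ih//; [exact: bF|exact: bmeas_sum].
Qed.

Lemma bmeas_normr_int f M : bmeas f -> (forall x, S x -> `|f x| <= M) ->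
  `|\int[m]_x f x| <= M.
Proof.
move=> bf fM; rewrite ler_norml; apply/andP; split.
  rewrite -[leLHS]Rint_cst; apply: bmeas_le => //; first exact: bmeas_cst.
  by move=> x /fM; rewrite ler_norml => /andP[].
rewrite -[leRHS]Rint_cst; apply: bmeas_le => //; first exact: bmeas_cst.
by move=> x /fM; rewrite ler_norml => /andP[].
Qed.

End bounded_on_full_set.

Section square_of_full_set.
Context d (T : measurableType d) (R : realType) (m : probability T R).
Variable S : set T.
Hypotheses (mS : measurable S) (S0 : m (~` S) = 0%E).
Local Notation bm := (@bmeas _ T R S).
Local Notation S2 := (S `*` S).
Local Notation bm2 := (@bmeas _ (T * T)%type R S2).

Lemma measurable_square : measurable S2.
Proof. exact: measurableX. Qed.

Lemma square_full : (m \x m)%E (~` S2) = 0%E.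
Proof.
have mS2 := measurable_square.
rewrite probability_setC//.
have := product_measure1E m m mS mS => /= ->.
have -> : m S = 1%E.
  have := probability_setC m (measurableC mS).
  by rewrite setCK S0 sube0.
by rewrite mule1 subee.
Qed.

Lemma bmeas_fst f : bm f -> bm2 (fun z => f z.1).
Proof.
move=> [mf [M fM]]; split; first exact: (measurableT_comp mf).
by exists M => -[x y] [/= /fM].
Qed.

Lemma bmeas_snd f : bm f -> bm2 (fun z => f z.2).
Proof.
move=> [mf [M fM]]; split; first exact: (measurableT_comp mf).
by exists M => -[x y] [/= _ /fM].
Qed.

Lemma bmeas_section1 h x : S x -> bm2 h -> bm (fun y => h (x, y)).
Proof.
move=> Sx [mh [M hM]]; split; first exact: (measurableT_comp mh).
by exists M => y Sy; apply: hM.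
Qed.

Lemma bmeas_fubini_bm h : bm2 h -> bm (fun x => \int[m]_y h (x, y)).
Proof.
move=> bh; split.
  have mF : measurable_fun setT (fubini_F m (EFin \o h)).
    by apply: measurable_fubini_F; exact: (bmeas_integrable measurable_square square_full).
  exact: (measurableT_comp (@fine_measurable R setT measurableT) mF).
have [_ [M hM]] := bh; exists M => x Sx.
apply: (bmeas_normr_int mS S0); first exact: bmeas_section1.
by move=> y Sy; apply: hM.
Qed.

(** The sections outside of [S] need not be integrable, but do not matter. *)
Lemma bmeas_fubini h : bm2 h ->
  \int[(m \x m)%E]_z h z = \int[m]_x \int[m]_y h (x, y).
Proof.
move=> bh; have ih := bmeas_integrable measurable_square square_full bh.
rewrite (bmeas_intS mS S0); last exact: bmeas_fubini_bm.
rewrite {1}/Rintegral -integral12_prod_meas1//.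
rewrite (negligible_integral (measurableC mS) measurableT (integrable_fubini_F ih) S0).
rewrite setTD setCK /Rintegral; congr fine; apply: eq_integral => x; rewrite inE => Sx.
rewrite /fubini_F fineK//; apply: integrable_fin_num => //.
exact: (bmeas_integrable mS S0 (bmeas_section1 Sx bh)).
Qed.

Lemma bmeas_prod f g : bm f -> bm g ->
  \int[(m \x m)%E]_z (f z.1 * g z.2) = (\int[m]_x f x) * \int[m]_x g x.
Proof.
move=> bf bg; rewrite bmeas_fubini; last first.
  by apply: bmeasM; [exact: bmeas_fst|exact: bmeas_snd].
rewrite -(bmeas_intZr mS S0 _ bf); apply: eq_Rintegral => x _.
exact: (bmeas_intZ mS S0 (f x) bg).
Qed.

(** The variance as the mean squared difference of two independent copies. *)
Lemma integral_sqr_diff f : bm f ->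
  \int[(m \x m)%E]_z (f z.1 - f z.2) ^+ 2 =
  2 * (\int[m]_x (f x ^+ 2) - (\int[m]_x f x) ^+ 2).
Proof.
move=> bf; have mS2 := measurable_square; have S20 := square_full.
have b1 : bm (fun=> 1 : R) by exact: bmeas_cst.
have bX := bmeasX 2 bf.
rewrite (_ : (fun z : T * T => _) =
   (fun z => (f z.1 ^+ 2 * 1 - 2 * (f z.1 * f z.2)) + 1 * f z.2 ^+ 2)); last first.
  by apply/funext => z; ring.
have bp g h : bm g -> bm h -> bm2 (fun z => g z.1 * h z.2).
  by move=> bg bh; apply: bmeasM; [exact: bmeas_fst|exact: bmeas_snd].
rewrite (bmeas_intD mS2 S20); last 2 first.
- by apply: bmeasB; [exact: (bp (fun x => f x ^+ 2) (fun=> 1))|apply: bmeasZ; exact: bp].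
- exact: (bp (fun=> 1) (fun x => f x ^+ 2)).
rewrite (bmeas_intB mS2 S20); last 2 first.
- exact: (bp (fun x => f x ^+ 2) (fun=> 1)).
- by apply: bmeasZ; exact: bp.
rewrite (bmeas_intZ mS2 S20); last exact: bp.
rewrite (bmeas_prod bX b1) (bmeas_prod bf bf) (bmeas_prod b1 bX).
by rewrite Rint_cst; ring.
Qed.

End square_of_full_set.

(** * Continuously differentiable functions and difference quotients *)

Section C1_functions.
Context (R : realType).
Implicit Types (f g : R -> R) (x y r : R).

Lemma is_derive_quadratic f x d C :
  (forall h, `|f (h + x) - f x - d * h| <= C * h ^+ 2) -> is_derive x 1 f d.
Proof.
move=> fC.
have C0 : 0 <= C.
  by have := fC 1; rewrite expr1n !mulr1; exact: le_trans (normr_ge0 _).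
have lim0 : (h^-1 *: (f (h *: 1 + x) - f x) @[h --> 0^']) --> d.
  apply/cvgrPdist_le => e e0; near=> h.
  have h0 : h != 0 by near: h; exact: nbhs_dnbhs_neq.
  have hC : C * `|h| <= e.
    have : `|h| <= e / (C + 1).
      near: h; apply: dnbhs0_le; rewrite divr_gt0//; lra.
    rewrite ler_pdivlMr; last lra.
    by move=> /(le_trans _); apply; rewrite mulrC ler_wpM2l//; lra.
  rewrite [_ *: 1]mulr1; apply: le_trans hC.
  rewrite -(@ler_pM2r _ `|h|) ?normr_gt0// -normrM -mulrA -expr2.
  rewrite (_ : _ * h = - (f (h + x) - f x - d * h)); last first.
    by rewrite /GRing.scale/=; field.
  by rewrite normrN real_normK ?num_real.
apply: DeriveDef; first by apply/cvg_ex; exists d.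
exact/cvg_lim.
Unshelve. all: by end_near. Qed.

Lemma C1_is_derive f : C1 f -> forall x, is_derive x 1 f (derive1 f x).
Proof. by move=> [df _] x; apply: DeriveDef => //; rewrite derive1E. Qed.

Lemma C1_intro f df : (forall x, is_derive x 1 f (df x)) -> continuous df ->
  C1 f /\ derive1 f = df.
Proof.
move=> fdf cdf.
have e : derive1 f = df.
  by apply/funext => x; rewrite derive1E; apply: derive_val.
by split=> //; split; [move=> x; exact: ex_derive|rewrite e].
Qed.

Lemma derivable_all_continuous f : (forall x, derivable f x 1) -> continuous f.
Proof. by move=> df x; apply/differentiable_continuous/derivable1_diffP. Qed.

Lemma C1_continuous f : C1 f -> continuous f.
Proof. by move=> [df _]; exact: derivable_all_continuous. Qed.

(** The square of the positive part, a C^1 building block for cutoff functions. *)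
Definition sqpos x : R := Num.max 0 x ^+ 2.

Lemma is_derive_sqpos x : is_derive x 1 sqpos (2 * Num.max 0 x).
Proof.
apply: (@is_derive_quadratic _ _ _ 1) => h; rewrite /sqpos ler_norml mul1r.
by case: (leP 0 x) => x0; case: (leP 0 (h + x)) => hx0; apply/andP; split; nra.
Qed.

Lemma continuous_max0 : continuous (fun x => 2 * Num.max 0 x).
Proof.
move=> x; apply: cvgM; first exact: cvg_cst.
by apply: continuous_max; [exact: cvg_cst|exact: cvg_id].
Qed.

Lemma C1_comp f g : C1 f -> C1 g ->
  C1 (f \o g) /\ derive1 (f \o g) = fun x => derive1 f (g x) * derive1 g x.
Proof.
move=> cf cg; apply: C1_intro.
  by move=> x; apply: is_derive1_comp; exact: C1_is_derive.
move=> x; apply: cvgM; last by case: cg => _; apply.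
apply: continuous_comp; first exact: C1_continuous.
by case: cf => _; apply.
Qed.

Lemma C1_add f g : C1 f -> C1 g ->
  C1 (fun x => f x + g x) /\ derive1 (fun x => f x + g x) = fun x => derive1 f x + derive1 g x.
Proof.
move=> cf cg; apply: C1_intro.
  by move=> x; apply: is_deriveD; exact: C1_is_derive.
by move=> x; apply: cvgD; [case: cf => _; apply|case: cg => _; apply].
Qed.

Lemma C1_mul f g : C1 f -> C1 g ->
  C1 (fun x => f x * g x) /\ derive1 (fun x => f x * g x) = fun x => derive1 f x * g x + f x * derive1 g x.
Proof.
move=> cf cg; apply: C1_intro.
  move=> x; rewrite addrC [derive1 f x * _]mulrC; apply: is_deriveM; exact: C1_is_derive.
move=> x; apply: cvgD; apply: cvgM.
- by case: cf => _; apply.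
- exact: C1_continuous.
- exact: C1_continuous.
- by case: cg => _; apply.
Qed.

Lemma C1_cst c : C1 (fun=> c : R) /\ derive1 (fun=> c : R) = fun=> 0.
Proof.
by apply: C1_intro => x; exact: cvg_cst.
Qed.

Lemma C1_id : C1 (@id R) /\ derive1 (@id R) = fun=> 1.
Proof.
by apply: C1_intro => x; exact: cvg_cst.
Qed.

Lemma C1_scale c f : C1 f -> C1 (fun x => c * f x) /\ derive1 (fun x => c * f x) = fun x => c * derive1 f x.
Proof.
move=> cf; have [H1 H2] := C1_mul (C1_cst c).1 cf; split => //.
by rewrite H2 (C1_cst c).2; apply/funext => x; rewrite mul0r add0r.
Qed.

Lemma C1_sqpos : C1 sqpos /\ derive1 sqpos = fun x => 2 * Num.max 0 x.
Proof. by apply: C1_intro; [exact: is_derive_sqpos|exact: continuous_max0]. Qed.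

(** A C^1 function equal to [1] on [[-r, r]] and to [0] outside of
    [[-(r + 1), r + 1]]. *)
Definition bump r x : R := sqpos (1 + (-1) * (sqpos (x + (- r)) + sqpos (-1 * x + (- r)))).

Lemma C1_bump r : C1 (bump r) /\ (forall x, `|x| <= r -> bump r x = 1 /\ derive1 (bump r) x = 0) /\
  (forall x, r + 1 < `|x| -> bump r x = 0).
Proof.
have [cs ds] := C1_sqpos.
have [c1 d1] := C1_add C1_id.1 (C1_cst (- r)).1.
have [c2 d2] := C1_add (C1_scale (-1) C1_id.1).1 (C1_cst (- r)).1.
have [c3 d3] := C1_comp cs c1.
have [c4 d4] := C1_comp cs c2.
have [c5 d5] := C1_add c3 c4.
have [c6 d6] := C1_scale (-1) c5.
have [c7 d7] := C1_add (C1_cst 1).1 c6.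
have [c8 d8] := C1_comp cs c7.
split; first exact: c8.
split.
  move=> x; rewrite ler_norml => /andP[rx xr]; split.
    rewrite /bump /sqpos (max_l (_ : x + - r <= 0)); last lra.
    rewrite (max_l (_ : -1 * x + - r <= 0)); last lra.
    by rewrite expr0n/= addr0 mulr0 addr0 max_r// expr1n.
  rewrite [bump r](_ : _ = sqpos \o (fun x => 1 + -1 *
    ((sqpos \o (fun x => x + (- r))) x + (sqpos \o (fun x => -1 * x + (- r))) x)))//.
  rewrite d8 d7 d6 d5 d3 d4 ds /= (max_l (_ : x + - r <= 0)); last lra.
  rewrite (max_l (_ : -1 * x + - r <= 0)); last lra.
  by rewrite (C1_cst 1).2 !(mul0r, mulr0, addr0).
move=> x rx; rewrite /bump /sqpos; case: (ltP 0 x) => x0.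
  rewrite gtr0_norm// in rx.
  rewrite (max_l (_ : 1 + _ <= 0)) ?expr0n//.
  rewrite (max_r (_ : 0 <= x + - r)); last lra.
  by have := sqr_ge0 (Num.max 0 (-1 * x + - r)); nra.
rewrite ler0_norm// in rx.
rewrite (max_l (_ : 1 + _ <= 0)) ?expr0n//.
rewrite (max_r (_ : 0 <= -1 * x + - r)); last lra.
by have := sqr_ge0 (Num.max 0 (x + - r)); nra.
Qed.

(** Every C^1 function agrees on a given ball, together with its derivative, with
    a compactly supported one. *)
Lemma C1_cutoff f r : C1 f -> exists g, [/\ C1 g, compactly_supported g &
  forall x, `|x| <= r -> g x = f x /\ derive1 g x = derive1 f x].
Proof.
move=> cf; have [cb [b1 b0]] := C1_bump r.
have [cfb dfb] := C1_mul cf cb.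
exists (fun x => f x * bump r x); split=> //.
  apply: (subclosed_compact _ (@segment_compact _ (- (r + 1)) (r + 1))).
    exact: closed_closure.
  rewrite [X in _ `<=` X](closure_id _).1; last exact: itv_closed.
  apply: closure_subset => x /=; rewrite in_itv/= -ler_norml; apply: contraNT.
  by rewrite -ltNge => /b0 ->; rewrite mulr0.
by move=> x /b1[bx dbx]; rewrite dfb bx dbx !mulr1 mulr0 addr0.
Qed.

Lemma measurable_inv : measurable_fun [set: R] (@GRing.inv R).
Proof.
rewrite -(setUv [set 0]); apply/measurable_funU => //; first exact: measurableC.
split; first exact: measurable_fun_set1.
apply: open_continuous_measurable_fun; first by rewrite openC; exact: closed_eq.
by move=> x; rewrite inE => /eqP x0; exact: inv_continuous.
Qed.

Lemma measurable_diffquot f : C1 f ->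
  measurable_fun setT (fun z : measurableTypeR R * measurableTypeR R => diffquot f z.1 z.2).
Proof.
move=> cf; have mf : measurable_fun setT f.
  by apply: continuous_measurable_fun; exact: C1_continuous.
apply: measurable_fun_ifT.
- exact: measurable_fun_eqr.
- apply: (measurableT_comp (f := derive1 f)) => //.
  by apply: continuous_measurable_fun; case: cf.
- apply: measurable_funM.
    by apply: measurable_funB; exact: (measurableT_comp mf).
  by apply: (measurableT_comp measurable_inv); exact: measurable_funB.
Qed.

Lemma diffquot_mvt f x y : C1 f ->
  exists2 c, Num.min x y <= c <= Num.max x y & diffquot f x y = derive1 f c.
Proof.
move=> cf; rewrite /diffquot; have D := C1_is_derive cf; have cc := C1_continuous cf.
have main a b : a < b -> exists2 c, a <= c <= b & f b - f a = derive1 f c * (b - a).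
  move=> ab; have [c] := MVT ab (fun x _ => D x) (continuous_subspaceT cc).
  by rewrite in_itv/= => /andP[ac cb] e; exists c => //; rewrite !ltW.
case: eqVneq => [<-|xy].
  by exists x => //; rewrite minxx maxxx lexx.
case: (ltgtP x y) xy => // xy _.
  by have [c ab e] := main _ _ xy; exists c => //; rewrite -opprB e -[x - y]opprB; field; lra.
by have [c ab e] := main _ _ xy; exists c => //; rewrite e; field; lra.
Qed.

Lemma continuous_bounded_itv f r : continuous f -> exists M : R, forall x, `|x| <= r -> `|f x| <= M.
Proof.
move=> cf; have := continuous_compact (continuous_subspaceT cf) (@segment_compact _ (- r) r).
move=> /compact_bounded [M [_ HM]]; exists (M + 1) => x xr.
apply: (HM (M + 1)); first lra.
by exists x => //=; rewrite in_itv/= -ler_norml.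
Qed.

Lemma continuous_bmeas_itv (x y : R) f : continuous f ->
  bmeas (`[x, y]%classic : set (measurableTypeR R)) (f : measurableTypeR R -> R).
Proof.
move=> cf; split; first exact: continuous_measurable_fun.
have [M HM] := continuous_bounded_itv (`|x| + `|y|) cf.
exists M => z; rewrite /= in_itv/= => /andP[xz zy]; apply: HM.
have := ler_norm (- x); have := ler_norm y; rewrite normrN ler_norml => *.
by have := normr_ge0 x; have := normr_ge0 y => *; apply/andP; split; lra.
Qed.

Lemma diffquot_bounded f r : C1 f ->
  exists M : R, forall x y, `|x| <= r -> `|y| <= r -> `|diffquot f x y| <= M.
Proof.
move=> cf; have [M HM] := continuous_bounded_itv r (cf.2).
exists M => x y xr yr.
have [c] := diffquot_mvt x y cf; rewrite ge_min le_max => /andP[c1 c2] ->.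
apply: HM; move: xr yr; rewrite !ler_norml => /andP[x1 x2] /andP[y1 y2].
by apply/andP; split; case/orP: c1 => ?; case/orP: c2 => ?; lra.
Qed.

End C1_functions.

(** * Measures with compact support *)

Section compact_support.
Context (R : realType) (mu : probR R).
Hypothesis mu_compact : compact (supp mu).
Local Notation K := (supp mu : set (measurableTypeR R)).

Lemma supp_closed : closed K.
Proof. exact: (compact_closed (@Rhausdorff R)). Qed.

Lemma supp_measurable : measurable K.
Proof. exact: closed_measurable supp_closed. Qed.

(** The complement of the support is covered by the countably many null open
    intervals with rational endpoints. *)
Lemma supp_full : mu (~` K) = 0%E.
Proof.
apply/(@negligibleP _ _ _ mu _ (measurableC supp_measurable)).
pose F n : set (measurableTypeR R) := if @unpickle (rat * rat)%type n is Some pq then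
   if `[< mu `]ratr pq.1, ratr pq.2[%classic = 0%E >] then `]ratr pq.1, ratr pq.2[%classic else set0
  else set0.
apply: (@negligibleS _ _ _ mu (\bigcup_n F n)).
  move=> x /= /existsNP[U /not_implyP[oU /not_implyP[Ux /negP]]].
  rewrite -leNgt => U0.
  have [e /= e0 eU] : nbhs_ball x U by rewrite nbhs_ballE; exact: open_nbhs_nbhs.
  have [p] := @rat_in_itvoo R (x - e) x ltac:(lra).
  have [q] := @rat_in_itvoo R x (x + e) ltac:(lra).
  rewrite !in_itv/= => /andP[q1 q2] /andP[p1 p2].
  have [n Hn] : exists n, @unpickle (rat * rat)%type n = Some (p, q).
    by exists (pickle (p, q)); rewrite pickleK.
  exists n; first by [].
  rewrite /F Hn asboolT/=.
    by rewrite in_itv/= p2 q1.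
  apply/eqP; rewrite eq_le measure_ge0 andbT; apply: le_trans U0.
  apply: le_measure; rewrite ?inE//; first exact: open_measurable.
  apply: subset_trans eU; rewrite ball_itv => y /=; rewrite !in_itv/= => /andP[? ?].
  by apply/andP; split; lra.
apply: negligible_bigcup => n; rewrite /F; case: unpickle => [pq|]; last exact: negligible_set0.
case: asboolP => [|_]; last exact: negligible_set0.
by move=> H; apply/negligibleP.
Qed.

Lemma supp_nonempty : K !=set0.
Proof.
apply/set0P/eqP => K0; have := supp_full; rewrite K0 setC0 probability_setT.
by case=> /eqP; rewrite oner_eq0.
Qed.

Lemma supp_bounded : exists r : R, 0 < r /\ forall x : R, K x -> `|x| <= r.
Proof.
have [M [_ HM]] := compact_bounded mu_compact.
have M1 : M < `|M| + 1 by have := ler_norm M; lra.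
exists (`|M| + 1); split; first by have := normr_ge0 M; lra.
by move=> x Kx; apply: (HM _ M1).
Qed.

Local Notation bm := (@bmeas _ (measurableTypeR R) R K).
Local Notation bm2 := (@bmeas _ (measurableTypeR R * measurableTypeR R)%type R (K `*` K)).

Lemma continuous_bmeas (f : R -> R) : continuous f -> bm f.
Proof.
move=> cf; split; first exact: continuous_measurable_fun.
have [r [_ Kr]] := supp_bounded.
have [M HM] := continuous_bounded_itv r cf.
by exists M => x /Kr /HM.
Qed.

Lemma C1_bmeas (f : R -> R) : C1 f -> bm f.
Proof. by move=> /C1_continuous; exact: continuous_bmeas. Qed.

Lemma diffquot_bmeas (f : R -> R) : C1 f -> bm2 (fun z => diffquot f z.1 z.2).
Proof.
move=> cf; split; first exact: measurable_diffquot.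
have [r [_ Kr]] := supp_bounded.
have [M HM] := diffquot_bounded r cf.
by exists M => -[x y] [/= /Kr Kx /Kr Ky]; apply: HM.
Qed.

Lemma Var_sqr_diff (f : R -> R) : bm f ->
  \int[(mu \x mu)%E]_z (f z.1 - f z.2) ^+ 2 = 2 * Var mu f.
Proof. exact: (integral_sqr_diff supp_measurable supp_full). Qed.

(** By truncating outside the support, the inequality extends to all C^1
    functions. *)
Lemma poincare_C1 (C : R) (f : R -> R) : poincare_inequality mu C -> C1 f ->
  C * Var mu f <= free_dirichlet mu f.
Proof.
move=> [_ HC] cf; have [r [r0 Kr]] := supp_bounded.
have [g [cg sg gf]] := C1_cutoff r cf.
have := HC g cg sg.
have e1 : Var mu g = Var mu f.
  rewrite /Var; congr (_ - _ ^+ 2).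
    apply: (bmeas_eq supp_measurable supp_full).
    - by apply: (bmeasX 2); exact: C1_bmeas.
    - by apply: (bmeasX 2); exact: C1_bmeas.
    - by move=> x /Kr /gf[->].
  apply: (bmeas_eq supp_measurable supp_full).
  - exact: C1_bmeas.
  - exact: C1_bmeas.
  - by move=> x /Kr /gf[->].
have e2 : free_dirichlet mu g = free_dirichlet mu f.
  apply: (bmeas_eq (measurable_square supp_measurable) (square_full supp_measurable supp_full)).
  - by apply: (bmeasX 2); exact: diffquot_bmeas.
  - by apply: (bmeasX 2); exact: diffquot_bmeas.
  - move=> [x y] [/= /Kr Kx /Kr Ky]; rewrite /diffquot.
    by have [-> ->] := gf _ Kx; have [-> _] := gf _ Ky.
by rewrite e1 e2.
Qed.

Lemma inf_supp : K (inf K) /\ K (sup K) /\ forall x : R, K x -> inf K <= x <= sup K.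
Proof.
have [r [_ Kr]] := supp_bounded; have n0 := supp_nonempty.
have hu : has_ubound K by exists r => x /Kr; rewrite ler_norml => /andP[].
have hl : has_lbound K by exists (- r) => x /Kr; rewrite ler_norml => /andP[].
split; last split.
- apply: supp_closed => U /nbhs_ballP[e /= e0 eU].
  have [x Kx xe] := inf_adherent e0 (conj n0 hl).
  exists x; split => //; apply: eU; rewrite ball_itv/= in_itv/=.
  by have := ge_inf hl Kx; move=> ?; apply/andP; split; lra.
- by apply: supp_closed; exact: closure_sup.
- by move=> x Kx; rewrite ge_inf//= ub_le_sup.
Qed.

Lemma diam_supp : diam K = sup K - inf K.
Proof.
have [Ki [Ks Kx]] := inf_supp.
have is_le := Kx _ Ki.
apply/eqP; rewrite eq_le; apply/andP; split.
  apply: ge_sup.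
    by exists `|inf K - inf K|, (inf K), (inf K).
  move=> _ [x [y [/Kx x1 /Kx y1 ->]]]; rewrite ler_norml; apply/andP; split; lra.
apply: ub_le_sup.
  exists (sup K - inf K) => _ [x [y [/Kx x1 /Kx y1 ->]]].
  rewrite ler_norml; apply/andP; split; lra.
by exists (sup K), (inf K); split => //; rewrite ger0_norm//; lra.
Qed.

Hypothesis mu_not_dirac : ~ exists a : R, mu [set a] = 1%E.

Lemma inf_lt_sup : inf K < sup K.
Proof.
have [Ki [Ks Kx]] := inf_supp.
rewrite ltNge; apply/negP => si; apply: mu_not_dirac; exists (inf K).
have : mu (~` [set inf K]) = 0%E.
  apply/(@negligibleP _ _ _ mu _ (measurableC (measurable_set1 _))).
  apply: negligibleS ((@negligibleP _ _ _ mu _ (measurableC supp_measurable)).2 supp_full).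
  by apply: subsetC => x /Kx xi /=; apply/eqP; rewrite eq_le; apply/andP; split; lra.
rewrite probability_setC//= => /eqP; rewrite sube_eq//.
by rewrite add0e eq_sym => /eqP.
Qed.

Lemma diam_gt0 : 0 < diam K.
Proof. by rewrite diam_supp subr_gt0 inf_lt_sup. Qed.

End compact_support.

(** * The two bounds on the Poincaré constant *)

Section poincare_bounds.
Context (R : realType) (mu : probR R).
Hypothesis mu_compact : compact (supp mu).
Local Notation K := (supp mu : set (measurableTypeR R)).
Local Notation bm := (@bmeas _ (measurableTypeR R) R K).
Local Notation bm2 := (@bmeas _ (measurableTypeR R * measurableTypeR R)%type R (K `*` K)).
Let mK := supp_measurable mu_compact.
Let K0 := supp_full mu_compact.
Let mK2 := measurable_square mK.
Let K20 := square_full mK K0.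

Lemma diffquotE (f : R -> R) x y : f x - f y = diffquot f x y * (x - y).
Proof.
rewrite /diffquot; case: eqVneq => [->|xy]; first by rewrite !subrr mulr0.
by field; rewrite subr_eq0.
Qed.

Lemma sqr_le_sqr (t u : R) : - u <= t -> t <= u -> t ^+ 2 <= u ^+ 2.
Proof. by move=> *; nra. Qed.

Lemma Var_ge0 (f : R -> R) : bm f -> 0 <= Var mu f.
Proof.
move=> bf; have := Var_sqr_diff mu_compact bf.
suff : 0 <= \int[(mu \x mu)%E]_z (f z.1 - f z.2) ^+ 2 by lra.
by apply: Rintegral_ge0 => z _; exact: sqr_ge0.
Qed.

Lemma free_dirichlet_ge0 (f : R -> R) : 0 <= free_dirichlet mu f.
Proof. by apply: Rintegral_ge0 => z _; exact: sqr_ge0. Qed.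

Lemma bm2_sqr_diff (f : R -> R) : bm f -> bm2 (fun z => (f z.1 - f z.2) ^+ 2).
Proof.
by move=> bf; apply: (bmeasX 2); apply: bmeasB; [exact: bmeas_fst|exact: bmeas_snd].
Qed.

Lemma bmeas_indic (U : set (measurableTypeR R)) : measurable U -> bm (\1_U : R -> R).
Proof.
move=> mU; split; first exact: measurable_indic.
by exists 1 => x _; rewrite indicE; case: (_ \in _); rewrite ?normr1 ?normr0.
Qed.

Lemma Rint_indic (U : set (measurableTypeR R)) : measurable U ->
  \int[mu]_x (\1_U x : R) = fine (mu U).
Proof. by move=> mU; rewrite /Rintegral integral_indic// setIT. Qed.

Lemma fine_measure_gt0 (U : set (measurableTypeR R)) : measurable U ->
  (0 < mu U)%E -> 0 < fine (mu U).
Proof.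
move=> mU U0; apply: fine_gt0; rewrite U0/=.
by rewrite -ge0_fin_numE// fin_num_measure.
Qed.

(** Neighbourhoods of [x] and [y] on which [f] takes values far apart both have
    positive mass. *)
Lemma Var_gt0 (f : R -> R) x y : continuous f -> K x -> K y -> f x != f y ->
  0 < Var mu f.
Proof.
move=> cf Kx Ky fxy; have bf := continuous_bmeas mu_compact cf.
have h0 : 0 < `|f x - f y| by rewrite normr_gt0 subr_eq0.
set h := `|f x - f y| in h0.
pose U w : set (measurableTypeR R) := f @^-1` ball w (h / 3).
have oU w : open (U w) by apply: open_comp => [z _|]; [exact: cf|exact: ball_open].
have mU w : measurable (U w) by apply: open_measurable; exact: oU.
have Uf w : U (f w) w by apply: ballxx; lra.
have Ux0 := fine_measure_gt0 (mU _) (Kx _ (oU _) (Uf _)).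
have Uy0 := fine_measure_gt0 (mU _) (Ky _ (oU _) (Uf _)).
have : (h / 3) ^+ 2 * (fine (mu (U (f x))) * fine (mu (U (f y)))) <= 2 * Var mu f.
  rewrite -(Var_sqr_diff mu_compact bf) -!Rint_indic//.
  have b1 := bmeas_indic (mU (f x)); have b2 := bmeas_indic (mU (f y)).
  rewrite -(bmeas_prod mK K0 b1 b2).
  have b3 : bm2 (fun z => \1_(U (f x)) z.1 * \1_(U (f y)) z.2).
    by apply: bmeasM; [exact: bmeas_fst|exact: bmeas_snd].
  rewrite -(bmeas_intZ mK2 K20 _ b3).
  apply: (bmeas_le mK2 K20); [exact: bmeasZ|exact: bm2_sqr_diff|].
  move=> [z w] _ /=; rewrite !indicE.
  have [zx|_] := boolP (z \in _); last by rewrite mul0r mulr0 sqr_ge0.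
  have [wy|_] := boolP (w \in _); last by rewrite !mulr0 sqr_ge0.
  move: zx wy; rewrite !inE /U /= /ball/= => zx wy; rewrite !mulr1.
  have : h / 3 <= `|f z - f w|.
    have : h <= `|f x - f z| + (`|f z - f w| + `|f w - f y|).
      rewrite /h (_ : f x - f y = (f x - f z) + ((f z - f w) + (f w - f y))); last by ring.
      by apply: (le_trans (ler_normD _ _)); rewrite lerD2l ler_normD.
    by rewrite [`|f w - f y|]distrC; lra.
  by move=> H; rewrite -[leRHS]real_normK ?num_real// lerXn2r// nnegrE; lra.
by have : 0 < (h / 3) ^+ 2 * (fine (mu (U (f x))) * fine (mu (U (f y))));
  [rewrite !mulr_gt0//; lra | lra].
Qed.

Hypothesis mu_not_dirac : ~ exists a : R, mu [set a] = 1%E.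
Local Notation d := (diam (supp mu)).
Local Notation a := (inf K).
Local Notation b := (sup K).

Lemma Var_id_gt0 : 0 < Var mu id.
Proof.
have [Ka [Kb _]] := inf_supp mu_compact.
have ab := inf_lt_sup mu_compact mu_not_dirac.
apply: (Var_gt0 (x := a) (y := b)) => //=; first by move=> x; exact: cvg_id.
by rewrite lt_eqF.
Qed.

Lemma free_dirichlet_lower (f : R -> R) : C1 f -> 2 / d ^+ 2 * Var mu f <= free_dirichlet mu f.
Proof.
move=> cf; have bf := C1_bmeas mu_compact cf; have d0 := diam_gt0 mu_compact mu_not_dirac.
have dE := diam_supp mu_compact; have [_ [_ Kx]] := inf_supp mu_compact.
rewrite mulrAC ler_pdivrMr ?exprn_gt0// -(Var_sqr_diff mu_compact bf) mulrC.
have bq := bmeasX 2 (diffquot_bmeas mu_compact cf).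
rewrite -(bmeas_intZ mK2 K20 _ bq).
apply: (bmeas_le mK2 K20); [exact: bm2_sqr_diff|exact: bmeasZ|].
move=> [x y] [/= /Kx xi /Kx yi]; rewrite diffquotE exprMn mulrC ler_wpM2r ?sqr_ge0//.
by apply: sqr_le_sqr; lra.
Qed.

Lemma poincare_diam : poincare_inequality mu (2 / d ^+ 2).
Proof.
have d0 := diam_gt0 mu_compact mu_not_dirac.
by split; [rewrite divr_gt0// exprn_gt0|move=> f cf _; exact: free_dirichlet_lower].
Qed.

Lemma free_dirichlet_id : free_dirichlet mu id = 1.
Proof.
rewrite /free_dirichlet (_ : (fun z => _) = fun=> 1); first exact: Rint_cst.
apply/funext => z; rewrite /diffquot; case: eqVneq => [_|xy].
  by rewrite (C1_id R).2 expr1n.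
by rewrite divff ?expr1n// subr_eq0.
Qed.

(** The identity has difference quotient [1]. *)
Lemma poincare_le_Var (C : R) : poincare_inequality mu C -> C <= 1 / Var mu id.
Proof.
move=> HC; have := poincare_C1 mu_compact HC (C1_id R).1.
by rewrite free_dirichlet_id ler_pdivlMr// Var_id_gt0.
Qed.

Lemma poincare_le_Poin (C : R) : poincare_inequality mu C -> C <= Poin mu.
Proof.
by move=> HC; apply: ub_le_sup => //; exists (1 / Var mu id) => c /poincare_le_Var.
Qed.

Lemma Poin_le_Var : Poin mu <= 1 / Var mu id.
Proof.
apply: ge_sup; first by exists (2 / d ^+ 2); exact: poincare_diam.
by move=> c /poincare_le_Var.
Qed.

Lemma poincare_Poin : poincare_inequality mu (Poin mu).
Proof.
have H0 := poincare_diam; split; first exact: lt_le_trans H0.1 (poincare_le_Poin H0).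
move=> f cf sf; have := Var_ge0 (C1_bmeas mu_compact cf).
rewrite le_eqVlt => /predU1P[<-|V0]; first by rewrite mulr0 free_dirichlet_ge0.
rewrite -ler_pdivlMr//; apply: ge_sup; first by exists (2 / d ^+ 2).
by move=> c [_ Hc]; rewrite ler_pdivlMr//; exact: Hc.
Qed.

(** Mass in the open interior of the convex hull of the support improves the
    constant: a pair with one point at distance at least [e] from both extremities
    is at distance at most [d - e]. *)
Lemma poincare_improved (e : R) : 0 < e -> e < d -> (0 < mu `](a + e)%R, (b - e)%R[%classic)%E ->
  2 / d ^+ 2 < Poin mu.
Proof.
move=> e0 ed; set M := `]_, _[%classic => M0.
have mM : measurable (M : set (measurableTypeR R)) by exact: measurable_itv.
have m0 := fine_measure_gt0 mM M0.
have d0 := diam_gt0 mu_compact mu_not_dirac.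
have dE := diam_supp mu_compact; have [_ [_ Kx]] := inf_supp mu_compact.
pose g := (d - e) ^- 2 - d ^- 2.
have g0 : 0 < g.
  rewrite /g subr_gt0 ltf_pV2 ?posrE ?exprn_gt0//; last lra.
  rewrite ltr_pXn2r// ?nnegrE; lra.
suff H : poincare_inequality mu (2 / d ^+ 2 + g * fine (mu M)).
  apply: lt_le_trans (poincare_le_Poin H).
  by rewrite ltrDl mulr_gt0.
split; first by rewrite addr_gt0 ?mulr_gt0// invr_gt0 exprn_gt0.
move=> f cf _; have bf := C1_bmeas mu_compact cf; have bM := bmeas_indic mM.
have bq := bmeasX 2 (diffquot_bmeas mu_compact cf).
have bs := bm2_sqr_diff bf.
have b3 : bm2 (fun z => \1_M z.1 * (f z.1 - f z.2) ^+ 2).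
  by apply: bmeasM => //; exact: bmeas_fst.
have I1 : fine (mu M) * Var mu f <= \int[(mu \x mu)%E]_z (\1_M z.1 * (f z.1 - f z.2) ^+ 2).
  rewrite (bmeas_fubini mK K0 b3) -Rint_indic// -(bmeas_intZr mK K0 _ bM).
  apply: (bmeas_le mK K0).
  - by apply: bmeasM => //; exact: bmeas_cst.
  - exact: (bmeas_fubini_bm mK K0 b3).
  move=> x _ /=.
  have bX := bmeasX 2 bf.
  (* the mean of [(f x - f y) ^ 2] over [y] is [Var f + (f x - mean f) ^ 2] *)
  rewrite (_ : (fun y => _) =
    (fun y => \1_M x * (f x ^+ 2) + (- (\1_M x * (2 * f x))) * f y + \1_M x * f y ^+ 2)); last first.
    by apply/funext => y; ring.
  have b4 := bmeas_cst K (\1_M x * (f x ^+ 2)).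
  have b5 := bmeasZ (- (\1_M x * (2 * f x))) bf.
  rewrite (bmeas_intD mK K0 (bmeasD b4 b5) (bmeasZ _ bX)) (bmeas_intD mK K0 b4 b5).
  rewrite (bmeas_intZ mK K0 _ bf) (bmeas_intZ mK K0 _ bX) Rint_cst /Var.
  have -> : forall t I1 I2 : R, t * f x ^+ 2 + - (t * (2 * f x)) * I1 + t * I2 =
     t * ((I2 - I1 ^+ 2) + (f x - I1) ^+ 2) by move=> *; ring.
  by rewrite ler_wpM2l// ?indicE// lerDl sqr_ge0.
have bs1 := bmeasZ (d ^- 2) bs; have b31 := bmeasZ g b3.
apply: (@le_trans _ _ (\int[(mu \x mu)%E]_z (d ^- 2 * (f z.1 - f z.2) ^+ 2 + g * (\1_M z.1 * (f z.1 - f z.2) ^+ 2)))).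
  rewrite (bmeas_intD mK2 K20 bs1 b31) (bmeas_intZ mK2 K20 _ bs) (bmeas_intZ mK2 K20 _ b3).
  rewrite (Var_sqr_diff mu_compact bf) mulrDl lerD//.
    by rewrite le_eqVlt; apply/orP; left; apply/eqP; ring.
  by rewrite -mulrA ler_wpM2l// ltW.
apply: (bmeas_le mK2 K20) => //; first exact: bmeasD.
move=> [x y] [/= Kx1 Ky1]; have xi := Kx _ Kx1; have yi := Kx _ Ky1.
rewrite diffquotE (_ : _ + _ = diffquot f x y ^+ 2 * ((d ^- 2 + g * \1_M x) * (x - y) ^+ 2)); last by ring.
rewrite -[leRHS]mulr1 ler_wpM2l ?sqr_ge0//.
rewrite indicE; have [|_] := boolP (x \in _).
  move=> /set_mem; rewrite /M/= in_itv/= => /andP[x1 x2].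
  rewrite mulr1 /g addrC subrK mulrC ler_pdivrMr ?exprn_gt0//; last lra.
  by rewrite mul1r; apply: sqr_le_sqr; lra.
rewrite mulr0 addr0 mulrC ler_pdivrMr ?exprn_gt0// mul1r.
by apply: sqr_le_sqr; lra.
Qed.

End poincare_bounds.

(** * The lower bound is attained at two-point laws only *)

Section two_point.
Context (R : realType) (mu : probR R).
Hypothesis mu_compact : compact (supp mu).
Hypothesis mu_not_dirac : ~ exists a : R, mu [set a] = 1%E.
Local Notation K := (supp mu : set (measurableTypeR R)).
Local Notation d := (diam (supp mu)).
Let mK := supp_measurable mu_compact.
Let K0 := supp_full mu_compact.

Lemma not_in_supp_null (A : set (measurableTypeR R)) : measurable A ->
  (forall x, A x -> ~ K x) -> mu A = 0%E.
Proof.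
move=> mA AK; apply/eqP; rewrite eq_le measure_ge0 andbT -[leRHS]K0.
by apply: le_measure; rewrite ?inE//; exact: measurableC.
Qed.

Lemma mu_setI_supp (A : set (measurableTypeR R)) : measurable A -> mu A = mu (A `&` K).
Proof.
move=> mA; rewrite -[in LHS](setUIDK A K) measureU//.
- rewrite -[RHS]adde0; congr (_ + _)%E.
  by apply: not_in_supp_null; [exact: measurableD|move=> x []].
- exact: measurableI.
- exact: measurableD.
- by rewrite -subset0 => x [[_ ?] []].
Qed.

Lemma supp_pair_two_point (a b : R) : a < b -> K a -> K b ->
  (forall x, K x -> x = a \/ x = b) ->
  exists2 alpha, 0 < alpha < 1 & forall A : set (measurableTypeR R), measurable A ->
             mu A = two_point_law alpha a b A.
Proof.
move=> ab Ka Kb Kab.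
have pos x y (U : set R) : open U -> U x -> ~ U y -> K x -> (forall z, K z -> z = x \/ z = y) ->
    (0 < mu [set x])%E.
  move=> oU Ux Uy Kx Kxy; apply: (lt_le_trans (Kx U oU Ux)).
  rewrite -[leRHS]adde0 -(@not_in_supp_null (U `\` [set x])).
  - have mU : measurable (U : set (measurableTypeR R)) by exact: open_measurable.
    have m1 : measurable ([set x] : set (measurableTypeR R)) by exact: measurable_set1.
    rewrite -measureU//; last 2 first.
    + exact: measurableD.
    + exact: setDIK.
    apply: le_measure; rewrite ?inE//; first by apply: measurableU => //; exact: measurableD.
    by move=> z Uz; have [->|zx] := pselect (z = x); [left|right].
  - apply: measurableD; [exact: open_measurable|exact: measurable_set1].
  by move=> z [Uz zx] /Kxy[//|zy]; apply: Uy; rewrite -zy.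
have pa : (0 < mu [set a])%E.
  by apply: (pos a b `]-oo, b[%classic) => //=; rewrite in_itv/= ?ltxx.
have pb : (0 < mu [set b])%E.
  apply: (pos b a `]a, +oo[%classic) => //=; rewrite ?in_itv/= ?ltxx ?ab//.
  by move=> z /Kab[|]; [right|left].
have ma := fine_measure_gt0 (measurable_set1 _) pa.
have mb := fine_measure_gt0 (measurable_set1 _) pb.
have Ea : mu [set a] = (fine (mu [set a]))%:E by rewrite fineK// fin_num_measure.
have Eb : mu [set b] = (fine (mu [set b]))%:E by rewrite fineK// fin_num_measure.
have split2 (A : set (measurableTypeR R)) : measurable A ->
    mu A = (mu (A `&` [set a]) + mu (A `&` [set b]))%E.
  move=> mA; rewrite -measureU//; last 3 first.
  + by apply: measurableI.
  + by apply: measurableI.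
  + rewrite -subset0 => z [[_ /= ->] [_ /=]].
    by move=> e; rewrite e ltxx in ab.
  rewrite -setIUr (mu_setI_supp mA); congr (mu _).
  apply/seteqP; split=> z [Az].
    by move=> /Kab[] zE; split; [by []|left|by []|right].
  by move=> []/= zE; split=> //=; rewrite zE.
have s1 : fine (mu [set a]) + fine (mu [set b]) = 1.
  have := split2 setT measurableT; rewrite !setTI probability_setT Ea Eb -EFinD.
  by case.
exists (fine (mu [set a])); first by apply/andP; split; lra.
move=> A mA; rewrite split2// /two_point_law.
have -> : 1 - fine (mu [set a]) = fine (mu [set b]) by lra.
rewrite -Ea -Eb /dirac !indicE; congr (_ + _)%E.
  have [|] := boolP (a \in A); rewrite ?inE ?notin_setE => Aa.
    by rewrite mule1 setIidr// => z ->.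
  by rewrite mule0 (_ : A `&` _ = set0) ?measure0// -subset0 => z [/[swap] ->].
have [|] := boolP (b \in A); rewrite ?inE ?notin_setE => Ab.
  by rewrite mule1 setIidr// => z ->.
by rewrite mule0 (_ : A `&` _ = set0) ?measure0// -subset0 => z [/[swap] ->].
Qed.

(** A point of the support strictly between the extremities would have
    neighbourhoods of positive mass away from both of them. *)
Lemma Poin_diam_two_point : 2 / d ^+ 2 = Poin mu ->
  exists alpha a b : R, [/\ a < b, 0 < alpha < 1 &
           forall A : set (measurableTypeR R), measurable A ->
             mu A = two_point_law alpha a b A].
Proof.
move=> E; have [Ka [Kb Kx]] := inf_supp mu_compact.
have ab := inf_lt_sup mu_compact mu_not_dirac.
have dE := diam_supp mu_compact.
have [|alpha a01 aE] := @supp_pair_two_point _ _ ab Ka Kb; last first.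
  by exists alpha, (inf K), (sup K).
move=> x Kx1; apply: contrapT => /not_orP[xa xb].
have /andP[x1 x2] := Kx _ Kx1.
have {}x1 : inf K < x by rewrite lt_neqAle x1 eq_sym andbT; apply/eqP.
have {}x2 : x < sup K by rewrite lt_neqAle x2 andbT; apply/eqP.
pose e := Num.min (x - inf K) (sup K - x) / 2.
have e1 : e <= (x - inf K) / 2 by rewrite ler_pM2r// ge_min lexx.
have e2 : e <= (sup K - x) / 2 by rewrite ler_pM2r// ge_min lexx orbT.
have e0 : 0 < e by rewrite divr_gt0// lt_min !subr_gt0 x1.
have : 2 / d ^+ 2 < Poin mu.
  apply: (poincare_improved mu_compact mu_not_dirac e0); first lra.
  apply: Kx1; first exact: itv_open.
  by rewrite /= in_itv/=; apply/andP; split; lra.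
by rewrite E ltxx.
Qed.

Lemma two_point_supp (alpha a b : R) : a < b -> 0 < alpha < 1 ->
  (forall A : set (measurableTypeR R), measurable A -> mu A = two_point_law alpha a b A) ->
  [/\ K a, K b & forall x, K x -> x = a \/ x = b].
Proof.
move=> ab /andP[a0 a1] muE.
have sum_gt0 (x y : \bar R) : (0 <= x -> 0 < y -> 0 < y + x)%E.
  by move=> x0 y0; rewrite (lt_le_trans y0)// leeDl.
split.
- move=> U oU Ua; rewrite muE ?/two_point_law; last exact: open_measurable.
  rewrite /dirac !indicE mem_set// mule1; apply: sum_gt0; last by rewrite lte_fin.
  by rewrite mule_ge0 ?lee_fin ?subr_ge0 ?ler0n// ltW.
- move=> U oU Ub; rewrite muE ?/two_point_law; last exact: open_measurable.
  rewrite /dirac !indicE (mem_set Ub) mule1 addeC; apply: sum_gt0; last by rewrite lte_fin subr_gt0.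
  by rewrite mule_ge0 ?lee_fin ?ler0n// ltW.
move=> x Kx; apply: contrapT => /not_orP[xa xb].
have oU : open ([set z | z != a] `&` [set z | z != b]) by apply: openI; exact: open_neq.
have := Kx _ oU; move=> /(_ (conj (introN eqP xa) (introN eqP xb))).
rewrite muE; last exact: open_measurable.
rewrite /two_point_law /dirac !indicE memNset ?memNset ?mule0 ?adde0 ?ltxx//=.
  by move=> [_ /eqP].
by move=> [/eqP].
Qed.

Lemma two_point_Poin (alpha a b : R) : a < b -> 0 < alpha < 1 ->
  (forall A : set (measurableTypeR R), measurable A -> mu A = two_point_law alpha a b A) ->
  2 / d ^+ 2 = Poin mu.
Proof.
move=> ab a01 muE; have [Ka Kb Kab] := two_point_supp ab a01 muE.
have [Ki [Ks Kx]] := inf_supp mu_compact.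
have ea : inf K = a.
  have /andP[? ?] := Kx _ Ka; have /andP[? ?] := Kx _ Kb.
  by case: (Kab _ Ki) => // e; lra.
have eb : sup K = b.
  have /andP[? ?] := Kx _ Ka; have /andP[? ?] := Kx _ Kb.
  by case: (Kab _ Ks) => // e; lra.
have dE : d = b - a by rewrite diam_supp// ea eb.
apply/eqP; rewrite eq_le (poincare_le_Poin mu_compact mu_not_dirac (poincare_diam mu_compact mu_not_dirac))/=.
(* a cubic with critical points [a] and [b]: its difference quotient vanishes on
   the diagonal of the support, so that only the pairs at distance [b - a] count *)
pose f (x : R) : R := -2 * x ^+ 3 + 3 * (a + b) * x ^+ 2 - 6 * a * b * x.
pose df (x : R) : R := 6 * (x - a) * (b - x).
have [cf dfE] : C1 f /\ derive1 f = df.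
  apply: C1_intro; last first.
    move=> x; apply: cvgM; first apply: cvgM; [exact: cvg_cst| |];
      apply: cvgB; solve [exact: cvg_cst|exact: cvg_id].
  move=> x; apply: is_derive_eq.
  by rewrite /df /GRing.scale/=; ring.
have V0 : 0 < Var mu f.
  apply: (Var_gt0 mu_compact _ Ka Kb); first exact: C1_continuous.
  rewrite -subr_eq0 (_ : _ - _ = - (b - a) ^+ 3); last by rewrite /f; ring.
  by rewrite oppr_eq0 expf_eq0/= subr_eq0 gt_eqF.
rewrite -(ler_pM2r V0).
apply: le_trans (poincare_C1 mu_compact (poincare_Poin mu_compact mu_not_dirac) cf) _.
have bf := C1_bmeas mu_compact cf.
rewrite mulrAC -(Var_sqr_diff mu_compact bf) mulrC.
have mK2 := measurable_square mK; have K20 := square_full mK K0.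
have bs := bm2_sqr_diff bf.
rewrite -(bmeas_intZ mK2 K20 _ bs).
apply: (bmeas_le mK2 K20); [by apply: (bmeasX 2); exact: diffquot_bmeas|exact: bmeasZ|].
have da : df a = 0 by rewrite /df subrr mulr0 mul0r.
have db : df b = 0 by rewrite /df subrr mulr0.
have ba0 : b - a != 0 by rewrite subr_eq0 gt_eqF.
have ab0 : a - b != 0 by rewrite subr_eq0 lt_eqF.
move=> [x y] [/= /Kab xab /Kab yab]; rewrite /diffquot dfE dE.
case: xab => ->; case: yab => ->.
- by rewrite eqxx da expr0n/= mulr_ge0 ?invr_ge0 ?sqr_ge0.
- by rewrite lt_eqF// le_eqVlt; apply/orP; left; apply/eqP; field; rewrite ba0 ab0.
- by rewrite gt_eqF// le_eqVlt; apply/orP; left; apply/eqP; field.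
- by rewrite eqxx db expr0n/= mulr_ge0 ?invr_ge0 ?sqr_ge0.
Qed.

End two_point.

(** * Weierstrass approximation and determinacy by moments *)

Section weierstrass.
Context (R : realType).
Implicit Types (f h : R -> R) (t : R) (n : nat).

Lemma itv_unif_continuous f (a b : R) : continuous f -> forall e, 0 < e ->
  exists2 dl, 0 < dl & forall x y, a <= x <= b -> a <= y <= b -> `|x - y| <= dl -> `|f x - f y| <= e.
Proof.
move=> cf e e0.
have := (compact_near_coveringP `[a, b]).1 (@segment_compact _ a b).
move=> /(_ _ (0^'+) (fun dl x => forall y, `|x - y| <= dl -> `|f x - f y| <= e)).
have loc x : `[a, b]%classic x -> \forall x' \near x & dl \near 0^'+, forall y, `|x' - y| <= dl -> `|f x' - f y| <= e.
  move=> _.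
  have /cvgrPdist_lt/(_ _ (ltac:(lra) : 0 < e / 2)) := cf x.
  move=> /nbhs_ballP[r /= r0 xr].
  exists (ball x (r / 2), [set dl | dl < r / 2]).
    split => /=; first by apply: nbhsx_ballx; lra.
    by apply: nbhs_right_lt; lra.
  move=> [x' dl] [/= xx' dlr] y x'y.
  have h1 : `|f x - f x'| < e / 2.
    by apply: xr; apply: le_ball xx'; lra.
  have h2 : `|f x - f y| < e / 2.
    apply: xr; rewrite /ball/=.
    rewrite /ball/= in xx'.
    have := ler_normD (x - x') (x' - y); rewrite addrA subrK; lra.
  by have := ler_normD (f x' - f x) (f x - f y); rewrite addrA subrK (distrC (f x') (f x)); lra.
move=> /(_ _ loc) H.
near (0 : R)^'+ => dl.
exists dl; first by [].
have D : `[a, b]%classic `<=` (fun x => forall y, `|x - y| <= dl -> `|f x - f y| <= e) by near: dl.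
by move=> x y xab yab xy; apply: D => //=; rewrite in_itv.
Unshelve. all: by end_near. Qed.

(** The Bernstein polynomial of order [n] with coefficients [h 0, h 1, ..., h n].
    Its value at [t] is the expectation of [h] at a binomial variable with
    parameters [n] and [t], computed by conditioning on the first trial. *)
Fixpoint bernstein n (h : nat -> R) : {poly R} :=
  if n is n'.+1 then 'X * bernstein n' (h \o succn) + (1 - 'X) * bernstein n' h
  else (h 0%N)%:P.

Lemma bernsteinS n (h : nat -> R) t : (bernstein n.+1 h).[t] =
  t * (bernstein n (h \o succn)).[t] + (1 - t) * (bernstein n h).[t].
Proof. by rewrite /= !hornerE. Qed.

Lemma bernstein_le n (g h : nat -> R) t : 0 <= t <= 1 ->
  (forall k, (k <= n)%N -> g k <= h k) -> (bernstein n g).[t] <= (bernstein n h).[t].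
Proof.
move=> /andP[t0 t1]; elim: n g h => [|n ih] g h gh; first by rewrite !hornerC gh.
rewrite !bernsteinS lerD// ler_wpM2l ?subr_ge0// ih// => k kn.
  exact: gh.
by apply: gh; exact: leqW.
Qed.

Lemma bernstein_lin n (g h : nat -> R) (c d t : R) :
  (bernstein n (fun k => c * g k + d * h k)).[t] = c * (bernstein n g).[t] + d * (bernstein n h).[t].
Proof.
elim: n g h => [|n ih] g h; first by rewrite !hornerC.
by rewrite !bernsteinS !(ih, ih (g \o succn) (h \o succn)); ring.
Qed.

Lemma bernstein_cst n (c t : R) : (bernstein n (fun=> c)).[t] = c.
Proof.
elim: n => [|n ih]; first by rewrite hornerC.
by rewrite bernsteinS !ih; ring.
Qed.

(** The second moment of a binomial variable; the shift [c] absorbs the first trial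
    in the induction. *)
Lemma bernstein_sqr n (c t : R) : (bernstein n (fun k => (k%:R + c) ^+ 2)).[t] =
  n%:R * t * (1 - t) + (n%:R * t + c) ^+ 2.
Proof.
elim: n c => [|n ih] c; first by rewrite hornerC; ring.
have -> : bernstein n.+1 (fun k => (k%:R + c) ^+ 2) =
    'X * bernstein n (fun k => (k%:R + (1 + c)) ^+ 2) +
    (1 - 'X) * bernstein n (fun k => (k%:R + c) ^+ 2).
  by congr (_ * bernstein n _ + _); apply/funext => k /=; rewrite -natr1; ring.
by rewrite !hornerE !ih -natr1; ring.
Qed.

(** Bernstein's proof: [f] varies by at most [e / 2] near [t], and the binomial law
    puts little mass away from [t], by a variance bound. *)
Lemma weierstrass01 f : continuous f -> forall e, 0 < e ->
  exists p : {poly R}, forall t, 0 <= t <= 1 -> `|f t - p.[t]| <= e.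
Proof.
move=> cf e e0.
have [dl dl0 Hdl] := itv_unif_continuous 0 1 cf (ltac:(lra) : 0 < e / 2).
have [M HM] := continuous_bounded_itv 1 cf.
have M0 : 0 <= M by apply: le_trans (HM 0 _); rewrite ?normr0.
pose C := 2 * M / dl ^+ 2.
have C0 : 0 <= C by rewrite /C divr_ge0 ?sqr_ge0// mulr_ge0.
(* [C] bounds the oscillation of [f] far from [t] by a quadratic function, whose
   binomial mean is at most [C / n] *)
pose n := (Num.bound (C * 2 / e)).+1.
have n0 : 0 < n%:R :> R by rewrite ltr0n.
have nC : C * 2 / e < n%:R.
  apply: (lt_le_trans (archi_boundP _)); last by rewrite ler_nat.
  by apply: divr_ge0; [exact: mulr_ge0|exact: ltW].
exists (bernstein n (fun k => f (k%:R / n%:R))) => t t01.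
have /andP[t0 t1] := t01.
pose g (k : nat) : R := e / 2 + C / n%:R ^+ 2 * (k%:R + (- (n%:R * t))) ^+ 2.
have gE : (bernstein n g).[t] <= e.
  rewrite /g.
  have -> : bernstein n (fun k => e / 2 + C / n%:R ^+ 2 * (k%:R + (- (n%:R * t))) ^+ 2) =
     bernstein n (fun k => 1 * (e / 2) + (C / n%:R ^+ 2) * (k%:R + (- (n%:R * t))) ^+ 2).
    by congr (bernstein n _); apply/funext => k; rewrite mul1r.
  rewrite (bernstein_lin n (fun=> e / 2) (fun k => (k%:R + (- (n%:R * t))) ^+ 2)).
  rewrite bernstein_cst bernstein_sqr mul1r subrr expr0n/= addr0.
  have : C / n%:R ^+ 2 * (n%:R * t * (1 - t)) <= e / 2.
    rewrite (_ : _ * _ = C * (t * (1 - t)) / n%:R); last by field; rewrite gt_eqF.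
    rewrite ler_pdivrMr//.
    apply: (@le_trans _ _ C); first by rewrite ler_piMr//; nra.
    by move: nC; rewrite ltr_pdivrMr//; nra.
  by lra.
have key k : (k <= n)%N -> `|f t - f (k%:R / n%:R)| <= g k.
  move=> kn; have k01 : 0 <= (k%:R / n%:R : R) <= 1.
    by rewrite divr_ge0//= ler_pdivrMr// mul1r ler_nat.
  have sq0 : 0 <= C / n%:R ^+ 2 * (k%:R + (- (n%:R * t))) ^+ 2.
    by rewrite mulr_ge0// ?sqr_ge0// divr_ge0// sqr_ge0.
  have [near|far] := leP `|t - k%:R / n%:R| dl.
    by have := Hdl _ _ t01 k01 near; rewrite /g; lra.
  have fM : `|f t - f (k%:R / n%:R)| <= 2 * M.
    apply: (le_trans (ler_normB _ _)).
    have := HM t; rewrite ger0_norm// => /(_ t1).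
    by have /andP[k0 k1] := k01; have := HM (k%:R / n%:R); rewrite (ger0_norm k0) => /(_ k1); lra.
  apply: (le_trans fM); rewrite /g.
  suff : 2 * M <= C / n%:R ^+ 2 * (k%:R + (- (n%:R * t))) ^+ 2 by lra.
  rewrite (_ : C / n%:R ^+ 2 * _ = 2 * M * ((t - k%:R / n%:R) ^+ 2 / dl ^+ 2)); last first.
    by rewrite /C; field; rewrite !gt_eqF.
  rewrite -[leLHS]mulr1 ler_wpM2l ?mulr_ge0// ler_pdivlMr ?exprn_gt0// mul1r.
  rewrite -[leRHS]real_normK ?num_real// lerXn2r// ?nnegrE ?ltW//.
have lin1 : (bernstein n (fun k => f t - f (k%:R / n%:R))).[t] = f t - (bernstein n (fun k => f (k%:R / n%:R))).[t].
  have -> : bernstein n (fun k => f t - f (k%:R / n%:R)) = bernstein n (fun k => 1 * f t + (-1) * f (k%:R / n%:R)).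
    by congr (bernstein n _); apply/funext => k; ring.
  by rewrite (bernstein_lin n (fun=> f t) (fun k => f (k%:R / n%:R))) bernstein_cst; ring.
rewrite -lin1 ler_norml; apply/andP; split; last first.
  apply: le_trans gE; apply: bernstein_le => // k kn.
  exact: le_trans (ler_norm _) (key k kn).
have -> : - e = -1 * e + 0 * 0 by ring.
apply: (@le_trans _ _ (-1 * (bernstein n g).[t] + 0 * (bernstein n g).[t])); first by lra.
rewrite -bernstein_lin; apply: bernstein_le => // k kn.
by have := key k kn; rewrite ler_norml => /andP[+ _]; lra.
Qed.

Lemma weierstrass f (a b : R) : a < b -> continuous f -> forall e, 0 < e ->
  exists p : {poly R}, forall x, a <= x <= b -> `|f x - p.[x]| <= e.
Proof.
move=> ab cf e e0.
have cg : continuous (fun t => f (a + (b - a) * t)).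
  move=> t; apply: continuous_comp; last exact: cf.
  apply: cvgD; first exact: cvg_cst.
  by apply: cvgM; [exact: cvg_cst|exact: cvg_id].
have [p Hp] := weierstrass01 cg e0.
exists (p \Po ((b - a)^-1 *: ('X - a%:P))) => x /andP[ax xb].
have t01 : 0 <= (b - a)^-1 * (x - a) <= 1.
  rewrite mulrC divr_ge0/= ?subr_ge0// ?ler_pdivrMr ?subr_gt0//; last exact: ltW.
  by lra.
have e1 : a + (b - a) * ((b - a)^-1 * (x - a)) = x.
  by field; rewrite subr_eq0 gt_eqF.
rewrite horner_comp !hornerE.
by have := Hp _ t01; rewrite e1.
Qed.

End weierstrass.

Section moment_determinacy.
Context (R : realType) (mu nu : probR R) (r : R).
Hypothesis r0 : 0 < r.
Local Notation S := (`[- r, r]%classic : set (measurableTypeR R)).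
Hypotheses (muS : mu (~` S) = 0%E) (nuS : nu (~` S) = 0%E).
Variable c : R.
Hypothesis moments : forall n : nat, \int[mu]_x ((x - c) ^+ n) = \int[nu]_x ((x - c) ^+ n).
Let mS : measurable S. Proof. exact: measurable_itv. Qed.
Local Notation bm := (@bmeas _ (measurableTypeR R) R S).

(** The expansion of [p] in powers of [x - c] reduces the claim to moments. *)
Lemma moments_poly (p : {poly R}) : \int[mu]_x p.[x] = \int[nu]_x p.[x].
Proof.
pose q := p \Po ('X + c%:P).
have pq : (fun x => p.[x]) = fun x => \sum_(i < size q) q`_i * (x - c) ^+ i.
  apply/funext => x; rewrite -horner_coef /q horner_comp !hornerE.
  by rewrite subrK.
rewrite pq.
have bX1 i : bm (fun x => (x - c) ^+ i).
  apply: continuous_bmeas_itv => x; apply: (@continuous_comp _ _ _ (fun x => x - c) (fun x => x ^+ i)).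
    by apply: cvgB; [exact: cvg_id|exact: cvg_cst].
  exact: exprn_continuous.
have bX i : bm (fun x => q`_i * (x - c) ^+ i) by apply: bmeasZ.
rewrite (bmeas_int_sum mS muS)// (bmeas_int_sum mS nuS)//.
apply: eq_bigr => i _.
by rewrite (bmeas_intZ mS muS _ (bX1 i)) (bmeas_intZ mS nuS _ (bX1 i)) moments.
Qed.

Lemma moments_continuous (f : R -> R) : continuous f -> \int[mu]_x f x = \int[nu]_x f x.
Proof.
move=> cf; apply/eqP; rewrite -subr_eq0 -normr_le0; apply/ler_addgt0Pr => e e0.
rewrite add0r.
have rr : - r < r by rewrite gtrN.
have e20 : 0 < e / 2 by lra.
have [p Hp] := weierstrass rr cf e20.
have bf : bm f by exact: continuous_bmeas_itv.
have bp : bm (fun x => p.[x]) by apply: continuous_bmeas_itv; exact: continuous_horner.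
have bfp := bmeasB bf bp.
have fp x : S x -> `|f x - p.[x]| <= e / 2 by rewrite /= in_itv/= => /Hp.
have := bmeas_normr_int mS muS bfp fp; have := bmeas_normr_int mS nuS bfp fp.
rewrite (bmeas_intB mS muS bf bp) (bmeas_intB mS nuS bf bp) moments_poly.
set A := \int[mu]_x _; set B := \int[nu]_x f x; set C := \int[nu]_x _ => h1 h2.
have := ler_normB (A - C) (B - C).
by rewrite (_ : A - C - (B - C) = A - B); [lra|ring].
Qed.

End moment_determinacy.

Section continuous_determinacy.
Context (R : realType).

Lemma itv_le_of_continuous (mu nu : probR R) (r : R) (S := (`[- r, r]%classic : set (measurableTypeR R))) :
  mu (~` S) = 0%E -> nu (~` S) = 0%E ->
  (forall f : R -> R, continuous f -> \int[mu]_x f x = \int[nu]_x f x) ->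
  forall a b : R, (mu `]a, b[%classic <= nu `]a, b[%classic)%E.
Proof.
move=> muS nuS muf a b; have mS : measurable S by exact: measurable_itv.
pose F (n : nat) : set (measurableTypeR R) := `]a + n.+1%:R^-1, b - n.+1%:R^-1[%classic.
have mF n : measurable (F n) by exact: measurable_itv.
have FU : \bigcup_n F n = `]a, b[%classic.
  apply/seteqP; split=> [x [n _]|x].
    rewrite /F/= !in_itv/= => /andP[x1 x2].
    have n0 : 0 < n.+1%:R^-1 :> R by rewrite invr_gt0.
    move: (n.+1%:R^-1) n0 x1 x2 => u n0 x1 x2.
    by apply/andP; split; lra.
  rewrite /= in_itv/= => /andP[ax xb].
  pose e := Num.min (x - a) (b - x).
  have e0 : 0 < e by rewrite lt_min !subr_gt0 ax.
  have e1 : e <= x - a by rewrite ge_min lexx.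
  have e2 : e <= b - x by rewrite ge_min lexx orbT.
  have [n ne] := ltr_add_invr e0; rewrite add0r in ne.
  exists n => //; rewrite /F/= in_itv/=; move: (n.+1%:R^-1) ne => u ne.
  by apply/andP; split; lra.
have cvF : mu (F n) @[n --> \oo] --> mu `]a, b[%classic.
  rewrite -FU; apply: nondecreasing_cvg_mu => //; first exact: bigcup_measurable.
  move=> m n mn; apply/subsetPset => x; rewrite /F/= !in_itv/= => /andP[x1 x2].
  have : n.+1%:R^-1 <= m.+1%:R^-1 :> R by rewrite lef_pV2 ?posrE// ler_nat.
  move: (n.+1%:R^-1) (m.+1%:R^-1) x1 x2 => u v x1 x2 uv.
  by apply/andP; split; lra.
apply: (cvge_to_le cvF); apply: nearW => n.
(* a trapezoidal function vanishing outside of ]a, b[ and equal to 1 on [F n] *)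
pose f (x : R) := Num.min 1 (n.+1%:R * Num.max 0 (Num.min (x - a) (b - x))).
have cf : continuous f.
  have c1 : continuous (fun x : R => Num.min (x - a) (b - x)).
    move=> x; apply: (@continuous_min R R (fun x => x - a) (fun x => b - x)); apply: cvgB;
      solve [exact: cvg_cst|exact: cvg_id].
  have c2 : continuous (fun x : R => Num.max 0 (Num.min (x - a) (b - x))).
    move=> x; apply: (@continuous_max R R (fun=> 0) (fun x => Num.min (x - a) (b - x))).
      exact: cvg_cst.
    exact: c1.
  move=> x; apply: (@continuous_min R R (fun=> 1)
     (fun x => n.+1%:R * Num.max 0 (Num.min (x - a) (b - x)))); first exact: cvg_cst.
  by apply: cvgM; [exact: cvg_cst|exact: c2].
have bf : bmeas S f by exact: continuous_bmeas_itv.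
have n0 : 0 < n.+1%:R :> R by [].
have mab : measurable (`]a, b[%classic : set (measurableTypeR R)) by exact: measurable_itv.
have bI (U : set (measurableTypeR R)) : measurable U -> bmeas S (\1_U : R -> R).
  move=> mU; split; first exact: measurable_indic.
  by exists 1 => x _; rewrite indicE; case: (_ \in _); rewrite ?normr1 ?normr0.
have h1 : fine (mu (F n)) <= \int[mu]_x f x.
  rewrite -Rint_indic//; apply: (bmeas_le mS muS) => //; first exact: bI.
  move=> x _; rewrite indicE; have [/set_mem|_] := boolP (x \in F n).
    rewrite /F /= in_itv/= => /andP[x1 x2]; rewrite /f le_min lexx/=.
    rewrite -ler_pdivrMl// mulr1 le_max le_min; apply/orP; right.
    by move: (n.+1%:R^-1) x1 x2 => u x1 x2; apply/andP; split; lra.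
  by rewrite /f le_min ler01 mulr_ge0// le_max lexx.
have h2 : \int[nu]_x f x <= fine (nu `]a, b[%classic).
  rewrite -Rint_indic//; apply: (bmeas_le mS nuS) => //; first exact: bI.
  move=> x _; rewrite indicE; have [_|/negP xab] := boolP (x \in _).
    by rewrite /f ge_min lexx.
  rewrite /f ge_min; apply/orP; right; rewrite max_l ?mulr0// ge_min.
  have [ax|xa] := leP x a; first by rewrite subr_le0 ax.
  have [bx|xb] := leP b x; first by rewrite orbC subr_le0 bx.
  by exfalso; apply: xab; apply/mem_set; rewrite /= in_itv/= xa.
rewrite -(@fineK _ (mu (F n))) ?fin_num_measure// -(@fineK _ (nu `]a, b[%classic)) ?fin_num_measure//.
by rewrite lee_fin; apply: le_trans h1 _; rewrite muf.
Qed.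

Lemma measure_eq_of_continuous (mu nu : probR R) (r : R) (S := (`[- r, r]%classic : set (measurableTypeR R))) :
  mu (~` S) = 0%E -> nu (~` S) = 0%E ->
  (forall f : R -> R, continuous f -> \int[mu]_x f x = \int[nu]_x f x) ->
  forall A : set (measurableTypeR R), measurable A -> mu A = nu A.
Proof.
move=> muS nuS muf A mA.
apply: (@measure_unique _ R (measurableTypeR R) (@RGenOpens.G R) (fun n => `]- n%:R, n%:R[%classic) _ _ _ _ mu nu) => //.
- exact: RGenOpens.measurableE.
- move=> _ _ [a [b ->]] [a' [b' ->]]; exists (Num.max a a'), (Num.min b b').
  apply/seteqP; split=> x /=; rewrite !in_itv/= gt_max lt_min.
    by move=> [/andP[-> ->] /andP[-> ->]].
  by move=> /andP[/andP[-> ->] /andP[-> ->]].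
- by move=> n; exists (- n%:R), n%:R.
- apply/seteqP; split=> // x _; exists (Num.bound `|x|) => //=.
  by rewrite in_itv/= -ltr_norml archi_boundP.
- move=> _ [a [b ->]]; apply/eqP; rewrite eq_le; apply/andP; split.
    exact: (@itv_le_of_continuous mu nu r).
  by apply: (@itv_le_of_continuous nu mu r) => // f cf; rewrite muf.
- by move=> k; rewrite -ge0_fin_numE// fin_num_measure//; exact: measurable_itv.
Qed.

End continuous_determinacy.

(** * First variation of the Poincaré inequality at the identity *)

Section perturbation.
Context (R : realType) (mu : probR R).
Hypothesis mu_compact : compact (supp mu).
Hypothesis mu_not_dirac : ~ exists a : R, mu [set a] = 1%E.
Hypothesis PoinV : Poin mu = 1 / Var mu id.
Local Notation K := (supp mu : set (measurableTypeR R)).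
Local Notation bm := (@bmeas _ (measurableTypeR R) R K).
Local Notation bm2 := (@bmeas _ (measurableTypeR R * measurableTypeR R)%type R (K `*` K)).
Local Notation V := (Var mu id).
Let mK := supp_measurable mu_compact.
Let K0 := supp_full mu_compact.
Let mK2 := measurable_square mK.
Let K20 := square_full mK K0.

(** A linear term dominated by a quadratic one vanishes. *)
Lemma quadratic_slope0 (A Q : R) : (forall t, t * A <= t ^+ 2 * Q) -> A = 0.
Proof.
move=> H; apply/eqP; apply: contraT => A0.
have q0 : 0 < `|Q| + 1 by have := normr_ge0 Q; lra.
have A2 : 0 < A ^+ 2 by rewrite exprn_even_gt0.
have := H (A / (`|Q| + 1)).
rewrite (_ : _ * A = A ^+ 2 / (`|Q| + 1) ^+ 2 * (`|Q| + 1)); last by field; rewrite gt_eqF.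
rewrite (_ : _ ^+ 2 * Q = A ^+ 2 / (`|Q| + 1) ^+ 2 * Q); last by field; rewrite gt_eqF.
rewrite ler_pM2l; last by rewrite divr_gt0// exprn_gt0.
by have := ler_norm Q; lra.
Qed.

(** Since the identity attains equality, the first variation of the inequality
    at the identity vanishes. *)
Lemma first_variation (f : R -> R) : C1 f ->
  V * \int[(mu \x mu)%E]_z diffquot f z.1 z.2 = \int[mu]_x (x * f x) - (\int[mu]_x x) * \int[mu]_x f x.
Proof.
move=> cf; have V0 := Var_id_gt0 mu_compact mu_not_dirac.
have bf := C1_bmeas mu_compact cf; have bi := C1_bmeas mu_compact (C1_id R).1.
have bq := diffquot_bmeas mu_compact cf.
set B := \int[_]_z _; set A := \int[mu]_x (x * f x); set m := \int[mu]_x x; set F := \int[mu]_x f x.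
suff : (A - m * F) / V - B = 0.
  move=> /eqP; rewrite subr_eq0 => /eqP <-.
  by rewrite mulrCA divff ?mulr1 ?gt_eqF.
apply: (@quadratic_slope0 _ ((free_dirichlet mu f - Var mu f / V) / 2)) => t.
have [cg dg] := C1_add (C1_id R).1 (C1_scale t cf).1.
have := poincare_C1 mu_compact (poincare_Poin mu_compact mu_not_dirac) cg.
rewrite PoinV.
have -> : free_dirichlet mu (fun x => x + t * f x) = 1 + 2 * t * B + t ^+ 2 * free_dirichlet mu f.
  rewrite /free_dirichlet.
  have -> : (fun z : measurableTypeR R * measurableTypeR R => diffquot (fun x => x + t * f x) z.1 z.2 ^+ 2) =
      (fun z => (1 + 2 * t * diffquot f z.1 z.2) + t ^+ 2 * diffquot f z.1 z.2 ^+ 2).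
    apply/funext => z; rewrite /diffquot dg (C1_id R).2 (C1_scale t cf).2.
    by case: eqVneq => [_|xy]; [ring|field; rewrite subr_eq0].
  have b1 := bmeas_cst (K `*` K) (1 : R); have b2 := bmeasZ (2 * t) bq.
  have b3 := bmeasX 2 bq; have b4 := bmeasZ (t ^+ 2) b3.
  rewrite (bmeas_intD mK2 K20 (bmeasD b1 b2) b4) (bmeas_intD mK2 K20 b1 b2).
  by rewrite (bmeas_intZ mK2 K20 _ bq) (bmeas_intZ mK2 K20 _ b3) Rint_cst.
have -> : Var mu (fun x => x + t * f x) = V + 2 * t * (A - m * F) + t ^+ 2 * Var mu f.
  rewrite /Var.
  have -> : (fun x : measurableTypeR R => (x + t * f x) ^+ 2) =
      (fun x => (x ^+ 2 + 2 * t * (x * f x)) + t ^+ 2 * f x ^+ 2).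
    by apply/funext => x; ring.
  have b1 := bmeasX 2 bi; have b2 := bmeasM bi bf; have b3 := bmeasX 2 bf.
  have b2' := bmeasZ (2 * t) b2; have b3' := bmeasZ (t ^+ 2) b3; have bf' := bmeasZ t bf.
  rewrite (bmeas_intD mK K0 (bmeasD b1 b2') b3') (bmeas_intD mK K0 b1 b2').
  rewrite (bmeas_intZ mK K0 _ b2) (bmeas_intZ mK K0 _ b3).
  rewrite (bmeas_intD mK K0 bi bf') (bmeas_intZ mK K0 _ bf) -/A -/m -/F.
  by ring.
rewrite (_ : 1 / V * _ = 1 + 2 * t * ((A - m * F) / V) + t ^+ 2 * (Var mu f / V)); last first.
  by field; rewrite gt_eqF.
by lra.
Qed.

(** Central moments. *)
Definition cmoment (mu : probR R) (n : nat) : R := \int[mu]_x (x - \int[mu]_y y) ^+ n.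

Lemma C1_shifted_power (m : R) n : C1 (fun x => (x - m) ^+ n) /\
  derive1 (fun x => (x - m) ^+ n) = fun x => n%:R * (x - m) ^+ n.-1.
Proof.
elim: n => [|n [cn dn]].
  have [c0 d0] := C1_cst (1 : R); split.
    by under eq_fun do rewrite expr0.
  by under eq_fun do rewrite expr0; rewrite d0; apply/funext => x; rewrite mul0r.
have [c1 d1] := C1_add (C1_id R).1 (C1_cst (- m)).1.
have [c2 d2] := C1_mul c1 cn.
have -> : (fun x => (x - m) ^+ n.+1) = (fun x => (x - m) * (x - m) ^+ n).
  by apply/funext => x; rewrite exprS.
split=> //; rewrite d2 d1 dn (C1_id R).2 (C1_cst (- m)).2; apply/funext => x /=.
case: n {cn dn c2 d2} => [|n]; first by rewrite /= !expr0; ring.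
by rewrite /= -natr1 exprS; ring.
Qed.

Lemma diffquot_shifted_power (m x y : R) n : diffquot (fun x => (x - m) ^+ n) x y =
  \sum_(i < n) (x - m) ^+ (n.-1 - i) * (y - m) ^+ i.
Proof.
rewrite /diffquot; case: eqVneq => [->|xy].
  rewrite (C1_shifted_power m n).2.
  rewrite (eq_bigr (fun=> (y - m) ^+ n.-1)); last first.
    move=> i _; rewrite -exprD subnK//.
    by case: n i => [[]//|n] i; rewrite -ltnS.
  by rewrite sumr_const card_ord mulr_natl.
rewrite subrXX; have -> : x - m - (y - m) = x - y by ring.
by rewrite mulrAC divff ?mul1r ?subr_eq0.
Qed.

Lemma bmeas_shifted_power m n : bm (fun x => (x - m) ^+ n).
Proof. exact: (C1_bmeas mu_compact (C1_shifted_power m n).1). Qed.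

(** The first variation at powers of [x - m], where [m] is the mean, determines the
    central moments one after the other. *)
Lemma cmoment_rec n : cmoment mu n.+1 = V * \sum_(i < n) cmoment mu (n.-1 - i) * cmoment mu i.
Proof.
set m := \int[mu]_y y.
have := first_variation (C1_shifted_power m n).1.
under eq_Rintegral do rewrite diffquot_shifted_power.
have bp k := bmeas_shifted_power m k.
have bprod i : bm2 (fun z => (z.1 - m) ^+ (n.-1 - i) * (z.2 - m) ^+ i).
  by apply: bmeasM; [exact: (bmeas_fst (bp _))|exact: (bmeas_snd (bp _))].
rewrite (bmeas_int_sum mK2 K20); last by move=> i _; exact: bprod.
under eq_bigr do rewrite (bmeas_prod mK K0 (bp _) (bp _)).
move=> ->; rewrite /cmoment -/m.
have bi := C1_bmeas mu_compact (C1_id R).1.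
rewrite -(bmeas_intZ mK K0 _ (bp n)) -(bmeas_intB mK K0); last 2 first.
- by apply: bmeasM.
- exact: bmeasZ.
by apply: eq_Rintegral => x _; rewrite exprS; ring.
Qed.

End perturbation.

(** * Integration against a density *)

Section density.
Local Open Scope ereal_scope.
Context d (T : measurableType d) (R : realType) (mu nu : {measure set T -> \bar R}).
Variable g : T -> R.
Hypotheses (mg : measurable_fun setT g) (g0 : forall x, (0 <= g x)%R).
Hypothesis nuE : forall A, measurable A -> nu A = \int[mu]_(x in A) (g x)%:E.

Import HBNNSimple.

Let mEg : measurable_fun setT (EFin \o g). Proof. exact/measurable_EFinP. Qed.

Let density_nnsfun (f : {nnsfun T >-> R}) :
  \int[nu]_x (f x)%:E = \int[mu]_x ((f x)%:E * (g x)%:E).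
Proof.
under [LHS]eq_integral do rewrite fimfunE -fsumEFin//.
rewrite ge0_integral_fsum//; last 2 first.
  - by move=> r; exact/measurable_EFinP/measurableT_comp.
  - by move=> n x _; rewrite EFinM nnfun_muleindic_ge0.
under [RHS]eq_integral.
  move=> x xD; rewrite fimfunE -fsumEFin// ge0_mule_fsuml; last first.
    by move=> r; rewrite EFinM nnfun_muleindic_ge0.
  over.
rewrite ge0_integral_fsum//; last 2 first.
  - move=> r; apply: emeasurable_funM => //.
    by apply/measurable_EFinP; apply: measurable_funM => //.
  - move=> n x _; rewrite mule_ge0//; last by rewrite lee_fin.
    by rewrite EFinM nnfun_muleindic_ge0.
apply: eq_fsbigr => r /set_mem[x _ fx].
have r0 : (0 <= r)%R by rewrite -fx.
have mr : measurable (f @^-1` [set r]) by [].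
under eq_integral do rewrite EFinM.
have mI : measurable_fun setT (fun x => (\1_(f @^-1` [set r]) x)%:E : \bar R).
  exact/measurable_EFinP.
rewrite ge0_integralZl//.
rewrite integral_indic// setIT nuE//.
under [RHS]eq_integral do rewrite EFinM -muleA.
rewrite ge0_integralZl//; last 2 first.
  - exact: emeasurable_funM.
  - by move=> ? _; rewrite mule_ge0 ?lee_fin.
congr (_ * _); rewrite integral_mkcond; apply: eq_integral => t _.
rewrite patchE indicE; case: ifPn => _; first by rewrite mul1e.
by rewrite mul0e.
Qed.

Let density_ge0 (f : T -> \bar R) : measurable_fun setT f -> (forall x, 0 <= f x) ->
  \int[nu]_x f x = \int[mu]_x (f x * (g x)%:E).
Proof.
move=> mf f0; pose f_ := nnsfun_approx measurableT mf.
transitivity (limn (fun n => \int[nu]_x (f_ n x)%:E)).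
  rewrite -monotone_convergence//=.
  - apply: eq_integral => x /[!inE] xD; apply/esym/cvg_lim => //=.
    exact: cvg_nnsfun_approx.
  - by move=> n; exact/measurable_EFinP/measurable_funTS.
  - by move=> n x _; rewrite lee_fin.
  - by move=> x _ a b ab; rewrite lee_fin; exact/lefP/nd_nnsfun_approx.
transitivity (limn (fun n => \int[mu]_x ((f_ n x)%:E * (g x)%:E))).
  by apply: congr_lim; apply/funext => n; exact: density_nnsfun.
rewrite -monotone_convergence//=.
- apply: eq_integral => x /[!inE] xD; apply/cvg_lim => //=.
  by apply: cvgeZr => //; exact: cvg_nnsfun_approx.
- by move=> n; apply: emeasurable_funM => //; exact/measurable_EFinP/measurable_funTS.
- by move=> n x _; rewrite mule_ge0 ?lee_fin.
- move=> x _ a b ab; rewrite lee_wpmul2r ?lee_fin//.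
  exact/lefP/nd_nnsfun_approx.
Qed.

(** The measure [nu] has density [g] with respect to [mu]. *)
Lemma integral_density (f : T -> R) : measurable_fun setT f ->
  \int[nu]_x (f x)%:E = \int[mu]_x (f x * g x)%:E.
Proof.
move=> mf; rewrite [LHS]integralE [RHS]integralE.
have mEf : measurable_fun setT (EFin \o f) by exact/measurable_EFinP.
rewrite (density_ge0 (measurable_funepos mEf))//.
rewrite (density_ge0 (measurable_funeneg mEf))//.
congr (_ - _); apply: eq_integral => x _.
  by rewrite !funeposE/= -!EFin_max -EFinM maxr_pMl ?mul0r.
by rewrite !funenegE/= -!EFin_max -EFinM maxr_pMl// mul0r mulNr.
Qed.

End density.

(** * The semicircular law as the image of an angle *)

Section uniform_angle.
Context (R : realType).

(** The uniform law on [[0, pi]]. *)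
Definition angle_law : probR R := uniform_prob (pi_gt0 R).

Local Notation U := angle_law.
Local Notation S := (`[0, pi]%classic : set (measurableTypeR R)).
Local Notation bm := (@bmeas _ (measurableTypeR R) R S).

Lemma angle_measurable : measurable S.
Proof. exact: measurable_itv. Qed.

Lemma angle_full : U (~` S) = 0%E.
Proof.
rewrite /angle_law/= /uniform_prob integral_uniform_pdf.
by rewrite setICl integral_set0.
Qed.

Lemma angle_bmeas (f : R -> R) : continuous f -> bm f.
Proof. exact: continuous_bmeas_itv. Qed.

Lemma integral_angle (f : R -> R) : measurable_fun setT f ->
  (\int[U]_x (f x)%:E = \int[lebesgue_measure]_(x in S) (pi^-1 * f x)%:E)%E.
Proof.
move=> mf.
rewrite (@integral_density _ _ _ lebesgue_measure U (uniform_pdf 0 pi))//; last 2 first.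
- exact: measurable_uniform_pdf.
- by move=> x; apply: uniform_pdf_ge0; exact: pi_gt0.
rewrite [RHS]integral_mkcond; apply: eq_integral => x _; rewrite patchE.
have [/set_mem|/negP xS] := boolP (x \in S).
  by rewrite /= in_itv/= /uniform_pdf => ->; rewrite subr0 mulrC.
rewrite /uniform_pdf ifF ?mulr0//; apply/negbTE/negP => xS'; apply: xS.
by apply/mem_set; rewrite /= in_itv.
Qed.

Lemma angle_FTC (g : R -> R) : C1 g -> \int[U]_x derive1 g x = (g pi - g 0) / pi.
Proof.
move=> cg; have pi0 := pi_gt0 R.
have [cg' dg'] := C1_scale pi^-1 cg.
rewrite /Rintegral integral_angle; last first.
  by apply: continuous_measurable_fun; case: cg.
rewrite (continuous_FTC2 (F := fun x => pi^-1 * g x))//.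
- by rewrite -EFinB/= -mulrBr mulrC.
- apply: continuous_subspaceT => x; apply: cvgM; first exact: cvg_cst.
  by case: cg => _; apply.
- have cc := C1_continuous cg'; split.
  + by move=> x _; case: cg' => + _; apply.
  + exact: cvg_at_right_filter (cc _).
  + exact: cvg_at_left_filter (cc _).
- by move=> x _; rewrite dg'.
Qed.

Lemma C1_sin : C1 (@sin R) /\ derive1 (@sin R) = cos.
Proof. by apply: C1_intro; exact: continuous_cos. Qed.

Lemma C1_cos : C1 (@cos R) /\ derive1 (@cos R) = fun x => - sin x.
Proof.
by apply: C1_intro => x; apply: cvgN; exact: continuous_sin.
Qed.

Lemma sin_natpi (n : nat) : sin (n%:R * pi) = 0 :> R.
Proof.
elim: n => [|n ih]; first by rewrite mul0r sin0.
by rewrite -natr1 mulrDl mul1r sinDpi ih oppr0.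
Qed.

Lemma angle_cos (n : nat) : \int[U]_x cos (n%:R * x) = (n == 0)%:R.
Proof.
case: n => [|n].
  by under eq_Rintegral do rewrite mul0r cos0; rewrite Rint_cst.
have [c1 d1] := C1_scale n.+1%:R (C1_id R).1.
have [c2 d2] := C1_comp C1_sin.1 c1.
have [c3 d3] := C1_scale n.+1%:R^-1 c2.
have <- : \int[U]_x derive1 (fun x => n.+1%:R^-1 * (sin \o (fun x => n.+1%:R * x)) x) x
   = \int[U]_x cos (n.+1%:R * x).
  apply: eq_Rintegral => x _; rewrite d3 d2 C1_sin.2 d1 (C1_id R).2 mulr1.
  by rewrite mulrCA mulVf ?mulr1// pnatr_eq0.
by rewrite angle_FTC//= sin_natpi !mulr0 sin0 !mulr0 subrr mul0r.
Qed.

Lemma continuous_cosM (c : R) : continuous (fun x : R => cos (c * x)).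
Proof.
move=> x; apply: (@continuous_comp _ _ _ (fun x => c * x) cos); last exact: continuous_cos.
by apply: cvgM; [exact: cvg_cst|exact: cvg_id].
Qed.

Lemma angle_sin_sin (m n : nat) :
  \int[U]_x (2 * (sin (m.+1%:R * x) * sin (n.+1%:R * x))) = (m == n)%:R.
Proof.
have -> : (fun x : measurableTypeR R => 2 * (sin (m.+1%:R * x) * sin (n.+1%:R * x))) =
    (fun x => cos ((m - n + (n - m))%:R * x) - cos ((m + n).+2%:R * x)).
  apply/funext => x.
  have -> : (m + n).+2%:R * x = m.+1%:R * x + n.+1%:R * x.
    by rewrite -mulrDl -natrD addSn addnS.
  have -> : cos ((m - n + (n - m))%:R * x) = cos (m.+1%:R * x - n.+1%:R * x).
    case: (leqP m n) => mn.
      rewrite (eqP (_ : m - n == 0)%N) ?subn_eq0// add0n.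
      rewrite -cosN -mulNr; congr (cos _); rewrite -mulrBl; congr (_ * _).
      by rewrite natrB// -!natr1; ring.
    rewrite (eqP (_ : n - m == 0)%N) ?subn_eq0 1?ltnW// addn0.
    congr (cos _); rewrite -mulrBl; congr (_ * _).
    by rewrite natrB; [rewrite -!natr1; ring|exact: ltnW].
  by rewrite cosB cosD; ring.
rewrite (bmeas_intB angle_measurable angle_full); last 2 first.
- apply: angle_bmeas; exact: continuous_cosM.
- apply: angle_bmeas; exact: continuous_cosM.
rewrite !angle_cos subr0; congr (_%:R); congr nat_of_bool.
by rewrite addn_eq0 !subn_eq0 -eqn_leq.
Qed.

End uniform_angle.

Section semicircle_measure.
Context (R : realType) (a r : R).
Hypothesis r0 : 0 < r.
Local Notation mu := (@lebesgue_measure R).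
Local Notation pdf := (semicircle_pdf a r).
Local Notation S := (`[a - 2 * r, a + 2 * r]%classic : set (measurableTypeR R)).

Lemma semicircle_pdf_ge0 x : 0 <= pdf x.
Proof.
rewrite /semicircle_pdf mulr_ge0 ?sqrtr_ge0// mulr_ge0//.
by rewrite invr_ge0 mulr_ge0 ?sqr_ge0// mulr_ge0// pi_ge0.
Qed.

Lemma continuous_semicircle_sqrt : continuous (fun x : R => Num.sqrt (4 * r ^+ 2 - (x - a) ^+ 2)).
Proof.
move=> x; apply: (@continuous_comp _ _ _ (fun x => 4 * r ^+ 2 - (x - a) ^+ 2) Num.sqrt).
  apply: cvgB; first exact: cvg_cst.
  exact: (C1_continuous (C1_shifted_power a 2).1).
exact: sqrt_continuous.
Qed.

Lemma measurable_semicircle_pdf : measurable_fun setT (pdf : measurableTypeR R -> R).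
Proof.
apply: measurable_funM; first exact: measurable_funM.
by apply: continuous_measurable_fun; exact: continuous_semicircle_sqrt.
Qed.

(** The semicircular law; the proof of [0 < r] makes it canonically a probability. *)
Definition semicircle_prob of 0 < r : set (measurableTypeR R) -> \bar R := semicircle_law a r.

Let law0 : semicircle_prob r0 set0 = 0%E.
Proof. by rewrite /semicircle_prob /semicircle_law integral_set0. Qed.

Let law_ge0 A : (0 <= semicircle_prob r0 A)%E.
Proof. by apply: integral_ge0 => x _; rewrite lee_fin semicircle_pdf_ge0. Qed.

Let law_sigma_additive : semi_sigma_additive (semicircle_prob r0).
Proof.
move=> /= F mF tF mUF; rewrite /semicircle_prob /semicircle_law; apply: cvg_toP.
  apply: ereal_nondecreasing_is_cvgn => m n mn.
  apply: lee_sum_nneg_natr => // k _ _.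
  by apply: integral_ge0 => /= x Fkx; rewrite lee_fin semicircle_pdf_ge0.
rewrite ge0_integral_bigcup//=.
- apply: measurable_funTS; apply/measurable_EFinP.
  exact: measurable_semicircle_pdf.
- by move=> x _; rewrite lee_fin semicircle_pdf_ge0.
Qed.

HB.instance Definition _ := isMeasure.Build _ _ _ (semicircle_prob r0)
  law0 law_ge0 law_sigma_additive.

(** The substitution [x = a + 2 r cos t]. *)
Lemma semicircle_substitution (f : R -> R) : continuous f ->
  (\int[mu]_x (f x * pdf x)%:E =
   \int[angle_law R]_x (f (a + 2 * r * cos x) * (2 * (sin x * sin x)))%:E)%E.
Proof.
move=> cf; have pi0 := pi_gt0 R; have rn0 : r != 0 by rewrite gt_eqF.
have pin0 : pi != 0 :> R by rewrite gt_eqF.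
have cF : continuous (fun x : R => a + 2 * r * cos x).
  move=> x; apply: cvgD; first exact: cvg_cst.
  by apply: cvgM; [exact: cvg_cst|exact: continuous_cos].
rewrite integral_angle; last first.
  apply: continuous_measurable_fun => x; apply: cvgM.
    by apply: continuous_comp; [exact: cF|exact: cf].
  by apply: cvgM; [exact: cvg_cst|apply: cvgM; exact: continuous_sin].
pose G (x : R) := f x * ((2 * pi * r ^+ 2)^-1 * Num.sqrt (4 * r ^+ 2 - (x - a) ^+ 2)).
have [c1 d1] := C1_scale (2 * r) (C1_cos R).1.
have [c2 d2] := C1_add (C1_cst a).1 c1.
have F0 : a + 2 * r * cos 0 = a + 2 * r by rewrite cos0 mulr1.
have Fpi : a + 2 * r * cos pi = a - 2 * r by rewrite cospi mulrN1.
transitivity (\int[mu]_(x in `[(a + 2 * r * cos pi)%R, (a + 2 * r * cos 0)%R]) (G x)%:E)%E.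
  rewrite F0 Fpi [RHS]integral_mkcond; apply: eq_integral => x _.
  rewrite patchE /semicircle_pdf indicE; case: ifPn => _.
    by rewrite /G mulr1.
  by rewrite !(mulr0, mul0r).
rewrite (@integration_by_substitution_decreasing _ (fun x => a + 2 * r * cos x) G 0 pi)//.
- apply: eq_integral => x; rewrite inE/= in_itv/= => /andP[x0 xpi]; congr EFin.
  rewrite -[LHS]/(G (a + 2 * r * cos x) * - derive1 (fun x => a + 2 * r * cos x) x).
  rewrite d2 d1 (C1_cos R).2 (C1_cst a).2 /G.
  have sx : 0 <= sin x by apply: sin_ge0_pi; rewrite x0.
  rewrite (_ : 4 * r ^+ 2 - _ = (2 * r * sin x) ^+ 2); last first.
    by rewrite [RHS]exprMn sin2cos2; ring.
  rewrite sqrtr_sqr ger0_norm; last by rewrite !mulr_ge0// ltW.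
  move: (pi : R) pin0 => p pn0 /=.
  by field; rewrite pn0 rn0.
- exact: ltW.
- move=> x y xi yi xy; rewrite ltrD2l ltr_pM2l ?mulr_gt0//.
  by rewrite ltr_cos.
- by move=> x _; case: c2 => _; apply.
- by apply/cvg_ex; exists (derive1 (fun x => a + 2 * r * cos x) 0); apply: cvg_at_right_filter; case: c2 => _; apply.
- by apply/cvg_ex; exists (derive1 (fun x => a + 2 * r * cos x) pi); apply: cvg_at_left_filter; case: c2 => _; apply.
- split.
  + by move=> x _; case: c2 => + _; apply.
  + exact: cvg_at_right_filter (cF _).
  + exact: cvg_at_left_filter (cF _).
- apply: continuous_subspaceT => x; apply: cvgM; first exact: cf.
  by apply: cvgM; [exact: cvg_cst|exact: continuous_semicircle_sqrt].
Qed.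

Let law_setT : semicircle_prob r0 setT = 1%E.
Proof.
have := @semicircle_substitution (fun=> 1) (fun x => cvg_cst _).
rewrite /semicircle_prob /semicircle_law; under eq_integral do rewrite mul1r.
move=> ->; have := angle_sin_sin R 0 0; rewrite /Rintegral eqxx => E.
have bs : bmeas (`[0, pi]%classic : set (measurableTypeR R)) (fun x : R => 1 * (2 * (sin x * sin x))).
  apply: angle_bmeas => x; apply: cvgM; first exact: cvg_cst.
  by apply: cvgM; [exact: cvg_cst|apply: cvgM; exact: continuous_sin].
have := @bmeas_integrable _ _ _ (angle_law R) _ (@angle_measurable R) (@angle_full R) _ bs.
move=> /integrable_fin_num fs; rewrite -[LHS]fineK; last exact: fs.
rewrite -[1%E]/(1%:R%:E) -E; congr (fine _)%:E; apply: eq_integral => x _.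
by rewrite !mul1r.
Qed.

HB.instance Definition _ := Measure_isProbability.Build _ _ R
  (semicircle_prob r0) law_setT.

Lemma integral_semicircle (nu : probR R) (f : R -> R) :
  (forall A : set (measurableTypeR R), measurable A -> nu A = semicircle_law a r A) ->
  continuous f ->
  \int[nu]_x f x = \int[angle_law R]_x (f (a + 2 * r * cos x) * (2 * (sin x * sin x))).
Proof.
move=> nuE cf; rewrite /Rintegral -semicircle_substitution//.
rewrite (@integral_density _ _ _ lebesgue_measure nu pdf)//.
- exact: measurable_semicircle_pdf.
- exact: semicircle_pdf_ge0.
- exact: continuous_measurable_fun.
Qed.

Lemma semicircle_full : semicircle_prob r0 (~` S) = 0%E.
Proof.
rewrite /semicircle_prob /semicircle_law integral0_eq// => x Sx.
rewrite /semicircle_pdf indicE memNset//.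
by rewrite mulr0 mul0r.
Qed.

End semicircle_measure.

(** * Chebyshev polynomials of the second kind *)

Section chebyshev.
Context (R : realType).

(** The pair of consecutive Chebyshev polynomials [(cheb n, cheb n.+1)]. *)
Fixpoint cheb2 (n : nat) : {poly R} * {poly R} :=
  if n is n'.+1 then ((cheb2 n').2, 'X * (cheb2 n').2 - (cheb2 n').1) else (1, 'X).

(** Rescaled Chebyshev polynomials of the second kind, orthonormal for the
    semicircular law of variance 1. *)
Definition cheb n : {poly R} := (cheb2 n).1.

Lemma chebSS n : cheb n.+2 = 'X * cheb n.+1 - cheb n.
Proof. by []. Qed.

Lemma cheb0 : cheb 0 = 1. Proof. by []. Qed.
Lemma cheb1 : cheb 1 = 'X. Proof. by []. Qed.

Lemma nat_ind2 (P : nat -> Prop) : P 0%N -> P 1%N -> (forall n, P n -> P n.+1 -> P n.+2) ->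
  forall n, P n.
Proof.
move=> P0 P1 PS n; suff : P n /\ P n.+1 by case.
by elim: n => [//|n [Pn PSn]]; split => //; exact: PS.
Qed.

Lemma cheb_sin n (t : R) : (cheb n).[2 * cos t] * sin t = sin (n.+1%:R * t).
Proof.
elim/nat_ind2: n => [||n ih0 ih1].
- by rewrite cheb0 hornerC !mul1r.
- by rewrite cheb1 hornerX (_ : 2%:R * t = t + t) ?sinD; ring.
rewrite chebSS !hornerE mulrBl -mulrA ih0 ih1.
have -> : n.+3%:R * t = n.+2%:R * t + t by rewrite -[in LHS]natr1; ring.
have -> : n.+1%:R * t = n.+2%:R * t - t by rewrite -[in RHS]natr1; ring.
by rewrite !sinD sinN cosN; ring.
Qed.

(** The two-variable kernel [\sum_(k < n) cheb k (x) cheb (n - 1 - k) (y)]. *)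
Definition cheb_kernel n (x y : R) := \sum_(k < n) (cheb k).[x] * (cheb (n.-1 - k)).[y].

Lemma cheb_kernelSS n x y :
  cheb_kernel n.+2 x y = x * cheb_kernel n.+1 x y - cheb_kernel n x y + (cheb n.+1).[y].
Proof.
rewrite /cheb_kernel big_ord_recl/= subn0 cheb0 hornerC mul1r addrC; congr (_ + _).
rewrite big_ord_recl [in RHS]big_ord_recl/= subn0 cheb1 hornerX cheb0 hornerC mul1r mulrDr.
rewrite -addrA; congr (_ + _).
  by rewrite subSS subn0.
rewrite mulr_sumr -sumrB; apply: eq_bigr => i _.
rewrite /fintype.bump/= !add1n !subSS chebSS hornerD hornerN hornerM hornerX.
have -> : (n - i.+1 = n.-1 - i)%N by case: n i => // n i; rewrite subSS.
by ring.
Qed.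

Lemma cheb_diff n x y : (cheb n).[x] - (cheb n).[y] = (x - y) * cheb_kernel n x y.
Proof.
elim/nat_ind2: n => [||n ih0 ih1].
- by rewrite cheb0 !hornerC /cheb_kernel big_ord0 subrr mulr0.
- by rewrite cheb1 !hornerX /cheb_kernel big_ord_recl big_ord0/= cheb0 !hornerC; ring.
rewrite cheb_kernelSS chebSS !hornerE.
rewrite (_ : (x - y) * _ = x * ((x - y) * cheb_kernel n.+1 x y) - (x - y) * cheb_kernel n x y
   + (x - y) * (cheb n.+1).[y]); last by ring.
by rewrite -ih0 -ih1; ring.
Qed.

Lemma cheb_deriv n x : (cheb n)^`().[x] = cheb_kernel n x x.
Proof.
elim/nat_ind2: n => [||n ih0 ih1].
- by rewrite cheb0 derivC hornerC /cheb_kernel big_ord0.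
- by rewrite cheb1 derivX hornerC /cheb_kernel big_ord_recl big_ord0/= cheb0 !hornerC; ring.
rewrite cheb_kernelSS chebSS derivB derivM derivX !hornerE ih0 ih1.
by ring.
Qed.

Lemma size_cheb n : size (cheb n) = n.+1 /\ cheb n \is monic.
Proof.
elim/nat_ind2: n => [||n [s0 m0] [s1 m1]].
- by rewrite cheb0 size_poly1 monic1.
- by rewrite cheb1 size_polyX monicX.
have s : (size (cheb n) < size ('X * cheb n.+1)%R)%N.
  by rewrite mulrC size_mulX ?monic_neq0// s0 s1.
rewrite chebSS; split.
  by rewrite size_polyDl ?size_polyN// mulrC size_mulX ?monic_neq0// s1.
by rewrite monicE lead_coefDl ?size_polyN// -monicE monicMl ?monicX.
Qed.

Lemma cheb_basis (p : {poly R}) n : (size p <= n)%N ->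
  exists c : nat -> R, p = \sum_(k < n) c k *: cheb k.
Proof.
elim: n p => [|n ih] p sp.
  by exists (fun=> 0); rewrite big_ord0; apply/eqP; rewrite -size_poly_leq0.
have [sn mn] := size_cheb n.
have [|c Hc] := ih (p - p`_n *: cheb n).
  apply/leq_sizeP => j nj; rewrite coefB coefZ.
  move: nj; rewrite leq_eqVlt => /predU1P[<-|nj].
    by have := mn; rewrite monicE lead_coefE sn/= => /eqP ->; rewrite mulr1 subrr.
  by rewrite [p`_j]nth_default ?(leq_trans sp)// [(cheb n)`_j]nth_default ?sn// mulr0 subr0.
exists (fun k => if (k < n)%N then c k else p`_n).
rewrite big_ord_recr/= ltnn.
under eq_bigr => i _ do rewrite ltn_ord.
by rewrite -Hc subrK.
Qed.

End chebyshev.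

(** * The Poincaré inequality for the semicircular law *)

(** Parseval's identity for a finite orthogonal family. *)
Lemma int_sqr_sum d (T : measurableType d) (R : realType) (m : probability T R) (S : set T)
    (mS : measurable S) (S0 : m (~` S) = 0%E) (c : nat -> R) N (g : nat -> T -> R) (w : nat -> R) :
  (forall k, bmeas S (g k)) ->
  (forall k l, \int[m]_x (g k x * g l x) = w k * (k == l)%:R) ->
  \int[m]_x (\sum_(k < N) c k * g k x) ^+ 2 = \sum_(k < N) c k ^+ 2 * w k.
Proof.
move=> bg gg; under eq_Rintegral do rewrite expr2 big_distrlr/=.
have b k l : bmeas S (fun x => c k * g k x * (c l * g l x)).
  by apply: bmeasM; exact: bmeasZ.
rewrite (bmeas_int_sum mS S0); last by move=> k _; apply: bmeas_sum => l _; exact: b.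
apply: eq_bigr => k _; rewrite (bmeas_int_sum mS S0); last by move=> l _; exact: b.
have E (l : 'I_N) : \int[m]_x (c k * g k x * (c l * g l x)) = c k * c l * (w k * (k == l :> nat)%:R).
  rewrite -gg -(bmeas_intZ mS S0); last exact: bmeasM.
  by apply: eq_Rintegral => x _; ring.
under eq_bigr do rewrite E.
rewrite (bigD1 k)//= eqxx mulr1 big1 ?addr0; first by ring.
by move=> l lk; rewrite (_ : (k == l :> nat) = false) ?mulr0//; apply/negbTE; rewrite eq_sym.
Qed.

Section semicircle_poincare.
Context (R : realType) (a r : R) (r0 : 0 < r).
Variable mu : probR R.
Hypothesis muE : forall A : set (measurableTypeR R), measurable A -> mu A = semicircle_law a r A.
Local Notation S := (`[a - 2 * r, a + 2 * r]%classic : set (measurableTypeR R)).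
Local Notation bm := (@bmeas _ (measurableTypeR R) R S).
Local Notation bm2 := (@bmeas _ (measurableTypeR R * measurableTypeR R)%type R (S `*` S)).

Let mS : measurable S. Proof. exact: measurable_itv. Qed.
Let S0 : mu (~` S) = 0%E.
Proof. by rewrite muE; [exact: (semicircle_full a r0)|exact: measurableC]. Qed.
Let mS2 := measurable_square mS.
Let S20 := square_full mS S0.

Lemma semicircle_bmeas (f : R -> R) : continuous f -> bm f.
Proof. exact: continuous_bmeas_itv. Qed.

(** Chebyshev polynomials centred at [a] and scaled by [r]. *)
Definition ncheb n (x : R) := (cheb R n).[(x - a) / r].

Lemma continuous_ncheb n : continuous (ncheb n).
Proof.
move=> x; apply: (@continuous_comp _ _ _ (fun x => (x - a) / r) (fun x => (cheb R n).[x])).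
  apply: cvgM; last exact: cvg_cst.
  by apply: cvgB; [exact: cvg_id|exact: cvg_cst].
exact: continuous_horner.
Qed.

Lemma ncheb_bm n : bm (ncheb n).
Proof. apply: semicircle_bmeas; exact: continuous_ncheb. Qed.

Lemma ncheb_orthonormal m n : \int[mu]_x (ncheb m x * ncheb n x) = (m == n)%:R.
Proof.
rewrite (integral_semicircle r0 muE); last first.
  by move=> x; apply: cvgM; exact: continuous_ncheb.
rewrite -angle_sin_sin; apply: eq_Rintegral => t _.
rewrite -!cheb_sin /ncheb.
have -> : (a + 2 * r * cos t - a) / r = 2 * cos t by field; rewrite gt_eqF.
by ring.
Qed.

Lemma ncheb_mean n : \int[mu]_x ncheb n x = (n == 0%N)%:R.
Proof.
rewrite -(ncheb_orthonormal n 0); apply: eq_Rintegral => x _.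
by rewrite /ncheb cheb0 hornerC mulr1.
Qed.

(** The difference quotient of [ncheb n], up to the factor [1 / r]. *)
Definition ncheb_kernel n (x y : R) := \sum_(k < n) ncheb k x * ncheb (n.-1 - k) y.

Lemma bm2_ncheb k l : bm2 (fun z => ncheb k z.1 * ncheb l z.2).
Proof.
by apply: bmeasM; [exact: (bmeas_fst (ncheb_bm _))|exact: (bmeas_snd (ncheb_bm _))].
Qed.

Lemma ncheb2_orthonormal k l k' l' :
  \int[(mu \x mu)%E]_z ((ncheb k z.1 * ncheb l z.2) * (ncheb k' z.1 * ncheb l' z.2)) =
  (k == k')%:R * (l == l')%:R.
Proof.
rewrite -!ncheb_orthonormal -(bmeas_prod mS S0); last 2 first.
- by apply: bmeasM; exact: ncheb_bm.
- by apply: bmeasM; exact: ncheb_bm.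
by apply: eq_Rintegral => z _; ring.
Qed.

Lemma int_ncheb_kernel n m :
  \int[(mu \x mu)%E]_z (ncheb_kernel n z.1 z.2 * ncheb_kernel m z.1 z.2) = n%:R * (n == m)%:R.
Proof.
under eq_Rintegral do rewrite /ncheb_kernel big_distrlr/=.
rewrite (bmeas_int_sum mS2 S20); last first.
  by move=> i _; apply: bmeas_sum => j _; apply: bmeasM; exact: bm2_ncheb.
under eq_bigr => i _.
  rewrite (bmeas_int_sum mS2 S20); last first.
    by move=> j _; apply: bmeasM; exact: bm2_ncheb.
  under eq_bigr => j _ do rewrite ncheb2_orthonormal.
  over.
case: eqVneq => [<-|nm].
  rewrite mulr1 (eq_bigr (fun=> 1)) ?sumr_const ?card_ord// => i _.
  rewrite (bigD1 i)//= !eqxx mul1r big1 ?addr0// => j ji.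
  by rewrite (_ : (i == j :> nat) = false) ?mul0r//; apply/negbTE; rewrite eq_sym.
rewrite mulr0 big1// => i _; rewrite big1// => j _.
case: eqVneq => [ij|]; last by rewrite mul0r.
rewrite mul1r; case: eqVneq => // e; case/eqP: nm.
by have := ltn_ord i; have := ltn_ord j; lia.
Qed.

Lemma bm2_ncheb_kernel n : bm2 (fun z => ncheb_kernel n z.1 z.2).
Proof. by apply: bmeas_sum => i _; exact: bm2_ncheb. Qed.

Lemma C1_poly (p : {poly R}) : C1 (fun x => p.[x]) /\ derive1 (fun x => p.[x]) = fun x => p^`().[x].
Proof.
elim/poly_ind: p => [|p c [cp dp]].
  have [c0 d0] := C1_cst (0 : R).
  by under eq_fun do rewrite horner0; rewrite d0 deriv0; split=> //; apply/funext => x; rewrite horner0.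
have [c1 d1] := C1_mul cp (C1_id R).1.
have [c2 d2] := C1_add c1 (C1_cst c).1.
have -> : (fun x => (p * 'X + c%:P).[x]) = (fun x => p.[x] * id x + c).
  by apply/funext => x; rewrite !hornerE.
split=> //; rewrite d2 d1 dp (C1_id R).2 (C1_cst c).2; apply/funext => x.
by rewrite derivD derivM derivX derivC !hornerE.
Qed.

Lemma ncheb_expansion (p : {poly R}) : exists N (c : nat -> R),
  (forall x, p.[x] = \sum_(k < N) c k * ncheb k x) /\
  (forall x y, diffquot (fun x => p.[x]) x y = r^-1 * \sum_(k < N) c k * ncheb_kernel k x y).
Proof.
have rn0 : r != 0 by rewrite gt_eqF.
pose q := p \Po (r *: 'X + a%:P).
have [c Hc] := cheb_basis (leqnn (size q)).
have pq x : p.[x] = q.[(x - a) / r].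
  by rewrite /q horner_comp hornerD hornerZ hornerX hornerC; congr (_.[_]); field.
have E1 x : p.[x] = \sum_(k < size q) c k * ncheb k x.
  by rewrite pq {1}Hc horner_sum; apply: eq_bigr => k _; rewrite hornerZ.
have pp : p = q \Po (r^-1 *: ('X - a%:P)).
  rewrite /q -comp_polyA comp_polyD comp_polyZ comp_polyX comp_polyC.
  by rewrite scalerA divff// scale1r subrK comp_polyXr.
exists (size q), c; split => // x y; rewrite /diffquot; case: eqVneq => [<-|xy].
  have dq : q^`() = \sum_(k < size q) c k *: (cheb R k)^`().
    by rewrite {1}Hc raddf_sum; apply: eq_bigr => k _; rewrite /= derivZ.
  have dp : p^`().[x] = r^-1 * q^`().[(x - a) / r].
    have L : (r^-1 *: ('X - a%:P)).[x] = (x - a) / r.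
      by rewrite hornerZ hornerD hornerN hornerX hornerC mulrC.
    rewrite {1}pp deriv_comp hornerM horner_comp L derivZ derivB derivX derivC subr0.
    by rewrite alg_polyC hornerC mulrC.
  rewrite (C1_poly p).2 dp dq horner_sum; congr (_ * _); apply: eq_bigr => k _.
  by rewrite hornerZ cheb_deriv.
rewrite !E1 -sumrB mulr_suml mulr_sumr; apply: eq_bigr => k _.
rewrite -mulrBr /ncheb cheb_diff /cheb_kernel /ncheb_kernel /ncheb.
by field; rewrite rn0 subr_eq0.
Qed.

(** For [p = \sum_k c_k ncheb_k] the variance is [\sum_(k > 0) c_k ^ 2] and the
    Dirichlet form is [r ^ -2 \sum_k k c_k ^ 2]. *)
Lemma semicircle_poincare_poly (p : {poly R}) :
  Var mu (fun x => p.[x]) <= r ^+ 2 * free_dirichlet mu (fun x => p.[x]).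
Proof.
have rn0 : r != 0 by rewrite gt_eqF.
have [N [c [pE dE]]] := ncheb_expansion p.
have bn k := ncheb_bm k.
have bp : bm (fun x => p.[x]) by apply: semicircle_bmeas; exact: continuous_horner.
have meanE : \int[mu]_x p.[x] = \sum_(k < N) c k * (k == 0%N :> nat)%:R.
  under eq_Rintegral do rewrite pE.
  rewrite (bmeas_int_sum mS S0); last by move=> k _; exact: bmeasZ.
  by apply: eq_bigr => k _; rewrite (bmeas_intZ mS S0 _ (bn k)) ncheb_mean.
have sqrE : \int[mu]_x p.[x] ^+ 2 = \sum_(k < N) c k ^+ 2.
  under eq_Rintegral do rewrite pE.
  rewrite (int_sqr_sum mS S0 c N bn (w := fun=> 1)).
    by apply: eq_bigr => k _; rewrite mulr1.
  by move=> k l; rewrite ncheb_orthonormal mul1r.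
have dirE : free_dirichlet mu (fun x => p.[x]) = r^-1 ^+ 2 * \sum_(k < N) c k ^+ 2 * k%:R.
  rewrite /free_dirichlet; under eq_Rintegral do rewrite dE exprMn.
  have bk k := bm2_ncheb_kernel k.
  rewrite (bmeas_intZ mS2 S20); last first.
    by apply: (bmeasX 2); apply: bmeas_sum => k _; exact: bmeasZ.
  by rewrite (int_sqr_sum mS2 S20 c N bk int_ncheb_kernel).
rewrite dirE mulrA -exprMn divff// expr1n mul1r /Var sqrE meanE.
have -> : (\sum_(k < N) c k * (k == 0%N :> nat)%:R) ^+ 2 = \sum_(k < N) c k ^+ 2 * (k == 0%N :> nat)%:R.
  case: N {pE dE meanE sqrE dirE} => [|N]; first by rewrite !big_ord0 expr0n.
  rewrite !big_ord_recl /= !mulr1 !big1 ?addr0// => i _; by rewrite mulr0.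
rewrite -sumrB; apply: ler_sum => k _; have := sqr_ge0 (c k).
case: (nat_of_ord k) => [|n]; first by rewrite /= mulr1 mulr0 subrr.
rewrite /= mulr0 subr0 => ?; rewrite ler_peMr// ler1n//.
Qed.

Lemma diffquot_bm2 (f : R -> R) : C1 f -> bm2 (fun z => diffquot f z.1 z.2).
Proof.
move=> cf; split; first exact: measurable_diffquot.
have [M HM] := diffquot_bounded (`|a| + 2 * r) cf.
exists M => -[x y] [/=]; rewrite !in_itv/= => /andP[x1 x2] /andP[y1 y2].
have := ler_norm a; have := ler_norm (- a); rewrite normrN => ? ?.
by apply: HM; rewrite ler_norml; apply/andP; split; lra.
Qed.

Lemma bm2_weight : bm2 (fun z => r ^+ 2 - (z.1 - z.2) ^+ 2 / 2).
Proof.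
have bi : bm id by apply: semicircle_bmeas => x; exact: cvg_id.
apply: bmeasB; first exact: bmeas_cst.
apply: bmeasM; last exact: bmeas_cst.
by apply: (bmeasX 2); apply: bmeasB; [exact: (bmeas_fst bi)|exact: (bmeas_snd bi)].
Qed.

(** The deficit in the inequality only involves the difference quotient of [f], which
    is controlled by [f']. *)
Lemma deficit_integral (f : R -> R) : C1 f ->
  r ^+ 2 * free_dirichlet mu f - Var mu f =
  \int[(mu \x mu)%E]_z ((r ^+ 2 - (z.1 - z.2) ^+ 2 / 2) * diffquot f z.1 z.2 ^+ 2).
Proof.
move=> cf; have bq := bmeasX 2 (diffquot_bm2 cf).
have bf : bm f by apply: semicircle_bmeas; exact: C1_continuous.
have V2 := integral_sqr_diff mS S0 bf.
have -> : Var mu f = 2^-1 * \int[(mu \x mu)%E]_z (f z.1 - f z.2) ^+ 2.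
  by rewrite V2 /Var; field.
have bs : bm2 (fun z => (f z.1 - f z.2) ^+ 2).
  by apply: (bmeasX 2); apply: bmeasB; [exact: (bmeas_fst bf)|exact: (bmeas_snd bf)].
rewrite -(bmeas_intZ mS2 S20 _ bs) -(bmeas_intZ mS2 S20 _ bq).
rewrite -(bmeas_intB mS2 S20); last 2 first.
- exact: bmeasZ.
- exact: bmeasZ.
by apply: eq_Rintegral => z _; rewrite diffquotE; field.
Qed.

Lemma antiderivative (p : {poly R}) : exists q : {poly R}, q^`() = p.
Proof.
exists (\poly_(i < (size p).+1) (p`_i.-1 / i%:R)); apply/polyP => i.
rewrite coef_deriv coef_poly ltnS.
case: ltnP => [_|sp]; last by rewrite mul0rn nth_default.
by rewrite /= -[_ *+ i.+1]mulr_natr divfK// pnatr_eq0.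
Qed.

Lemma itv_S x : S x -> a - 2 * r <= x <= a + 2 * r.
Proof. by rewrite /= in_itv. Qed.

(** Uniform approximation of [f'] by polynomials extends the inequality from
    polynomials to C^1 functions. *)
Lemma semicircle_poincare_C1 (f : R -> R) : C1 f ->
  Var mu f <= r ^+ 2 * free_dirichlet mu f.
Proof.
move=> cf; rewrite -subr_ge0 deficit_integral//.
have bq := diffquot_bm2 cf; have bw := bm2_weight.
have [_ [W HW]] := bw; have [_ [M HM]] := bq.
have r0' : 0 < r by exact: r0.
have Sa : S a by rewrite /= in_itv/=; apply/andP; split; lra.
have W0 : 0 <= W by apply: le_trans (HW (a, a) (conj Sa Sa)).
have M0 : 0 <= M by apply: le_trans (HM (a, a) (conj Sa Sa)).
set T := \int[_]_z _.
suff H e : 0 < e -> e <= 1 -> - (W * (2 * M + 1) * e) <= T.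
  rewrite leNgt; apply/negP => T0.
  pose e := Num.min 1 (- T / (W * (2 * M + 1) + 1) / 2).
  have c0 : 0 < W * (2 * M + 1) + 1 by rewrite ltr_pwDr// mulr_ge0//; lra.
  have e0 : 0 < e by rewrite lt_min ltr01 !divr_gt0// oppr_gt0.
  have e1 : e <= 1 by rewrite ge_min lexx.
  have e2 : e <= - T / (W * (2 * M + 1) + 1) / 2 by rewrite ge_min lexx orbT.
  have := H e e0 e1.
  move: e2; rewrite -mulrA -invfM ler_pdivlMr ?mulr_gt0//.
  by move: (W * (2 * M + 1)) c0 => c c0; nra.
move=> e0 e1.
have AB : a - 2 * r < a + 2 * r by lra.
have [p0 Hp0] := weierstrass AB cf.2 e0.
have [p pE] := antiderivative p0.
have [cp dp] := C1_poly p.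
have bqp := diffquot_bm2 cp.
(* the difference quotient of [f - p] is a value of [f' - p'] *)
have near z : (S `*` S) z -> `|diffquot f z.1 z.2 - diffquot (fun x => p.[x]) z.1 z.2| <= e.
  move: z => [x y] [/= /itv_S Sx /itv_S Sy].
  have [ch dh] := C1_add cf (C1_scale (-1) cp).1.
  have [c cxy] := diffquot_mvt x y ch.
  have -> : diffquot (fun x => f x + -1 * p.[x]) x y = diffquot f x y - diffquot (fun x => p.[x]) x y.
    rewrite /diffquot dh (C1_scale (-1) cp).2; case: eqVneq => [_|xy]; first by ring.
    by field; rewrite subr_eq0.
  move=> ->; rewrite dh (C1_scale (-1) cp).2 dp pE mulN1r; apply: Hp0.
  move: cxy; rewrite ge_min le_max => /andP[/orP c1 /orP c2].
  by apply/andP; split; [case: c1 => ?|case: c2 => ?]; lra.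
have Tp : 0 <= \int[(mu \x mu)%E]_z ((r ^+ 2 - (z.1 - z.2) ^+ 2 / 2) * diffquot (fun x => p.[x]) z.1 z.2 ^+ 2).
  by rewrite -deficit_integral// subr_ge0 semicircle_poincare_poly.
have b1 := bmeasM bw (bmeasX 2 bq); have b2 := bmeasM bw (bmeasX 2 bqp).
have : `|T - \int[(mu \x mu)%E]_z ((r ^+ 2 - (z.1 - z.2) ^+ 2 / 2) * diffquot (fun x => p.[x]) z.1 z.2 ^+ 2)|
    <= W * (2 * M + 1) * e.
  rewrite /T -(bmeas_intB mS2 S20 b1 b2).
  apply: (bmeas_normr_int mS2 S20); first exact: bmeasB.
  move=> z Sz; rewrite -mulrBr normrM -mulrA; apply: ler_pM => //; first exact: HW.
  rewrite subr_sqr normrM mulrC; apply: ler_pM => //; last exact: near.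
  have := near z Sz; have := HM z Sz; rewrite !ler_norml => /andP[? ?] /andP[? ?].
  by apply/andP; split; lra.
by rewrite ler_norml => /andP[+ _]; lra.
Qed.

Lemma semicircle_mean : \int[mu]_x x = a.
Proof.
have rn0 : r != 0 by rewrite gt_eqF.
have -> : (fun x : measurableTypeR R => x : R) = (fun x => a + r * ncheb 1 x).
  by apply/funext => x; rewrite /ncheb cheb1 hornerX; field.
have b1 := ncheb_bm 1.
rewrite (bmeas_intD mS S0 (bmeas_cst _ a) (bmeasZ r b1)) (bmeas_intZ mS S0 _ b1).
by rewrite Rint_cst ncheb_mean mulr0 addr0.
Qed.

Lemma semicircle_Var : Var mu id = r ^+ 2.
Proof.
have rn0 : r != 0 by rewrite gt_eqF.
rewrite /Var semicircle_mean.
have -> : (fun x : measurableTypeR R => (id x : R) ^+ 2) =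
   (fun x => (a ^+ 2 + 2 * a * r * ncheb 1 x) + r ^+ 2 * (ncheb 1 x * ncheb 1 x)).
  by apply/funext => x; rewrite /ncheb cheb1 hornerX; field.
have b1 := ncheb_bm 1; have b2 := bmeasM b1 b1.
have b0 := bmeas_cst S (a ^+ 2); have b1' := bmeasZ (2 * a * r) b1.
rewrite (bmeas_intD mS S0 (bmeasD b0 b1') (bmeasZ _ b2)) (bmeas_intD mS S0 b0 b1').
rewrite (bmeas_intZ mS S0 _ b1) (bmeas_intZ mS S0 _ b2).
by rewrite Rint_cst ncheb_mean ncheb_orthonormal /= mulr0 mulr1; ring.
Qed.

Lemma poincare_semicircle : poincare_inequality mu (1 / Var mu id).
Proof.
have rn0 : r != 0 by rewrite gt_eqF.
rewrite semicircle_Var; split; first by rewrite divr_gt0// exprn_gt0.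
move=> f cf _; rewrite mul1r mulrC ler_pdivrMr ?exprn_gt0// mulrC.
exact: semicircle_poincare_C1.
Qed.

Lemma semicircle_not_dirac : ~ exists b : R, mu [set b] = 1%E.
Proof.
move=> [b]; rewrite muE; last exact: measurable_set1.
by rewrite /semicircle_law integral_set1 => -[] /eqP; rewrite eq_sym oner_eq0.
Qed.

Lemma supp_closed_general (nu : probR R) : closed (supp nu).
Proof.
move=> x Hx U oU Ux.
have [y [Ky Uy]] := Hx U (open_nbhs_nbhs (conj oU Ux)).
exact: Ky.
Qed.

Lemma supp_compact_of_full (nu : probR R) (c d : R) : nu (~` `[c, d]%classic) = 0%E ->
  compact (supp nu).
Proof.
move=> nu0; apply: (subclosed_compact (@supp_closed_general nu) (@segment_compact _ c d)).
move=> x Kx; apply: contrapT => xcd.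
have cl : closed (`[c, d]%classic : set R) by exact: itv_closed.
have := Kx _ (closed_openC cl) xcd.
by rewrite nu0 ltxx.
Qed.

Lemma semicircle_compact : compact (supp mu).
Proof. exact: supp_compact_of_full S0. Qed.

Lemma semicircle_Poin : Poin mu = 1 / Var mu id.
Proof.
apply/eqP; rewrite eq_le Poin_le_Var//=; last 2 first.
- exact: semicircle_compact.
- exact: semicircle_not_dirac.
apply: poincare_le_Poin; [exact: semicircle_compact|exact: semicircle_not_dirac|].
exact: poincare_semicircle.
Qed.

End semicircle_poincare.

(** * The upper bound is attained at semicircular laws only *)

Section semicircle_equality.
Context (R : realType) (mu : probR R).
Hypothesis mu_compact : compact (supp mu).
Hypothesis mu_not_dirac : ~ exists a : R, mu [set a] = 1%E.

Lemma cmoment0 (nu : probR R) : cmoment nu 0 = 1.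
Proof.
by rewrite /cmoment; under eq_Rintegral do rewrite expr0; rewrite Rint_cst.
Qed.

Lemma supp_full_itv (nu : probR R) (c : compact (supp nu)) (r : R) :
  (forall x, supp nu x -> `|x| <= r) -> nu (~` `[- r, r]%classic) = 0%E.
Proof.
move=> Hr; apply/eqP; rewrite eq_le measure_ge0 andbT -(supp_full c).
apply: le_measure; rewrite ?inE.
- by apply: measurableC; exact: measurable_itv.
- by apply: measurableC; exact: (supp_measurable c).
- by apply: subsetC => x /Hr; rewrite /= in_itv/= ler_norml.
Qed.

Lemma Poin_Var_semicircle : Poin mu = 1 / Var mu id ->
  exists a r : R, 0 < r /\
           forall A : set (measurableTypeR R), measurable A ->
             mu A = semicircle_law a r A.
Proof.
move=> PV; have V0 := Var_id_gt0 mu_compact mu_not_dirac.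
set a := \int[mu]_x x; set V := Var mu id in PV V0 *.
pose r := Num.sqrt V; have r0 : 0 < r by rewrite sqrtr_gt0.
have r2 : r ^+ 2 = V by rewrite sqr_sqrtr// ltW.
exists a, r; split=> //.
pose nu : probR R := semicircle_prob a r0.
have nuE (A : set (measurableTypeR R)) : measurable A -> nu A = semicircle_law a r A by [].
have nuc := semicircle_compact r0 nuE.
have nud := semicircle_not_dirac nuE.
have nuV := semicircle_Var r0 nuE.
have num := semicircle_mean r0 nuE.
have nuP := semicircle_Poin r0 nuE.
have cm n : cmoment mu n = cmoment nu n.
  elim/ltn_ind: n => -[|n] ih; first by rewrite !cmoment0.
  rewrite (cmoment_rec mu_compact mu_not_dirac PV) (cmoment_rec nuc nud nuP) nuV r2.
  congr (_ * _); apply: eq_bigr => i _; rewrite !ih// ltnS.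
  - exact: ltnW.
  - by rewrite (leq_trans (leq_subr _ _))// leq_pred.
have [r1 [r10 Hr1]] := supp_bounded mu_compact.
have [r3 [r30 Hr3]] := supp_bounded nuc.
pose M := Num.max r1 r3.
have M1 : r1 <= M by rewrite le_max lexx.
have M3 : r3 <= M by rewrite le_max lexx orbT.
have muM : mu (~` `[- M, M]%classic) = 0%E.
  by apply: supp_full_itv => // x /Hr1 xr; exact: le_trans xr M1.
have nuM : nu (~` `[- M, M]%classic) = 0%E.
  by apply: supp_full_itv => // x /Hr3 xr; exact: le_trans xr M3.
have M0 : 0 < M by apply: lt_le_trans M1.
move=> A mA; rewrite -nuE//.
apply: (measure_eq_of_continuous muM nuM) => // f cf.
apply: (moments_continuous M0 muM nuM (c := a)) => // n.
by have := cm n; rewrite /cmoment num.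
Qed.

End semicircle_equality.

(** * Affine changes of variable *)

Section lebesgue_affine.
Context (R : realType).
Local Notation leb := (@lebesgue_measure R).
Local Notation mR := (measurableTypeR R).
Local Open Scope ereal_scope.

Lemma measurable_affine (k c : R) : measurable_fun setT ((fun t => k * t + c)%R : mR -> mR).
Proof.
apply: continuous_measurable_fun => x; apply: cvgD; last exact: cvg_cst.
by apply: cvgM; [exact: cvg_cst|exact: cvg_id].
Qed.

(** The scaling of the Lebesgue measure by an affine map. *)
Lemma lebesgue_affine (k c : R) (A : set mR) : k != 0%R -> measurable A ->
  leb A = `|k|%:E * leb ((fun t => k * t + c)%R @^-1` A).
Proof.
move=> k0 mA; have nk0 : (0 <= `|k|)%R by exact: normr_ge0.
rewrite -[RHS]/(pushforward (mscale (NngNum nk0) leb) ((fun t => k * t + c)%R : mR -> mR) A).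
apply: lebesgue_measure_unique => //; first exact: measurable_affine.
move=> mh _ [[x y] _ <-].
rewrite lebesgue_measure_itv/= /pushforward /mscale/=.
have [kp|kn] := ltrP 0%R k.
  have -> : (fun t => k * t + c)%R @^-1` `]x, y]%classic = `]((x - c) / k)%R, ((y - c) / k)%R]%classic.
    apply/seteqP; split => t /=; rewrite !in_itv/= ltr_pdivrMr// ler_pdivlMr// [(t * k)%R]mulrC.
      by move=> /andP[? ?]; apply/andP; split; lra.
    by move=> /andP[? ?]; apply/andP; split; lra.
  rewrite lebesgue_measure_itv/= !lte_fin ltr_pM2r ?invr_gt0// ltrD2r.
  case: ifPn => _; last by rewrite mule0.
  by rewrite -!EFinB -EFinM gtr0_norm//; congr EFin; field.
have kl : (k < 0)%R by rewrite lt_neqAle k0.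
have -> : (fun t => k * t + c)%R @^-1` `]x, y]%classic = `[((y - c) / k)%R, ((x - c) / k)%R[%classic.
  apply/seteqP; split => t /=; rewrite !in_itv/= ltr_ndivlMr// ler_ndivrMr// [(t * k)%R]mulrC.
    by move=> /andP[? ?]; apply/andP; split; lra.
  by move=> /andP[? ?]; apply/andP; split; lra.
rewrite lebesgue_measure_itv/= !lte_fin ltr_nM2r ?invr_lt0// ltrD2r.
case: ifPn => _; last by rewrite mule0.
by rewrite -!EFinB -EFinM ltr0_norm//; congr EFin; field.
Qed.

Lemma integral_affine (k c : R) (f : mR -> \bar R) : k != 0%R ->
  measurable_fun setT f -> (forall x, 0 <= f x) ->
  \int[leb]_x f x = `|k|%:E * \int[leb]_t f (k * t + c)%R.
Proof.
move=> k0 mf f0; have nk0 : (0 <= `|k|)%R by exact: normr_ge0.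
have mh := measurable_affine k c.
transitivity (\int[mscale (NngNum nk0) leb]_t f (k * t + c)%R).
  rewrite -[in RHS](preimage_setT (fun t => k * t + c)%R).
  rewrite -(ge0_integral_pushforward mh)//.
  by apply: eq_measure_integral => A mA _; exact: lebesgue_affine.
by rewrite ge0_integral_mscale//; exact: measurableT_comp.
Qed.

Lemma integral_affine_itv (k c x y : R) (f : mR -> \bar R) : (0 < k)%R ->
  measurable_fun setT f -> (forall x, 0 <= f x) ->
  k%:E * \int[leb]_(t in `[x, y]) f (k * t + c)%R = \int[leb]_(t in `[(k * x + c)%R, (k * y + c)%R]) f t.
Proof.
move=> k0 mf f0; rewrite [RHS]integral_mkcond.
rewrite (@integral_affine k c) ?gt_eqF//; last 2 first.
- by apply/(measurable_restrictT _ (measurable_itv _)); exact: measurable_funTS.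
- by move=> t; rewrite patchE; case: ifP.
rewrite gtr0_norm//; congr (_ * _); rewrite integral_mkcond; apply: eq_integral => t _.
rewrite !patchE; congr (if _ then _ else _).
by rewrite !mem_setE !in_itv/= lerD2r lerD2r !ler_pM2l.
Qed.

Lemma integral_opp_itv (x y : R) (f : mR -> \bar R) :
  measurable_fun setT f -> (forall x, 0 <= f x) ->
  \int[leb]_(t in `[x, y]) f (- t)%R = \int[leb]_(t in `[(- y)%R, (- x)%R]) f t.
Proof.
move=> mf f0; rewrite [RHS]integral_mkcond.
rewrite (@integral_affine (-1) 0) ?oppr_eq0 ?oner_eq0//; last 2 first.
- by apply/(measurable_restrictT _ (measurable_itv _)); exact: measurable_funTS.
- by move=> t; rewrite patchE; case: ifP.
rewrite normrN1 mul1e integral_mkcond; apply: eq_integral => t _.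
rewrite !patchE mulN1r addr0; congr (if _ then _ else _).
by rewrite !mem_setE !in_itv/= !lerN2 andbC.
Qed.

Lemma integral_itv_chasles (x y z : R) (f : mR -> \bar R) : (x <= y)%R -> (y <= z)%R ->
  measurable_fun setT f -> (forall x, 0 <= f x) ->
  \int[leb]_(t in `[x, y]) f t + \int[leb]_(t in `[y, z]) f t = \int[leb]_(t in `[x, z]) f t.
Proof.
move=> xy yz mf f0.
rewrite -(integral_itv_bndo_bndc (measurable_funTS mf)).
rewrite -ge0_integral_setU//.
- by congr (integral _ _ _); rewrite -itv_bndbnd_setU// bnd_simp.
- exact: measurable_funTS.
- apply/disj_setPS => t [/=]; rewrite !in_itv/= => /andP[_ ty] /andP[].
  by rewrite leNgt ty.
Qed.

End lebesgue_affine.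

(** * The logarithmic potential of the arcsine law *)

Section neg_log.
Context (R : realType).
Local Notation mR := (measurableTypeR R).
Local Open Scope ereal_scope.

(** [- log |x|], equal to [+oo] at the origin. *)
Definition nln (x : R) : \bar R := - lne `|x|%:E.

Lemma nlnE (x : R) : nln x = if x == 0%R then +oo else (- ln `|x|)%:E.
Proof.
rewrite /nln /lne normr_le0; case: ifPn => // _.
Qed.

Lemma nln0 : nln 0 = +oo. Proof. by rewrite nlnE eqxx. Qed.

Lemma nln_neq0 (x : R) : x != 0%R -> nln x = (- ln `|x|)%:E.
Proof. by move=> x0; rewrite nlnE (negbTE x0). Qed.

Lemma nln_gtNy (x : R) : -oo < nln x.
Proof. by rewrite nlnE; case: ifP => _; rewrite ?ltNyr. Qed.

Lemma nlnM (x y : R) : nln (x * y) = nln x + nln y.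
Proof.
rewrite !nlnE mulf_eq0; case: eqVneq => [_|x0]/=.
  by rewrite addye//; case: ifP.
case: eqVneq => [_|y0]; first by rewrite addey.
by rewrite -EFinD normrM lnM ?posrE ?normr_gt0// opprD.
Qed.

Lemma nlnN (x : R) : nln (- x) = nln x.
Proof. by rewrite /nln normrN. Qed.

Lemma nln_ge0 (x : R) : (`|x| <= 1)%R -> 0 <= nln x.
Proof.
move=> x1; rewrite nlnE; case: eqVneq => // x0.
by rewrite lee_fin oppr_ge0 ln_le0.
Qed.

Lemma le_nln (x y : R) : (`|x| <= `|y|)%R -> nln y <= nln x.
Proof.
move=> xy; have [->|x0] := eqVneq x 0%R; first by rewrite nln0 leey.
rewrite !nlnE (negbTE x0).
have y0 : y != 0%R by rewrite -normr_gt0 (lt_le_trans _ xy)// normr_gt0.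
by rewrite (negbTE y0) lee_fin lerN2 ler_ln ?posrE ?normr_gt0.
Qed.

Lemma measurable_nln : measurable_fun setT (nln : mR -> \bar R).
Proof.
rewrite (_ : nln = fun x => if x == 0%R then +oo else (- ln `|x|)%:E); last first.
  by apply/funext => x; rewrite nlnE.
apply: measurable_fun_ifT => //; first exact: measurable_fun_eqr.
apply/measurable_EFinP; apply: measurableT_comp => //.
apply: (measurableT_comp (@measurable_ln R)); exact: normr_measurable.
Qed.

End neg_log.

Section log_sine.
Context (R : realType).
Local Notation mR := (measurableTypeR R).
Local Notation leb := (@lebesgue_measure R).
Local Open Scope ereal_scope.

(** [- log |sin t|], with value [+oo] at the multiples of [pi]. *)
Definition lsin (t : R) : \bar R := nln (sin t).

Lemma lsin_ge0 t : 0 <= lsin t.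
Proof. by apply: nln_ge0; rewrite ler_norml sin_geN1 sin_le1. Qed.

Lemma measurable_sin : measurable_fun setT (@sin R : mR -> mR).
Proof. by apply: continuous_measurable_fun; exact: continuous_sin. Qed.

Lemma measurable_lsin : measurable_fun setT (lsin : mR -> \bar R).
Proof. exact: (measurableT_comp (@measurable_nln R) measurable_sin). Qed.

Lemma lsinN t : lsin (- t) = lsin t.
Proof. by rewrite /lsin sinN nlnN. Qed.

Lemma lsinDpi t : lsin (t + pi) = lsin t.
Proof. by rewrite /lsin sinDpi nlnN. Qed.

Lemma nln2 : nln 2 = (- ln 2 : R)%:E.
Proof. by rewrite nln_neq0 ?pnatr_eq0// ger0_norm. Qed.

(** The duplication formula of the sine. *)
Lemma lsin_double t : lsin t + (ln 2)%:E = lsin (2^-1 * t + 0) + lsin (2^-1 * t + pi / 2).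
Proof.
rewrite /lsin addr0 sinDpihalf -nlnM.
have -> : sin t = (2 * (sin (2^-1 * t) * cos (2^-1 * t)))%R.
  have {1}-> : (t = 2^-1 * t + 2^-1 * t)%R by field.
  by rewrite sinD; ring.
by rewrite nlnM nln2 addeC addeA -EFinD subrr add0e.
Qed.

Let pi0 : (0 < pi :> R)%R := pi_gt0 R.

Lemma integral_double (f : mR -> \bar R) : measurable_fun setT f -> (forall t, 0 <= f t) ->
  \int[leb]_(t in `[0%R, pi]) (f (2^-1 * t + 0) + f (2^-1 * t + pi / 2))%R =
  2%:E * \int[leb]_(t in `[0%R, pi]) f t.
Proof.
move=> mf f0.
have m1 (c : R) : measurable_fun setT (fun t : mR => f (2^-1 * t + c)%R).
  by apply: measurableT_comp => //; exact: measurable_affine.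
rewrite ge0_integralD//; last 2 first.
- exact: measurable_funTS.
- exact: measurable_funTS.
have h (c : R) : \int[leb]_(t in `[0%R, pi]) f (2^-1 * t + c)%R =
    2%:E * \int[leb]_(t in `[(2^-1 * 0 + c)%R, (2^-1 * pi + c)%R]) f t.
  by rewrite -integral_affine_itv// muleA -EFinM mulfV ?mul1e ?pnatr_eq0.
rewrite !h -ge0_muleDr ?integral_ge0//; congr (_ * _).
have -> : (2^-1 * 0 + 0 = 0 :> R)%R by rewrite mulr0 addr0.
have -> : (2^-1 * 0 + pi / 2 = 2^-1 * pi + 0 :> R)%R by rewrite mulr0; field.
have -> : (2^-1 * pi + pi / 2 = pi :> R)%R by field.
apply: integral_itv_chasles => //; first by rewrite addr0 mulr_ge0// ltW.
by rewrite addr0 ger_pMl// invf_le1// ler1n.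
Qed.

Let trunc_le (x y l n : R) : (0 <= x)%R -> (x <= ln 2)%R -> (0 <= l)%R -> (0 <= n)%R ->
  (l + ln 2 = x + y)%R ->
  (Num.min x n + Num.min y n <= Num.min l n + 2 * ln 2)%R.
Proof.
move=> x0 xl l0 n0 e; have ln20 : (0 <= ln 2 :> R)%R by rewrite ln_ge0// ler1n.
have h1 : (Num.min x n <= x)%R by rewrite ge_min lexx.
have h2 : (Num.min y n <= y)%R by rewrite ge_min lexx.
have h3 : (Num.min y n <= n)%R by rewrite ge_min lexx orbT.
by case: (leP l n) => ln; lra.
Qed.

(** The truncated integrals are finite, so that the duplication formula bounds them,
    independently of [n]. *)
Lemma lsin_trunc_le (n : R) : (0 <= n)%R ->
  \int[leb]_(t in `[0%R, pi]) Order.min (lsin t) n%:E <= (2 * ln 2 * pi)%:E.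
Proof.
move=> n0; set I := \int[leb]_(t in _) _.
have ln20 : (0 <= ln 2 :> R)%R by rewrite ln_ge0// ler1n.
have mt : measurable_fun setT (fun t : mR => Order.min (lsin t) n%:E).
  by apply: measurable_mine => //; exact: measurable_lsin.
have t0 t : 0 <= Order.min (lsin t) n%:E by rewrite le_min lsin_ge0 lee_fin.
have It : I <= (n * pi)%:E.
  apply: (@le_trans _ _ (\int[leb]_(t in `[0%R, pi]) n%:E)).
    apply: ge0_le_integral => //; first exact: measurable_funTS.
    by move=> t _; rewrite ge_min lexx orbT.
  by rewrite integral_cst//= lebesgue_measure_itv/= lte_fin pi0 -EFinD subr0 -EFinM.
have key : 2%:E * I <= I + (2 * ln 2 * pi)%:E.
  rewrite -integral_double//.
  have -> : (2 * ln 2 * pi)%:E = \int[leb]_(t in `[0%R, pi]) (2 * ln 2)%:E.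
    by rewrite integral_cst//= lebesgue_measure_itv/= lte_fin pi0 -EFinD subr0 -EFinM.
  rewrite -ge0_integralD//; last 2 first.
  - exact: measurable_funTS.
  - by move=> t _; rewrite lee_fin mulr_ge0.
  apply: ge0_le_integral => //.
  - by move=> t _; rewrite adde_ge0.
  - apply: measurable_funTS; apply: emeasurable_funD;
      by apply: (measurableT_comp mt); exact: measurable_affine.
  - apply: measurable_funTS; apply: emeasurable_funD => //.
  move=> t _; have := lsin_double t.
  (* one of [sin (t / 2)] and [cos (t / 2)] has absolute value at least [1 / 2] *)
  set x := lsin (_ + 0)%R; set y := lsin (_ + _ / _)%R => xy.
  have [x0 y0] : 0 <= x /\ 0 <= y by split; exact: lsin_ge0.
  have lt0 := lsin_ge0 t.
  have : x <= (ln 2)%:E \/ y <= (ln 2)%:E.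
    have half (u : R) : (4^-1 <= u ^+ 2)%R -> nln u <= (ln 2)%:E.
      move=> u4; have u2 : (2^-1 <= `|u|)%R.
        rewrite -(@ler_pXn2r _ 2)// ?nnegrE// real_normK ?num_real//.
        by rewrite exprVn -natrX.
      have un0 : u != 0%R by rewrite -normr_gt0 (lt_le_trans _ u2).
      rewrite nln_neq0// lee_fin -[leRHS]opprK lerN2 -lnV ?posrE//.
      by rewrite ler_ln ?posrE// (lt_le_trans _ u2).
    rewrite /x /y /lsin addr0 sinDpihalf.
    have [h|h] := leP 4^-1%R (sin (2^-1 * t) ^+ 2)%R; first by left; exact: half.
    by right; apply: half; rewrite sin2cos2 in h; lra.
  move: xy; case: (x) x0 => [x'| |]//; case: (y) y0 => [y'| |]//; case: (lsin t) lt0 => [l| |]//.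
  - rewrite !lee_fin -!EFin_min -!EFinD !lee_fin => l0 y0 x0 [xy] [xl|yl].
      exact: trunc_le.
    by rewrite [leLHS]addrC; apply: trunc_le => //; rewrite [RHS]addrC.
  - rewrite !lee_fin => l0 _ x0 _ [xl|//].
    rewrite !minye -EFin_min -!EFinD !lee_fin.
    have : (Num.min x' n <= x')%R by rewrite ge_min lexx.
    lra.
  - rewrite !lee_fin => l0 x0 _ _ [//|yl].
    rewrite !minye -EFin_min -!EFinD !lee_fin.
    have : (Num.min y' n <= y')%R by rewrite ge_min lexx.
    lra.
  - by move=> _ _ _ _ [].
have If : I \is a fin_num.
  rewrite ge0_fin_numE ?integral_ge0//; exact: le_lt_trans It (ltry _).
by move: key; rewrite -(fineK If) -EFinM -EFinD !lee_fin; lra.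
Qed.

Lemma lsin_integral_fin : \int[leb]_(t in `[0%R, pi]) lsin t < +oo.
Proof.
pose g (n : nat) (t : mR) := Order.min (lsin t) n%:R%:E.
have gl t : limn (g ^~ t) = lsin t.
  apply/cvg_lim => //; rewrite /g.
  case E : (lsin t) => [l| |].
  - apply: cvg_near_cst; near=> n.
    by apply/min_idPl; rewrite lee_fin; near: n; exact: nbhs_infty_ger.
  - by under eq_fun do rewrite minye; exact/cvgenyP.
  - by have := lsin_ge0 t; rewrite E.
under eq_integral do rewrite -gl.
rewrite monotone_convergence//; last 3 first.
- move=> n; apply: measurable_funTS; apply: measurable_mine => //; exact: measurable_lsin.
- by move=> n t _; rewrite /g le_min lsin_ge0 lee_fin ler0n.
- move=> t _ m n mn; rewrite /g le_min ge_min lexx/= ge_min.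
  by rewrite lee_fin ler_nat mn orbT.
apply: (@le_lt_trans _ _ (2 * ln 2 * pi)%:E); last exact: ltry.
apply: lime_le.
  apply: ereal_nondecreasing_is_cvgn => m n mn; apply: ge0_le_integral => //.
  - by move=> t _; rewrite /g le_min lsin_ge0 lee_fin ler0n.
  - apply: measurable_funTS; apply: measurable_mine => //; exact: measurable_lsin.
  - apply: measurable_funTS; apply: measurable_mine => //; exact: measurable_lsin.
  - move=> t _; rewrite /g le_min ge_min lexx/= ge_min.
    by rewrite lee_fin ler_nat mn orbT.
by apply: nearW => n; exact: lsin_trunc_le.
Unshelve. all: by end_near. Qed.

(** By duplication, the integral [I] satisfies [2 I = I + pi log 2]. *)
Lemma integral_lsin : \int[leb]_(t in `[0%R, pi]) lsin t = (ln 2 * pi)%:E.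
Proof.
set I := \int[leb]_(t in _) _.
have ln20 : (0 <= ln 2 :> R)%R by rewrite ln_ge0// ler1n.
have If : I \is a fin_num.
  rewrite ge0_fin_numE; first exact: lsin_integral_fin.
  by apply: integral_ge0 => t _; exact: lsin_ge0.
have : 2%:E * I = I + (ln 2 * pi)%:E.
  rewrite -(integral_double measurable_lsin lsin_ge0).
  under eq_integral do rewrite -lsin_double.
  rewrite ge0_integralD//.
  - by rewrite integral_cst//= lebesgue_measure_itv/= lte_fin pi0 -EFinD subr0 -EFinM.
  - by move=> t _; exact: lsin_ge0.
  - by apply: measurable_funTS; exact: measurable_lsin.
by rewrite -(fineK If) -EFinM -EFinD => -[?]; congr EFin; lra.
Qed.

Lemma integral_lsin_period (x : R) : (0 <= x <= pi)%R ->
  \int[leb]_(t in `[x, (x + pi)%R]) lsin t = (ln 2 * pi)%:E.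
Proof.
move=> /andP[x0 xpi].
rewrite -(@integral_itv_chasles _ x pi); [|by []|by rewrite lerDr|exact: measurable_lsin|exact: lsin_ge0].
have -> : \int[leb]_(t in `[pi, (x + pi)%R]) lsin t = \int[leb]_(t in `[0%R, x]) lsin t.
  have := @integral_affine_itv R 1 pi 0 x lsin ltr01 measurable_lsin lsin_ge0.
  rewrite mul1e !mul1r add0r => <-; apply: eq_integral => t _.
  by rewrite mul1r lsinDpi.
rewrite addeC integral_itv_chasles ?integral_lsin//; [exact: measurable_lsin|exact: lsin_ge0].
Qed.

(** The logarithmic potential of the arcsine law on [[-1, 1]] is constant there:
    with [w = cos f], the difference [cos t - w] is a product of two sines of
    [(t + f) / 2] and [(t - f) / 2], which together run over a period. *)
Lemma arcsine_potential (w : R) : (-1 <= w <= 1)%R ->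
  \int[angle_law R]_t ((ln 2)%:E + nln (cos t - w)) = (2 * ln 2)%:E.
Proof.
move=> w1; pose f : R := acos w.
have cf : cos f = w by rewrite /f acosK// in_itv.
have f0 : (0 <= f)%R by exact: acos_ge0.
have fpi : (f <= pi)%R by exact: acos_lepi.
have E (t : R) : (ln 2)%:E + nln (cos t - w) = lsin (2^-1 * t + f / 2) + lsin (2^-1 * t + - (f / 2)).
  have -> : (cos t - w = (- 2) * (sin (2^-1 * t + f / 2) * sin (2^-1 * t + - (f / 2))))%R.
    rewrite -cf.
    have -> : cos t = cos ((2^-1 * t + f / 2) + (2^-1 * t + - (f / 2))) by congr cos; field.
    have -> : cos f = cos ((2^-1 * t + f / 2) - (2^-1 * t + - (f / 2))) by congr cos; field.
    by move: (2^-1 * t + f / 2)%R (2^-1 * t + - (f / 2))%R => p q; rewrite cosD cosB; ring.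
  by rewrite nlnM nlnN nln2 addeA -EFinD subrr add0e nlnM.
under eq_integral do rewrite E.
have ms (c : R) : measurable_fun setT (fun t : mR => lsin (2^-1 * t + c)%R).
  by apply: (measurableT_comp measurable_lsin); exact: measurable_affine.
rewrite [LHS]integral_uniform; last 2 first.
- exact: emeasurable_funD.
- by move=> t; rewrite adde_ge0 ?lsin_ge0.
rewrite ge0_integralD//; last 4 first.
- by move=> t _; exact: lsin_ge0.
- exact: measurable_funTS.
- by move=> t _; exact: lsin_ge0.
- exact: measurable_funTS.
have h (c : R) : \int[leb]_(t in `[0%R, pi]) lsin (2^-1 * t + c)%R =
    2%:E * \int[leb]_(t in `[(2^-1 * 0 + c)%R, (2^-1 * pi + c)%R]) lsin t.
  rewrite -integral_affine_itv//; [|exact: measurable_lsin|exact: lsin_ge0].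
  by rewrite muleA -EFinM mulfV ?mul1e ?pnatr_eq0.
rewrite !h -ge0_muleDr ?integral_ge0//; [|by move=> *; exact: lsin_ge0|by move=> *; exact: lsin_ge0].
have -> : \int[leb]_(t in `[(2^-1 * 0 + - (f / 2))%R, (2^-1 * pi + - (f / 2))%R]) lsin t =
    \int[leb]_(t in `[(f / 2 + 2^-1 * pi)%R, (f / 2 + pi)%R]) lsin t.
  under eq_integral do rewrite -lsinN.
  rewrite integral_opp_itv; [|exact: measurable_lsin|exact: lsin_ge0].
  have := @integral_affine_itv R 1 pi (- (2^-1 * pi + - (f / 2)))
    (- (2^-1 * 0 + - (f / 2))) lsin ltr01 measurable_lsin lsin_ge0.
  rewrite mul1e; under eq_integral do rewrite mul1r lsinDpi.
  have -> : (1 * - (2^-1 * pi + - (f / 2)) + pi = f / 2 + 2^-1 * pi)%R by field.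
  have -> : (1 * - (2^-1 * 0 + - (f / 2)) + pi = f / 2 + pi)%R by field.
  by [].
have -> : (2^-1 * 0 + f / 2 = f / 2)%R by rewrite mulr0 add0r.
rewrite [(2^-1 * pi + f / 2)%R]addrC integral_itv_chasles; last 4 first.
- by rewrite lerDl mulr_ge0// ltW.
- by rewrite lerD2l ger_pMl// invf_le1// ler1n.
- exact: measurable_lsin.
- exact: lsin_ge0.
rewrite integral_lsin_period; last by apply/andP; split; lra.
rewrite subr0 -!EFinM; congr EFin.
by rewrite mulrC -!mulrA mulfV ?mulr1// gt_eqF.
Qed.

End log_sine.

(** * Minimizers of a quadratic energy *)

Section mixture.
Context d (T : measurableType d) (R : realType).
Local Open Scope ereal_scope.

Section definitions.
Variables (t : R) (t0 : (0 <= t)%R) (t1 : (0 <= 1 - t)%R) (mu nu : probability T R).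

(** The convex combination [(1 - t) mu + t nu]. *)
Definition mixture : set T -> \bar R :=
  measure_add (mscale (NngNum t1) mu) (mscale (NngNum t0) nu).

HB.instance Definition _ := Measure.on mixture.

Let mixture_setT : mixture setT = 1.
Proof.
rewrite /mixture measure_addE/= /mscale/=.
by rewrite !probability_setT !mule1 -EFinD subrK.
Qed.

HB.instance Definition _ := Measure_isProbability.Build _ _ _ mixture mixture_setT.

Lemma integral_mixture (f : T -> \bar R) : measurable_fun setT f -> (forall x, 0 <= f x) ->
  \int[mixture]_x f x = (1 - t)%:E * \int[mu]_x f x + t%:E * \int[nu]_x f x.
Proof.
by move=> mf f0; rewrite ge0_integral_measure_add// !ge0_integral_mscale.
Qed.

Lemma mixtureE A : mixture A = (1 - t)%:E * mu A + t%:E * nu A.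
Proof. by rewrite /mixture measure_addE/= /mscale/=. Qed.

End definitions.

Section conditioning.
Variables (mu : probability T R) (N : set T) (mN : measurable N) (N0 : mu N != 0).

Let c : R := (fine (mu N))^-1.
Let muNE : mu N = (fine (mu N))%:E.
Proof. by rewrite fineK// fin_num_measure. Qed.
Let f0 : (0 < fine (mu N))%R.
Proof. by rewrite -lte_fin -muNE lt0e N0 measure_ge0. Qed.
Let c0 : (0 <= c)%R. Proof. by rewrite invr_ge0 ltW. Qed.

(** The law [mu] conditioned on an event [N] of positive probability. *)
Definition conditional_law : set T -> \bar R := mscale (NngNum c0) (mrestr mu mN).

HB.instance Definition _ := Measure.on conditional_law.

Let conditional_law_setT : conditional_law setT = 1.
Proof.
by rewrite /conditional_law /mscale/= /mrestr setTI muNE -EFinM mulVf// gt_eqF.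
Qed.

HB.instance Definition _ :=
  Measure_isProbability.Build _ _ _ conditional_law conditional_law_setT.

Lemma conditional_law_full : conditional_law (~` N) = 0.
Proof. by rewrite /conditional_law /mscale/= /mrestr setICl measure0 mule0. Qed.

Lemma conditional_law_abs A : measurable A -> mu A = 0 -> conditional_law A = 0.
Proof.
move=> mA A0; rewrite /conditional_law /mscale/= /mrestr.
rewrite (_ : mu (A `&` N) = 0) ?mule0//; apply/eqP; rewrite eq_le measure_ge0 andbT -A0.
by apply: le_measure; rewrite ?inE//; exact: measurableI.
Qed.

Lemma integral_conditional_law_le : exists2 k : R, (0 <= k)%R &
  forall f : T -> \bar R, measurable_fun setT f -> (forall x, 0 <= f x) ->
  \int[conditional_law]_x f x <= k%:E * \int[mu]_x f x.
Proof.
exists c => // f mf ff; rewrite -(ge0_integral_mscale mu measurableT (NngNum c0))//.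
apply: ge0_le_measure_integral => // S mS; rewrite /conditional_law /mscale/=.
apply: lee_wpmul2l => //; rewrite /mrestr; apply: le_measure; rewrite ?inE//.
exact: measurableI.
Qed.

End conditioning.
End mixture.

Section minimal_energy.
Context d (T : measurableType d) (R : realType).
Local Open Scope ereal_scope.
Variables (k : T * T -> \bar R) (v : T -> \bar R).
Hypotheses (mk : measurable_fun setT k) (k0 : forall z, 0 <= k z).
Hypothesis ksym : forall x y, k (x, y) = k (y, x).
Hypotheses (mv : measurable_fun setT v) (v0 : forall x, 0 <= v x).

(** The potential created by [nu] through the kernel [k]. *)
Definition potential (nu : probability T R) (x : T) := \int[nu]_y k (x, y).

(** The energy of [nu]: confinement [v] plus pairwise interaction [k]. *)
Definition energy (nu : probability T R) := \int[nu]_x v x + \int[nu]_x potential nu x.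

Lemma potential_ge0 nu x : 0 <= potential nu x.
Proof. by apply: integral_ge0 => y _; exact: k0. Qed.

Lemma measurable_potential nu : measurable_fun setT (potential nu).
Proof. exact: measurable_fun_fubini_tonelli_F. Qed.

Lemma measurable_kernel1 x : measurable_fun setT (fun y => k (x, y)).
Proof. by apply: measurableT_comp => //; exact: measurable_pair1. Qed.

Lemma potential_sym (mu nu : probability T R) :
  \int[mu]_x potential nu x = \int[nu]_x potential mu x.
Proof.
rewrite /potential fubini_tonelli//; apply: eq_integral => y _.
by apply: eq_integral => x _; exact: ksym.
Qed.

Lemma potential_mixture t t0 t1 (mu nu : probability T R) x :
  potential (@mixture _ T R t t0 t1 mu nu) x = (1 - t)%:E * potential mu x + t%:E * potential nu x.
Proof. by rewrite /potential integral_mixture//; exact: measurable_kernel1. Qed.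

Lemma energy_mixture t t0 t1 (mu nu : probability T R) :
  energy (@mixture _ T R t t0 t1 mu nu) =
  ((1 - t)%:E * \int[mu]_x v x + t%:E * \int[nu]_x v x) +
  ((1 - t)%:E * ((1 - t)%:E * \int[mu]_x potential mu x + t%:E * \int[mu]_x potential nu x) +
   t%:E * ((1 - t)%:E * \int[mu]_x potential nu x + t%:E * \int[nu]_x potential nu x)).
Proof.
have mp := measurable_potential; have p0 := potential_ge0.
rewrite /energy integral_mixture//; congr (_ + _).
under eq_integral do rewrite potential_mixture.
have tE : 0 <= t%:E by rewrite lee_fin.
have t1E : 0 <= (1 - t)%:E by rewrite lee_fin.
have mz s nu' : measurable_fun setT (fun x => s%:E * potential nu' x).
  by apply: emeasurable_funM.
rewrite integral_mixture//; last 2 first.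
- exact: emeasurable_funD.
- by move=> x; rewrite adde_ge0// mule_ge0.
have h (la : probability T R) : \int[la]_x ((1 - t)%:E * potential mu x + t%:E * potential nu x) =
    (1 - t)%:E * \int[la]_x potential mu x + t%:E * \int[la]_x potential nu x.
  rewrite ge0_integralD//; try by move=> x _; rewrite mule_ge0.
  by rewrite !ge0_integralZl.
by rewrite !h (potential_sym nu mu).
Qed.

(** A quadratic function of [t] which is minimal at [t = 0] on [[0, 1[] has a
    nonnegative slope there. *)
Lemma slope_le (a b q11 q12 q22 : R) :
  (forall t, 0 < t -> t < 1 -> a + q11 <= (1 - t) * a + t * b +
    ((1 - t) * ((1 - t) * q11 + t * q12) + t * ((1 - t) * q12 + t * q22)))%R ->
  (a + 2 * q11 <= b + 2 * q12)%R.
Proof.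
move=> H; rewrite leNgt; apply/negP => lt.
set A := (a + 2 * q11 - b - 2 * q12)%R; have A0 : (0 < A)%R by rewrite /A; lra.
set S := (q11 - 2 * q12 + q22)%R; have S0 := normr_ge0 S; have SS := ler_norm S.
have den : (0 < 2 * (A + `|S|))%R by lra.
pose t := (A / (2 * (A + `|S|)))%R.
have t0 : (0 < t)%R by rewrite divr_gt0.
have t1 : (t < 1)%R by rewrite ltr_pdivrMr//; lra.
have tS : (t * `|S| <= A / 2)%R.
  rewrite /t mulrAC ler_pdivrMr// [leRHS](_ : _ = A * (A + `|S|))%R; last by field.
  by rewrite ler_pM2l//; lra.
have := H _ t0 t1.
have -> : ((1 - t) * a + t * b +
    ((1 - t) * ((1 - t) * q11 + t * q12) + t * ((1 - t) * q12 + t * q22)) =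
   a + q11 - t * (A - t * S))%R by rewrite /A /S; ring.
have : (t * S <= t * `|S|)%R by rewrite ler_pM2l.
move=> h1 h2; have : (0 < t * (A - t * S))%R by rewrite mulr_gt0//; lra.
lra.
Qed.

Variable mu : probability T R.
Variables (B : set T) (mB : measurable B).
Hypothesis muB : mu (~` B) = 0.
Hypothesis Efin : energy mu < +oo.
Hypothesis Emin : forall nu : probability T R, nu (~` B) = 0 -> energy mu <= energy nu.

(** The first variation of the energy at [mu], up to an additive constant. *)
Definition effective_potential x := v x + 2%:E * potential mu x.

Local Notation u := effective_potential.

Lemma effective_potential_ge0 x : 0 <= u x.
Proof. by rewrite adde_ge0// mule_ge0// potential_ge0. Qed.

Lemma measurable_effective_potential : measurable_fun setT u.
Proof.
apply: emeasurable_funD => //; apply: emeasurable_funM => //.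
exact: measurable_potential.
Qed.

Lemma integral_effective_potential (nu : probability T R) :
  \int[nu]_x u x = \int[nu]_x v x + 2%:E * \int[nu]_x potential mu x.
Proof.
have mp := measurable_potential mu; have p0 := potential_ge0 mu.
rewrite ge0_integralD//; first by rewrite ge0_integralZl.
- by move=> x _; rewrite mule_ge0.
- exact: emeasurable_funM.
Qed.

Let fin (nu : probability T R) (f : T -> \bar R) : (forall x, 0 <= f x) ->
  \int[nu]_x f x < +oo -> \int[nu]_x f x = (fine (\int[nu]_x f x))%:E.
Proof. by move=> f0 lt; rewrite fineK// ge0_fin_numE// integral_ge0. Qed.

Let sum_fin (a b : \bar R) : 0 <= a -> 0 <= b -> a + b < +oo -> a < +oo /\ b < +oo.
Proof. by case: a => [a| |]//; case: b => [b| |]//; rewrite ?ltry. Qed.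

(** The energy of [(1 - t) mu + t nu] is a quadratic function of [t]. *)
Lemma first_order_condition (nu : probability T R) : nu (~` B) = 0 -> energy nu < +oo ->
  \int[mu]_x potential nu x < +oo -> \int[mu]_x u x <= \int[nu]_x u x.
Proof.
move=> nuB En Q12.
have p0 := potential_ge0.
have I0 (la : probability T R) f : (forall x, 0 <= f x) -> 0 <= \int[la]_x f x.
  by move=> f0; exact: integral_ge0.
have [a1 q1] := sum_fin (I0 _ _ v0) (I0 _ _ (p0 _)) Efin.
have [b1 q2] := sum_fin (I0 _ _ v0) (I0 _ _ (p0 _)) En.
rewrite !integral_effective_potential (potential_sym nu mu).
have Emix t t0 t1 := @energy_mixture t t0 t1 mu nu; move: Emix Emin; rewrite /energy.
move: (fin v0 a1) (fin (p0 _) q1) (fin v0 b1) (fin (p0 _) q2) (fin (p0 _) Q12).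
move: (fine (\int[mu]_x v x)) => a -> ; move: (fine (\int[mu]_x potential mu x)) => q11 ->.
move: (fine (\int[nu]_x v x)) => b ->; move: (fine (\int[nu]_x potential nu x)) => q22 ->.
move: (fine (\int[mu]_x potential nu x)) => q12 -> Emix Em.
rewrite -!EFinM -!EFinD lee_fin; apply: (@slope_le _ _ _ _ q22) => t t0 t1.
have t1' : (0 <= 1 - t)%R by rewrite subr_ge0 ltW.
have nB : mixture (ltW t0) t1' mu nu (~` B) = 0.
  by rewrite mixtureE muB nuB !mule0 adde0.
by have := Em _ nB; rewrite Emix -!(EFinM, EFinD) lee_fin.
Qed.

Let integral_c (nu : probability T R) (c : \bar R) : \int[nu]_x c = c.
Proof.
rewrite (integral_cst nu measurableT c) -[RHS]mule1; congr (_ * _).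
exact: probability_setT.
Qed.

Let integral_addc (nu : probability T R) (f : T -> \bar R) (c : \bar R) :
  measurable_fun setT f -> (forall x, 0 <= f x) -> 0 <= c ->
  \int[nu]_x (f x + c) = \int[nu]_x f x + c.
Proof.
by move=> mf f0 c0; rewrite ge0_integralD// integral_c.
Qed.

Local Notation l := (\int[mu]_x u x).

Let l_fin : l < +oo.
Proof.
have [a1 q1] := sum_fin (integral_ge0 _ (fun x _ => v0 x)) (integral_ge0 _ (fun x _ => potential_ge0 mu x)) Efin.
rewrite integral_effective_potential (fin v0 a1) (fin (potential_ge0 mu) q1).
by rewrite -EFinM -EFinD ltry.
Qed.

Let l_ge0 : 0 <= l.
Proof. by apply: integral_ge0 => x _; exact: effective_potential_ge0. Qed.

(** If the event that the effective potential is below its mean had positive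
    probability, moving towards [mu] conditioned on it would lower the energy. *)
Lemma effective_potential_ae_ge (e : R) : (0 < e)%R -> mu [set x | u x + e%:E <= l] = 0.
Proof.
move=> e0; set N := [set x | _].
have mu' := measurable_effective_potential.
have mN : measurable N.
  rewrite -[X in measurable X]setTI; apply: measurable_lee => //; exact: emeasurable_funD.
apply/eqP/negPn/negP => N0.
have [k' k'0 le] := integral_conditional_law_le mN N0.
pose nu : probability T R := conditional_law mN N0.
have lf f : measurable_fun setT f -> (forall x, 0 <= f x) -> \int[mu]_x f x < +oo -> \int[nu]_x f x < +oo.
  move=> mf f0 lt; apply: (le_lt_trans (le _ mf f0)).
  by rewrite (fin f0 lt) -EFinM ltry.
have [a1 q1] := sum_fin (integral_ge0 _ (fun x _ => v0 x)) (integral_ge0 _ (fun x _ => potential_ge0 mu x)) Efin.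
have mp := measurable_potential; have p0 := potential_ge0.
have pnu x : potential nu x <= k'%:E * potential mu x.
  by apply: le => //; exact: measurable_kernel1.
have q12 : \int[mu]_x potential nu x < +oo.
  apply: (@le_lt_trans _ _ (k'%:E * \int[mu]_x potential mu x)); last first.
    by rewrite (fin (p0 mu) q1) -EFinM ltry.
  rewrite -ge0_integralZl//; apply: ge0_le_integral => //.
  exact: emeasurable_funM.
have q22 : \int[nu]_x potential nu x < +oo by exact: lf.
have b1 : \int[nu]_x v x < +oo by exact: lf.
have nuB : nu (~` B) = 0 by apply: conditional_law_abs => //; exact: measurableC.
have := first_order_condition nuB _ q12.
rewrite /energy (fin v0 b1) (fin (p0 _) q22) -EFinD ltry => /(_ isT).
apply/negP; rewrite -ltNge.
apply: (@lt_le_trans _ _ (\int[nu]_x (u x + e%:E))).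
  rewrite (integral_addc nu mu' effective_potential_ge0) ?lee_fin ?ltW//.
  have := lf _ mu' effective_potential_ge0 l_fin.
  move=> /(fin effective_potential_ge0) ->.
  by rewrite -EFinD lte_fin ltrDl.
have lc : l = \int[nu]_x l by rewrite integral_c.
rewrite [leRHS]lc; apply: ae_ge0_le_integral => //.
- by move=> x _; rewrite adde_ge0 ?effective_potential_ge0// lee_fin ltW.
- exact: emeasurable_funD.
exists (~` N); split => //; first exact: measurableC.
  exact: conditional_law_full.
by move=> x /= + Nx; apply.
Qed.

(** The effective potential is almost everywhere at least its mean, hence almost
    everywhere equal to it. *)
Lemma effective_potential_ae_le (e : R) : (0 < e)%R -> mu [set x | l + e%:E < u x] = 0.
Proof.
move=> e0; set M := [set x | _].
have mu' := measurable_effective_potential; have u0 := effective_potential_ge0.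
have mM : measurable M.
  rewrite -[X in measurable X]setTI.
  exact: measurable_lte.
have muM : mu M = (fine (mu M))%:E by rewrite fineK// fin_num_measure.
suff H (d' : R) : (0 < d')%R -> (e * fine (mu M) <= d')%R.
  rewrite muM; congr EFin; apply/eqP; rewrite eq_le fine_ge0 ?measure_ge0// andbT.
  rewrite -(pmulr_rle0 _ e0); apply/ler_addgt0Pr => d' d0; rewrite add0r; exact: H.
move=> d0.
have : l + e%:E * mu M <= l + d'%:E.
  have -> : l + e%:E * mu M = \int[mu]_x (l + e%:E * (\1_M x)%:E).
    move: l l_ge0 => l' l'0; under eq_integral do rewrite addeC.
    rewrite integral_addc//; last 2 first.
    - by apply: emeasurable_funM => //; exact/measurable_EFinP.
    - by move=> x; rewrite mule_ge0// lee_fin ltW.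
    rewrite addeC ge0_integralZl ?lee_fin ?(ltW e0)//; last exact/measurable_EFinP.
    by rewrite integral_indic// setIT.
  have -> : l + d'%:E = \int[mu]_x (u x + d'%:E).
    by rewrite (integral_addc mu mu' u0)// lee_fin ltW.
  apply: ae_ge0_le_integral => //.
  - by move=> x _; rewrite adde_ge0// mule_ge0// lee_fin ltW.
  - apply: emeasurable_funD => //; apply: emeasurable_funM => //; exact/measurable_EFinP.
  - by move=> x _; rewrite adde_ge0// lee_fin ltW.
  - exact: emeasurable_funD.
  exists [set x | u x + d'%:E <= l]; split.
  - rewrite -[X in measurable X]setTI; apply: measurable_lee => //; exact: emeasurable_funD.
  - exact: effective_potential_ae_ge.
  move=> x /= H; rewrite leNgt; apply/negP => lt; apply: H => _; rewrite indicE.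
  have [xM|xM] := boolP (x \in M); last by rewrite mule0 adde0 ltW.
  rewrite mule1; move/set_mem : xM => /ltW/le_trans; apply.
  by rewrite leeDl// lee_fin ltW.
rewrite muM (fin u0 l_fin) -EFinM -!EFinD lee_fin; lra.
Qed.

End minimal_energy.

(** * The logarithmic energy on an interval *)

Section log_repulsion.
Context (R : realType).
Variable D : R.
Local Notation mR := (measurableTypeR R).
Local Open Scope ereal_scope.

(** The logarithmic repulsion [log (D / |x - y|)], truncated below at [0]; the
    truncation plays no role for points at distance at most [D]. *)
Definition repulsion (z : mR * mR) : \bar R := maxe 0 ((ln D)%:E + nln (z.1 - z.2)).

Lemma repulsion_ge0 z : 0 <= repulsion z.
Proof. by rewrite le_max lexx. Qed.

Let measurable_diff : measurable_fun setT (fun z : mR * mR => (z.1 - z.2)%R : mR).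
Proof. exact: (measurable_funB measurable_fst measurable_snd). Qed.

Lemma measurable_repulsion : measurable_fun setT repulsion.
Proof.
apply: measurable_maxe => //; apply: emeasurable_funD => //.
exact: (measurableT_comp (@measurable_nln R) measurable_diff).
Qed.

Lemma repulsion_sym x y : repulsion (x, y) = repulsion (y, x).
Proof. by rewrite /repulsion/= -nlnN opprB. Qed.

Lemma log_kernelE z : @log_kernel R z = - nln (z.1 - z.2).
Proof. by rewrite /nln oppeK. Qed.

Lemma measurable_log_kernel : measurable_fun setT (@log_kernel R).
Proof.
rewrite (_ : @log_kernel R = fun z => - nln (z.1 - z.2)); last first.
  by apply/funext => z; exact: log_kernelE.
apply: measurableT_comp => //.
exact: (measurableT_comp (@measurable_nln R) measurable_diff).
Qed.

Lemma repulsion_near x y : (0 < D)%R -> (`|x - y| <= D)%R ->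
  repulsion (x, y) = (ln D)%:E + nln (x - y).
Proof.
move=> D0 xy; rewrite /repulsion/=; apply/max_idPr; rewrite nlnE.
case: eqVneq => [_|xy0]; first by rewrite addey.
by rewrite -EFinD lee_fin subr_ge0 ler_ln ?posrE ?normr_gt0.
Qed.

(** Moving a point closer increases the repulsion. *)
Lemma le_repulsion x y x' y' : (`|x - y| <= `|x' - y'|)%R ->
  repulsion (x', y') <= repulsion (x, y).
Proof.
move=> le; rewrite /repulsion/= ge_max le_max lexx/= le_max.
by rewrite leeD2l ?orbT// le_nln.
Qed.

(** Convexity of [- log |x|] on each side of the origin. *)
Lemma nln_convex (l p q : R) : (0 <= l <= 1)%R -> (0 <= p * q)%R -> 
  nln (l * p + (1 - l) * q) <= l%:E * nln p + (1 - l)%:E * nln q.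
Proof.
case/andP => l0 l1 pq; have [->|ln0] := eqVneq l 0%R.
  by rewrite mul0r add0r subr0 mul1r mul0e add0e mul1e.
have [->|ln1] := eqVneq l 1%R.
  by rewrite subrr mul0r addr0 mul1r mul0e adde0 mul1e.
have lp : (0 < l)%R by rewrite lt_neqAle eq_sym ln0.
have ll : (0 < 1 - l)%R by rewrite subr_gt0 lt_neqAle ln1.
have nN (c r : R) : (0 < c)%R -> c%:E * nln r != -oo.
  by move=> c0; rewrite nlnE; case: ifP => _; rewrite ?gt0_muley ?lte_fin.
have [->|p0] := eqVneq p 0%R.
  by rewrite nln0 gt0_muley ?lte_fin// addye ?leey// nN.
have [->|q0] := eqVneq q 0%R.
  by rewrite nln0 gt0_muley ?lte_fin// addey ?leey// nN.
have np0 : (0 < `|p|)%R by rewrite normr_gt0.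
have nq0 : (0 < `|q|)%R by rewrite normr_gt0.
have e : (`|l * p + (1 - l) * q| = l * `|p| + (1 - l) * `|q|)%R.
  have [pp|pn] := ltrP 0%R p.
    have qq : (0 <= q)%R by rewrite -(pmulr_rge0 _ pp).
    by rewrite !ger0_norm ?addr_ge0 ?mulr_ge0// ltW.
  have pl : (p < 0)%R by rewrite lt_neqAle p0.
  have qq : (q <= 0)%R by rewrite -(nmulr_rge0 _ pl).
  rewrite !ler0_norm//; first ring.
  have h1 := mulr_ge0_le0 l0 pn; have h2 := mulr_ge0_le0 (ltW ll) qq.
  lra.
have en : (l * p + (1 - l) * q != 0)%R.
  by rewrite -normr_gt0 e addr_gt0 ?mulr_gt0.
rewrite !nln_neq0// -!EFinM -EFinD lee_fin e.
have := concave_ln (Itv01 l0 l1) np0 nq0; rewrite !convRE/= /unstable.onem.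
lra.
Qed.

End log_repulsion.

Section log_energy.
Context (R : realType) (a b C : R) (V : R -> R) (nu : probR R).
Hypotheses (ab : a < b) (cV : continuous V) (VC : forall x, a <= x <= b -> 0 <= V x + C).
Local Notation mR := (measurableTypeR R).
Local Notation I := (`[a, b]%classic : set mR).
Hypothesis nuI : nu (~` I) = 0%E.
Local Notation k := (repulsion (b - a)).
Local Open Scope ereal_scope.

(** The confining potential, shifted and truncated so as to be nonnegative. *)
Definition confinement (x : mR) : \bar R := (Num.max 0 (V x + C))%:E.

Lemma confinement_ge0 x : 0 <= confinement x.
Proof. by rewrite lee_fin le_max lexx. Qed.

Lemma measurable_confinement : measurable_fun setT confinement.
Proof.
apply/measurable_EFinP; apply: measurable_maxr => //.
by apply: measurable_funD => //; exact: continuous_measurable_fun.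
Qed.

Lemma confinementE x : (a <= x <= b)%R -> confinement x = (V x + C)%:E.
Proof. by move=> /VC h; rewrite /confinement; congr EFin; apply/max_idPr. Qed.

Let mI : measurable I. Proof. exact: measurable_itv. Qed.
Let bV := continuous_bmeas_itv a b cV.

Lemma integral_confinement : \int[nu]_x confinement x = (\int[nu]_x V x + C)%:E.
Proof.
have bVC := bmeasD bV (bmeas_cst I (C : R)).
have -> : (\int[nu]_x V x + C = \int[nu]_x (V x + C))%R.
  by rewrite (bmeas_intD mI nuI bV (bmeas_cst _ _)) Rint_cst.
rewrite /Rintegral fineK; last first.
  by apply: integrable_fin_num => //; exact: (bmeas_integrable mI nuI bVC).
apply: ae_eq_integral => //.
- exact: measurable_confinement.
- by apply/measurable_EFinP; case: bVC.
exists (~` I); split => //; first exact: measurableC.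
by move=> x /= H Ix; apply: H => _; rewrite confinementE.
Qed.

Let mI2 : measurable (I `*` I). Proof. exact: measurable_square. Qed.
Let nuI2 : (nu \x nu) (~` (I `*` I)) = 0. Proof. exact: square_full. Qed.

Let dist x y : I x -> I y -> (`|x - y| <= b - a)%R.
Proof.
rewrite /= !in_itv/= => /andP[? ?] /andP[? ?].
by rewrite ler_norml; apply/andP; split; lra.
Qed.

Let kE z : (I `*` I) z -> k z = (ln (b - a))%:E - log_kernel z.
Proof.
case: z => x y [/= Ix Iy]; rewrite log_kernelE oppeK repulsion_near ?subr_gt0//.
exact: dist.
Qed.

Let lE z : (I `*` I) z -> log_kernel z = (ln (b - a))%:E - k z.
Proof.
move=> Iz; rewrite kE//; case: (log_kernel z) => [r| |]//=.
by rewrite -!EFinD; congr EFin; lra.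
Qed.

Let restrict (f : mR * mR -> \bar R) : measurable_fun setT f ->
  (nu \x nu).-integrable (I `*` I) f -> (nu \x nu).-integrable setT f.
Proof.
move=> mf fi; apply/(negligible_integrable (measurableC mI2) measurableT mf nuI2).
by rewrite setTD setCK.
Qed.

Let cst_int c : (nu \x nu).-integrable (I `*` I) (cst c%:E).
Proof.
apply: (integrableS measurableT) => //.
exact: (bmeas_integrable mI2 nuI2 (bmeas_cst _ (c : R))).
Qed.

Lemma log_kernel_integrableE :
  (nu \x nu).-integrable setT (@log_kernel R) <-> (nu \x nu).-integrable setT k.
Proof.
split=> hi; apply: restrict.
- exact: measurable_repulsion.
- apply: (@eq_integrable _ _ _ _ _ mI2 (fun z => (ln (b - a))%:E - log_kernel z)).
    by move=> z /set_mem Iz; rewrite kE.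
  apply: integrableB => //; first exact: cst_int.
  exact: integrableS hi.
- exact: measurable_log_kernel.
- apply: (@eq_integrable _ _ _ _ _ mI2 (fun z => (ln (b - a))%:E - k z)).
    by move=> z /set_mem Iz; rewrite lE.
  apply: integrableB => //; first exact: cst_int.
  exact: integrableS hi.
Qed.

(** On measures carried by [[a, b]], minimizing the logarithmic energy amounts to
    minimizing the sum of two nonnegative terms, whose value may be infinite. *)
Lemma log_energyE : log_energy V nu = energy k confinement nu - (C + ln (b - a))%:E.
Proof.
have Qk : \int[nu \x nu]_z k z = \int[nu]_x potential k nu x.
  rewrite fubini_tonelli1//; last exact: repulsion_ge0.
  exact: measurable_repulsion.
rewrite /log_energy /energy integral_confinement -Qk; case: asboolP => [[_ li]|nli].
  have ki := log_kernel_integrableE.1 li.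
  have kS : (nu \x nu).-integrable (I `*` I) k by exact: integrableS ki.
  rewrite (negligible_integral (measurableC mI2) measurableT li nuI2) setTD setCK.
  rewrite (negligible_integral (measurableC mI2) measurableT ki nuI2) setTD setCK.
  rewrite (eq_integral (fun z => (ln (b - a))%:E - k z)); last first.
    by move=> z /set_mem Iz; rewrite lE.
  rewrite integralB//; last exact: cst_int.
  have -> : \int[nu \x nu]_(z in I `*` I) (ln (b - a))%:E = (ln (b - a))%:E.
    transitivity (\int[nu \x nu]_z (ln (b - a))%:E).
      have ci := bmeas_integrable mI2 nuI2 (bmeas_cst _ (ln (b - a))).
      rewrite [RHS](negligible_integral (measurableC mI2) measurableT ci nuI2).
      by rewrite setTD setCK.
    rewrite (integral_cst (nu \x nu) measurableT) -[RHS]mule1; congr (_ * _).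
    exact: probability_setT.
  have := integrable_fin_num mI2 kS.
  have -> : \int[nu]_x (V x)%:E = (\int[nu]_x V x)%:E.
    by rewrite fineK//; apply: integrable_fin_num => //; exact: (bmeas_integrable mI nuI bV).
  move: (\int[nu \x nu]_(z in _) k z) => [q| |]// _.
  by rewrite -!EFinD; congr EFin; lra.
have -> : \int[nu \x nu]_z k z = +oo; last by rewrite addey// addye.
apply/eqP; apply: contra_notT nli => koo; split.
  exact: (bmeas_integrable mI nuI bV).
apply/log_kernel_integrableE/integrableP; split; first exact: measurable_repulsion.
under eq_integral do rewrite gee0_abs ?repulsion_ge0//.
by rewrite ltey.
Qed.

End log_energy.

(** * Arcsine laws on intervals *)

Section arcsine.
Context (R : realType) (c L : R).
Hypothesis L0 : 0 < L.
Local Notation mR := (measurableTypeR R).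
Local Open Scope ereal_scope.

Let arc (t : mR) : mR := (c + L * cos t)%R.

Let continuous_arc : continuous (arc : R -> R).
Proof.
move=> x; apply: cvgD; first exact: cvg_cst.
by apply: cvgM; [exact: cvg_cst|exact: continuous_cos].
Qed.

Lemma measurable_arc : measurable_fun setT arc.
Proof. exact: continuous_measurable_fun. Qed.

(** The law of [c + L cos t] for a uniform angle [t] in [0, pi]. *)
Definition arcsine_law : probR R :=
  distribution (angle_law R) (mfun_Sub (mem_set measurable_arc)).

Lemma integral_arcsine_law (f : mR -> \bar R) : measurable_fun setT f -> (forall x, 0 <= f x) ->
  \int[arcsine_law]_x f x = \int[angle_law R]_t f (c + L * cos t)%R.
Proof. by move=> mf f0; rewrite ge0_integral_distribution. Qed.

Lemma arc_bound t : (c - L <= c + L * cos t <= c + L)%R.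
Proof.
have h1 : (L * -1 <= L * cos t)%R by rewrite ler_pM2l// cos_geN1.
have h2 : (L * cos t <= L * 1)%R by rewrite ler_pM2l// cos_le1.
by apply/andP; split; lra.
Qed.

Lemma arcsine_law_full (a b : R) : (a <= c - L)%R -> (c + L <= b)%R ->
  arcsine_law (~` `[a, b]%classic) = 0.
Proof.
move=> aL bL; rewrite /arcsine_law/= /distribution/= /pushforward.
rewrite (_ : _ @^-1` _ = set0) ?measure0//.
apply/seteqP; split => // t /=; apply; rewrite in_itv/=.
have /andP[h1 h2] := arc_bound t.
by apply/andP; split; [exact: le_trans h1|exact: le_trans bL].
Qed.

Variable D : R.
Hypothesis LD : (2 * L <= D)%R.
Local Notation k := (repulsion D).

Let D0 : (0 < D)%R. Proof. by have := L0; have := LD; lra. Qed.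

Lemma repulsion_arcsine (y : R) : (c - L <= y <= c + L)%R ->
  \int[angle_law R]_t k (c + L * cos t, y)%R = (ln D + ln 2 - ln L)%:E.
Proof.
move=> /andP[y1 y2]; pose w := ((y - c) / L)%R.
have w1 : (-1 <= w <= 1)%R.
  by rewrite ler_pdivlMr// ler_pdivrMr// mulN1r mul1r; apply/andP; split; lra.
have e0 : (0 <= ln D - ln L - ln 2)%R.
  have -> : (ln D - ln L - ln 2 = ln D - ln (2 * L))%R by rewrite lnM ?posrE//; ring.
  by rewrite subr_ge0 ler_ln ?posrE// mulr_gt0.
have E t : k (c + L * cos t, y)%R = (ln D - ln L - ln 2)%:E + ((ln 2)%:E + nln (cos t - w)).
  have /andP[h1 h2] := arc_bound t.
  rewrite repulsion_near//; last first.
    by rewrite ler_norml; have ld := LD; apply/andP; split; lra.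
  have -> : (c + L * cos t - y = L * (cos t - w))%R by rewrite /w; field; rewrite gt_eqF.
  rewrite nlnM nln_neq0 ?gt_eqF// gtr0_norm// !addeA -!EFinD; congr (_%:E + _); lra.
under eq_integral do rewrite E.
have mn : measurable_fun setT (fun t : mR => (ln 2)%:E + nln (cos t - w)).
  apply: emeasurable_funD => //; apply: (measurableT_comp (@measurable_nln R)).
  apply: measurable_funB => //; apply: continuous_measurable_fun; exact: continuous_cos.
rewrite ge0_integralD//; last first.
  move=> t _; rewrite nlnE; case: eqVneq => [_|cw]; first by rewrite addey.
  rewrite -EFinD lee_fin subr_ge0 ler_ln ?posrE ?normr_gt0//.
  have := cos_geN1 t; have := cos_le1 t; case/andP: w1 => *.
  by rewrite ler_norml; apply/andP; split; lra.
rewrite arcsine_potential// (integral_cst _ measurableT).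
rewrite [X in _ * X](_ : _ = 1) ?mule1; last exact: probability_setT.
by rewrite -EFinD; congr EFin; lra.
Qed.

(** Outside of the support, the repulsion is smaller than at the nearest end. *)
Lemma repulsion_arcsine_le (y : R) :
  \int[angle_law R]_t k (c + L * cos t, y)%R <= (ln D + ln 2 - ln L)%:E.
Proof.
have H y' : (c - L <= y' <= c + L)%R ->
    (forall x, c - L <= x <= c + L -> `|x - y'| <= `|x - y|)%R ->
    \int[angle_law R]_t k (c + L * cos t, y)%R <= (ln D + ln 2 - ln L)%:E.
  move=> y'L le; rewrite -(repulsion_arcsine y'L).
  have mk z : measurable_fun setT (fun t : mR => k (c + L * cos t, z)%R).
    apply: (measurableT_comp (@measurable_repulsion R D)).
    exact: (measurable_fun_pair measurable_arc (measurable_cst z)).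
  apply: ge0_le_integral => //; first by move=> t _; exact: repulsion_ge0.
  by move=> t _; apply: le_repulsion; apply: le; exact: arc_bound.
have l0 := L0.
have [y1|y1] := ltrP y (c - L)%R.
  apply: (H (c - L)%R) => [|x /andP[x1 x2]]; first by apply/andP; split; lra.
  by rewrite !ger0_norm; lra.
have [y2|y2] := ltrP (c + L)%R y.
  apply: (H (c + L)%R) => [|x /andP[x1 x2]]; first by apply/andP; split; lra.
  by rewrite !ler0_norm; lra.
by apply: (H y) => //; rewrite y1.
Qed.

Lemma potential_arcsine (y : R) : (c - L <= y <= c + L)%R ->
  potential k arcsine_law y = (ln D + ln 2 - ln L)%:E.
Proof.
move=> yL; rewrite /potential integral_arcsine_law; last 2 first.
- exact: (measurable_kernel1 (@measurable_repulsion R D)).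
- by move=> ?; exact: repulsion_ge0.
by rewrite -(repulsion_arcsine yL); apply: eq_integral => t _; exact: repulsion_sym.
Qed.

Lemma potential_arcsine_le (y : R) : potential k arcsine_law y <= (ln D + ln 2 - ln L)%:E.
Proof.
rewrite /potential integral_arcsine_law; last 2 first.
- exact: (measurable_kernel1 (@measurable_repulsion R D)).
- by move=> ?; exact: repulsion_ge0.
apply: le_trans (repulsion_arcsine_le y).
rewrite le_eqVlt; apply/orP; left; apply/eqP.
by apply: eq_integral => t _; exact: repulsion_sym.
Qed.

End arcsine.

(** * The Euler-Lagrange conditions for the logarithmic energy *)

Section sequences_limits.
Context (R : realType).
Local Open Scope ereal_scope.

(** Continuity of [- log |x|] as an extended real valued function. *)
Lemma addr_nln_cvg (r : R) (x_ : nat -> R) (x : R) : x_ @ \oo --> x ->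
  (fun n => r%:E + nln (x_ n)) @ \oo --> r%:E + nln x.
Proof.
move=> xx; have [x0|x0] := eqVneq x 0%R.
  rewrite x0 nln0 addey//; apply/cvgeyPge => A.
  have /cvgrPdist_lt/(_ _ (expR_gt0 (r - A))) := xx.
  apply: filterS => n; rewrite x0 sub0r normrN => xn.
  rewrite nlnE; case: eqVneq => [_|xn0]; first by rewrite addey ?leey.
  rewrite -EFinD lee_fin lerBrDl -lerBrDr -(expRK (r - A)%R).
  by rewrite ler_ln ?posrE ?normr_gt0 ?expR_gt0// ltW.
have hn : \forall n \near \oo, x_ n != 0%R by exact: (cvgr_neq0 _ xx x0).
rewrite nln_neq0// -EFinD; apply: cvg_EFin.
  move: hn; apply: filterS => n xn0.
  by rewrite nln_neq0.
have h : (fun n => (r - ln `|x_ n|)%R) @ \oo --> (r - ln `|x|)%R.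
  apply: cvgB; first exact: cvg_cst.
  apply: continuous_cvg; last exact: cvg_norm.
  by apply: continuous_ln; rewrite normr_gt0.
apply: cvg_trans h; apply: near_eq_cvg.
move: hn; apply: filterS => n xn0 /=.
by rewrite nln_neq0.
Qed.

Lemma adherent_sequence (x : R) (A : set R) : (forall e, 0 < e -> exists2 y, A y & `|x - y| < e)%R ->
  exists2 x_ : nat -> R, (forall n, A (x_ n)) & x_ @ \oo --> x.
Proof.
move=> H; have /choice[x_ Hx] n : exists y, A y /\ (`|x - y| < harmonic n)%R.
  by have [//|y Ay xy] := H (@harmonic R n); [exact: harmonic_gt0|exists y].
exists x_; first by move=> n; have [] := Hx n.
apply/cvgrPdist_lt => e e0.
have /cvgrPdist_lt/(_ _ e0) := @cvg_harmonic R; apply: filterS => n.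
rewrite sub0r normrN; have [_ h] := Hx n => h2; apply: (lt_trans h).
by rewrite -[ltLHS]ger0_norm ?harmonic_ge0.
Qed.

Lemma addr_nln_convex (r l p q : R) : (0 < l < 1)%R -> (0 <= p * q)%R ->
  r%:E + nln (l * p + (1 - l) * q) <=
  l%:E * (r%:E + nln p) + (1 - l)%:E * (r%:E + nln q).
Proof.
move=> /andP[l0 l1] pq; have ll : (0 < 1 - l)%R by rewrite subr_gt0.
have l01 : (0 <= l <= 1)%R by rewrite !ltW.
have := @nln_convex R l p q l01 pq.
have := nln_gtNy p; have := nln_gtNy q; case: (nln p) => [P| |]//; case: (nln q) => [Q| |]// _ _.
- case: (nln (_ + _)) => [X| |]; rewrite ?leNye// -?EFinM -?EFinD -?EFinM -?EFinD ?lee_fin//; lra.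
- by move=> _; rewrite (_ : r%:E + +oo = +oo)// (_ : (1 - l)%:E * +oo = +oo) ?gt0_muley ?lte_fin// addey ?leey.
- by move=> _; rewrite (_ : r%:E + +oo = +oo)// (_ : l%:E * +oo = +oo) ?gt0_muley ?lte_fin// addye ?leey.
- by move=> _; rewrite !addey// !gt0_muley ?lte_fin// ?leey.
Qed.

End sequences_limits.

Section log_gas.
Context (R : realType) (mu : probR R) (V : R -> R) (C : R).
Hypothesis mu_compact : compact (supp mu).
Hypothesis mu_not_dirac : ~ exists a : R, mu [set a] = 1%E.
Hypothesis cV : continuous V.
Hypothesis Vconvex : forall l x y, 0 <= l <= 1 ->
  V (l * x + (1 - l) * y) <= l * V x + (1 - l) * V y.
Hypothesis Vmin : energy_minimizer V mu.
Local Notation mR := (measurableTypeR R).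
Local Notation K := (supp mu : set mR).
Local Notation a := (inf K).
Local Notation b := (sup K).
Hypothesis VC : forall x, a <= x <= b -> 0 <= V x + C.
Local Notation I := (`[a, b]%classic : set mR).
Local Notation k := (repulsion (b - a)).
Local Notation v := (confinement C V).
Local Notation c := ((a + b) / 2).
Local Notation L := ((b - a) / 2).
Local Notation u := (effective_potential k v mu).
Local Open Scope ereal_scope.

Let ab : (a < b)%R. Proof. exact: inf_lt_sup. Qed.
Let mI : measurable I. Proof. exact: measurable_itv. Qed.

Let muI : mu (~` I) = 0.
Proof.
have [_ [_ KI]] := inf_supp mu_compact.
apply/eqP; rewrite eq_le measure_ge0 andbT -(supp_full mu_compact).
apply: le_measure; rewrite ?inE; [exact: measurableC|apply: measurableC; exact: supp_measurable|].
by apply: subsetC => x Kx; rewrite /= in_itv/=; exact: KI.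
Qed.

Let mk := @measurable_repulsion R (b - a).
Let k0 := @repulsion_ge0 R (b - a).
Let ksym := @repulsion_sym R (b - a).
Let mv := measurable_confinement C cV.
Let v0 := @confinement_ge0 R C V.

Let Emin (nu : probR R) : nu (~` I) = 0 -> energy k v mu <= energy k v nu.
Proof.
move=> nuI; have := Vmin nu.
rewrite (log_energyE ab cV VC muI) (log_energyE ab cV VC nuI).
by rewrite leeD2rE.
Qed.

Local Notation arc s := (arcsine_law c (s * L)).

Section arc.
Variable s : R.
Hypotheses (s0 : (0 < s)%R) (s1 : (s <= 1)%R).

Let L0 : (0 < s * L)%R. Proof. by have := ab => h; rewrite mulr_gt0//; lra. Qed.
Let LD : (2 * (s * L) <= b - a)%R.
Proof.
have -> : (2 * (s * L) = s * (b - a))%R by field.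
by rewrite ler_piMl// subr_ge0 ltW.
Qed.

Let arcI : arc s (~` I) = 0.
Proof. by have h := LD; apply: (arcsine_law_full L0); lra. Qed.

Let int_le (nu : probR R) : \int[nu]_x potential k (arc s) x <= (ln (b - a) + ln 2 - ln (s * L))%:E.
Proof.
set X := (ln (b - a) + ln 2 - ln (s * L))%R.
apply: (@le_trans _ _ (\int[nu]_x X%:E)); last first.
  rewrite (integral_cst nu measurableT) [X in _ * X](_ : _ = 1) ?mule1//.
  exact: probability_setT.
apply: ge0_le_integral => //.
- by move=> x _; exact: potential_ge0.
- exact: measurable_potential.
- by move=> x _; exact: potential_arcsine_le.
Qed.

Let Earc : energy k v (arc s) < +oo.
Proof.
rewrite /energy (integral_confinement cV VC arcI).
by apply: lte_add_pinfty; [exact: ltry|exact: le_lt_trans (int_le _) (ltry _)].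
Qed.

(** The minimizer has finite energy because arcsine laws do. *)
Lemma energy_fin : energy k v mu < +oo.
Proof. exact: le_lt_trans (Emin arcI) Earc. Qed.

Lemma effective_potential_arc :
  \int[mu]_x u x <= (\int[arc s]_x V x + C)%:E + 2%:E * (ln (b - a) + ln 2 - ln (s * L))%:E.
Proof.
have fin : \int[mu]_x potential k (arc s) x < +oo by exact: le_lt_trans (int_le _) (ltry _).
apply: (le_trans (first_order_condition mk k0 ksym mv v0 muI energy_fin Emin arcI Earc fin)).
rewrite (integral_effective_potential mk k0 mv v0) (integral_confinement cV VC arcI).
rewrite leeD2l// lee_pmul2l// (potential_sym mk k0 ksym); exact: int_le.
Qed.

End arc.

Let l := \int[mu]_x u x.

Let l_fin : l \is a fin_num.
Proof.
rewrite ge0_fin_numE; last by apply: integral_ge0 => x _; exact: effective_potential_ge0.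
apply: (le_lt_trans (effective_potential_arc ltr01 (lexx _))).
by rewrite -EFinM -EFinD ltry.
Qed.

Let I_dist x y : I x -> I y -> (`|x - y| <= b - a)%R.
Proof.
rewrite /= !in_itv/= => /andP[? ?] /andP[? ?].
by rewrite ler_norml; apply/andP; split; lra.
Qed.

Let kE x y : I x -> I y -> k (x, y) = (ln (b - a))%:E + nln (x - y).
Proof. by move=> Ix Iy; rewrite repulsion_near ?subr_gt0//; exact: I_dist. Qed.

Let uE x : I x -> u x = (V x + C)%:E + 2%:E * potential k mu x.
Proof. by move=> Ix; rewrite /effective_potential (confinementE VC)//; rewrite /= in_itv in Ix. Qed.

Let pot_ge0 x : 0 <= potential k mu x. Proof. exact: potential_ge0. Qed.

Let u_le x (M : R) : I x -> u x <= M%:E -> exists2 p : R, potential k mu x = p%:E & (V x + C + 2 * p <= M)%R.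
Proof.
move=> Ix; rewrite uE//; have := pot_ge0 x; case: (potential k mu x) => [p| |]// _.
  by rewrite -EFinM -EFinD lee_fin; exists p.
by rewrite gt0_muley// addey.
Qed.

(** The effective potential is lower semicontinuous, by Fatou's lemma. *)
Lemma effective_potential_lsc (M : R) (x_ : nat -> R) (x : R) : x_ @ \oo --> x ->
  (forall n, I (x_ n)) -> I x -> (forall n, u (x_ n) <= M%:E) -> u x <= M%:E.
Proof.
move=> xx Ix_ Ix uM.
pose w y := ((M - (V y + C)) / 2)%R.
have potw y : I y -> (u y <= M%:E) = (potential k mu y <= (w y)%:E).
  move=> Iy; rewrite uE//; have := pot_ge0 y; case: (potential k mu y) => [p| |]// _.
    by rewrite -EFinM -EFinD !lee_fin /w; apply/idP/idP; lra.
  by rewrite gt0_muley// addey.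
rewrite potw//.
have wx : (fun n => (w (x_ n))%:E) @ \oo --> (w x)%:E.
  apply: cvg_EFin; first exact: nearW.
  apply: cvgMl; apply: cvgB; first exact: cvg_cst.
  apply: cvgD; last exact: cvg_cst.
  by apply: continuous_cvg => //; exact: cV.
have mki (y : mR) : measurable_fun setT (fun z => k (y, z)) by exact: measurable_kernel1.
have potI y : potential k mu y = \int[mu]_(z in I) k (y, z).
  rewrite /potential (ge0_negligible_integral (measurableC mI) measurableT (mki y) _ muI)//.
  by rewrite setTD setCK.
apply: (@le_trans _ _ (limn_einf (fun n => potential k mu (x_ n)))).
  rewrite potI; under [in leRHS]eq_fun do rewrite potI.
  apply: le_trans (fatou mu mI _ _) => //; last by move=> n; exact: measurable_funTS.
  rewrite le_eqVlt; apply/orP; left; apply/eqP; apply: eq_integral => z /set_mem Iz.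
  have kc : (fun n => k (x_ n, z)) @ \oo --> k (x, z).
    rewrite kE//; under eq_fun do rewrite (kE (Ix_ _) Iz).
    apply: addr_nln_cvg; apply: cvgB => //; exact: cvg_cst.
  by have [-> _] := cvg_limn_einf_sup kc.
rewrite limn_einf_lim -(cvg_lim _ wx)//.
apply: lee_lim; [exact: is_cvg_einfs|by apply/cvg_ex; exists (w x)%:E|].
apply: nearW => n; apply: (@le_trans _ _ (potential k mu (x_ n))).
  by apply: ereal_inf_lbound; exists n => /=.
by rewrite -potw.
Qed.

(** A point of the support is a limit of points where the effective potential is at
    most its mean, up to [e]. *)
Lemma effective_potential_supp (x : R) : K x -> u x <= l.
Proof.
move=> Kx; have [_ [_ KI]] := inf_supp mu_compact.
have Ix : I x by rewrite /= in_itv/=; exact: KI.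
apply/lee_addgt0Pr => e e0; rewrite -(fineK l_fin) -EFinD.
have [|x_ Ax_ xx] := @adherent_sequence R x [set y | I y /\ u y <= (fine l + e)%:E].
  move=> d d0.
  have mball : (0 < mu (ball x d))%E by apply: Kx; [exact: ball_open|exact: ballxx].
  apply: contrapT => H.
  have mu' : measurable_fun setT u.
    by apply: (measurable_effective_potential mk k0 mv).
  have null : mu (~` I `|` [set y | l + e%:E < u y]) = 0.
    have mY : measurable [set y : mR | l + e%:E < u y].
      by rewrite -[X in measurable X]setTI; apply: measurable_lte.
    apply: null_set_setU => //; first exact: measurableC.
    exact: (effective_potential_ae_le mk k0 ksym mv v0 mI muI (energy_fin ltr01 (lexx _)) Emin e0).
  move: mball; rewrite lt_neqAle => /andP[/negP + _]; apply; rewrite eq_sym eq_le measure_ge0 andbT -null.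
  apply: le_measure; rewrite ?inE.
  - exact: measurable_ball.
  - apply: measurableU; first exact: measurableC.
    by rewrite -[X in measurable X]setTI; apply: measurable_lte.
  move=> y xy; have [Iy|nIy] := pselect (I y); last by left.
  right; rewrite /= ltNge; apply/negP => uy; apply: H; exists y => //.
  by split => //; rewrite EFinD fineK.
apply: (effective_potential_lsc xx) => // n; by have [] := Ax_ n.
Qed.

(** In a gap of the support, the effective potential is convex, hence bounded by its
    values at both ends. *)
Lemma effective_potential_hull (x : R) : I x -> u x <= l.
Proof.
move=> Ix; have [Ka [Kb KI]] := inf_supp mu_compact.
have [Kx|nKx] := pselect (K x); first exact: effective_potential_supp.
have Cl (A : set R) : closed A -> compact (A `&` supp mu).
  by move=> cA; rewrite setIC; apply: compact_closedI.
have idc A : {within A, continuous (@id R)} by apply: continuous_subspaceT => ?; exact: cvg_id.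
have /= := Ix; rewrite in_itv/= => /andP[ax xb].
have [|al /set_mem[/= alx Kal] almax] := @compact_EVT_max _ _ id _ _ (Cl _ (@closed_le R x)) (idc _).
  by exists a; split.
have [|be /set_mem[/= xbe Kbe] bemin] := @compact_EVT_min _ _ id _ _ (Cl _ (@closed_ge R x)) (idc _).
  by exists b; split.
have {}alx : (al < x)%R by rewrite lt_neqAle alx andbT; apply/eqP => e; apply: nKx; rewrite -e.
have {}xbe : (x < be)%R by rewrite lt_neqAle xbe andbT; apply/eqP => e; apply: nKx; rewrite e.
(* [al] and [be] are the ends of the gap containing [x] *)
have ba : (0 < be - al)%R by lra.
pose la := ((be - x) / (be - al))%R.
have la0 : (0 < la)%R by rewrite divr_gt0//; lra.
have la1 : (la < 1)%R by rewrite ltr_pdivrMr//; lra.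
have xE : (x = la * al + (1 - la) * be)%R by rewrite /la; field; rewrite gt_eqF.
have Ial : I al by rewrite /= in_itv/=; exact: KI.
have Ibe : I be by rewrite /= in_itv/=; exact: KI.
have := effective_potential_supp Kbe; have := effective_potential_supp Kal.
rewrite -(fineK l_fin) => /(u_le Ial)[pa pae pal] /(u_le Ibe)[pb pbe pbl].
have : potential k mu x <= (la * pa + (1 - la) * pb)%:E.
  have mki (y : mR) : measurable_fun setT (fun z => k (y, z)) by exact: measurable_kernel1.
  have ll : (0 <= 1 - la)%R by lra.
  rewrite EFinD !EFinM -pae -pbe /potential -!ge0_integralZl ?lee_fin ?(ltW la0)//.
  rewrite -ge0_integralD//; last 4 first.
  - by move=> y _; rewrite mule_ge0// lee_fin ltW.
  - exact: emeasurable_funM.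
  - by move=> y _; rewrite mule_ge0// lee_fin.
  - exact: emeasurable_funM.
  apply: ae_ge0_le_integral => //.
  - by move=> y _; rewrite adde_ge0// mule_ge0// lee_fin// ltW.
  - by apply: emeasurable_funD; exact: emeasurable_funM.
  exists (~` supp mu); split.
  - apply: measurableC; exact: supp_measurable.
  - exact: supp_full.
  move=> y /= H Ky; apply: H => _.
  have Iy : I y by rewrite /= in_itv/=; exact: KI.
  rewrite !kE//.
  have -> : (x - y = la * (al - y) + (1 - la) * (be - y))%R by rewrite {1}xE; ring.
  apply: addr_nln_convex; first by rewrite la0.
  have [yx|xy] := lerP y x.
    have : (y <= al)%R by apply: almax; apply/mem_set.
    by move=> ?; rewrite mulr_ge0//; lra.
  have : (be <= y)%R by apply: bemin; apply/mem_set; split => //=; exact: ltW.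
  by move=> ?; rewrite mulr_le0//; lra.
rewrite uE//; have := pot_ge0 x; case: (potential k mu x) => [p| |]// _.
rewrite -EFinM -EFinD !lee_fin => pp.
have la01 : (0 <= la <= 1)%R by rewrite !ltW.
have := Vconvex al be la01; rewrite -xE.
have h1 : (la * (V al + C + 2 * pa) <= la * fine l)%R by rewrite ler_pM2l.
have h2 : ((1 - la) * (V be + C + 2 * pb) <= (1 - la) * fine l)%R by rewrite ler_pM2l//; lra.
lra.
Qed.

(** The mean of the effective potential is at most [l] for the arcsine law of the
    convex hull of the support and at least [l] for a concentric one, while their
    logarithmic potentials differ by at most [- ln s]. *)
Lemma arcsine_comparison (s : R) : (0 < s)%R -> (s <= 1)%R ->
  (\int[arc 1%R]_x V x - \int[arc s]_x V x <= - 2 * ln s)%R.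
Proof.
move=> s0 s1; have ab' := ab.
have arcI : arc 1%R (~` I) = 0 by apply: arcsine_law_full; lra.
have mu' : measurable_fun setT u by apply: (measurable_effective_potential mk k0 mv).
have le1 : \int[arc 1%R]_x u x <= l.
  apply: (@le_trans _ _ (\int[arc 1%R]_x l)); last first.
    rewrite (integral_cst _ measurableT) [X in _ * X](_ : _ = 1) ?mule1//.
    exact: probability_setT.
  apply: ae_ge0_le_integral => //.
  - by move=> x _; exact: effective_potential_ge0.
  - by move=> x _; apply: integral_ge0 => y _; exact: effective_potential_ge0.
  exists (~` I); split => //; first exact: measurableC.
  by move=> x /= H Ix; apply: H => _; exact: effective_potential_hull.
have := le_trans le1 (effective_potential_arc s0 s1).
rewrite (integral_effective_potential mk k0 mv v0) (integral_confinement cV VC arcI).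
rewrite (potential_sym mk k0 ksym).
have -> : \int[mu]_x potential k (arc 1%R) x = (ln (b - a) + ln 2 - ln (1 * L))%:E.
  rewrite (ge0_negligible_integral (measurableC mI) measurableT _ _ muI)//; last 2 first.
  - exact: measurable_potential.
  - by move=> x _; exact: potential_ge0.
  rewrite setTD setCK.
  rewrite (eq_integral (fun=> (ln (b - a) + ln 2 - ln (1 * L))%:E)); last first.
    move=> x /set_mem; rewrite /= in_itv/= => /andP[ax xb].
    by apply: potential_arcsine; first lra; first lra; apply/andP; split; lra.
  rewrite (integral_cst _ mI) [X in _ * X](_ : _ = 1) ?mule1//.
  have := probability_setC mu (measurableC mI).
  by rewrite setCK muI sube0.
have lnM' : (ln (s * L) = ln s + ln (1 * L))%R by rewrite mul1r lnM ?posrE//; lra.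
rewrite -!EFinM -!EFinD lee_fin lnM'; lra.
Qed.

End log_gas.

(** * Moments of the arcsine law *)

Section reflection.
Context (R : realType).
Local Notation mR := (measurableTypeR R).
Local Notation leb := (@lebesgue_measure R).
Local Notation U := (angle_law R).

Lemma integral_reflect (c : R) (f : mR -> \bar R) : measurable_fun setT f ->
  (\int[leb]_x f x = \int[leb]_t f (- 1 * t + c)%R)%E.
Proof.
move=> mf; have k0 : (- 1 : R) != 0 by rewrite oppr_eq0 oner_eq0.
rewrite integralE [RHS]integralE.
rewrite (integral_affine c k0 (measurable_funepos mf))//.
rewrite (integral_affine c k0 (measurable_funeneg mf))//.
rewrite normrN normr1 !mul1e; congr (_ - _)%E;
  by apply: eq_integral => t _; rewrite ?funeposE ?funenegE.
Qed.

Lemma angle_reflect (f : R -> R) : continuous f ->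
  \int[U]_t f (- cos t) = \int[U]_t f (cos t).
Proof.
move=> cf.
have cfc : continuous (fun t : R => f (cos t)).
  by move=> t; apply: continuous_comp; [exact: continuous_cos|exact: cf].
have cfn : continuous (fun t : R => f (- cos t)).
  move=> t; apply: (@continuous_comp _ _ _ (fun t => - cos t) f); last exact: cf.
  by apply: cvgN; exact: continuous_cos.
rewrite /Rintegral; congr fine.
rewrite !integral_angle; [|exact: continuous_measurable_fun|exact: continuous_measurable_fun].
rewrite [RHS]integral_mkcond (@integral_reflect pi); last first.
  apply/(measurable_restrictT _ (measurable_itv _)); apply: measurable_funTS.
  apply/measurable_EFinP; apply: measurable_funM => //.
  exact: continuous_measurable_fun.
rewrite integral_mkcond; apply: eq_integral => t _; rewrite !patchE.
have -> : cos (- 1 * t + pi) = - cos t by rewrite mulN1r cosDpi cosN.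
congr (if _ then _ else _); rewrite !mem_setE !in_itv/= mulN1r.
by apply/idP/idP => /andP[? ?]; apply/andP; split; lra.
Qed.

(** Moments of the arcsine law on [[-1, 1]]. *)
Definition cosmoment (n : nat) : R := \int[U]_t cos t ^+ n.

Let bcos n : bmeas (`[0, pi]%classic : set mR) (fun t : mR => cos t ^+ n).
Proof. by apply: bmeasX; apply: angle_bmeas; exact: continuous_cos. Qed.

(** The integral of the derivative of [sin t cos^(n+1) t] over [[0, pi]] vanishes. *)
Lemma cosmomentSS n : n.+2%:R * cosmoment n.+2 = n.+1%:R * cosmoment n.
Proof.
have [c1 d1] := C1_sin R; have [c2 d2] := C1_cos R.
have [c0 d0] := C1_shifted_power (0 : R) n.+1.
have [c3 d3] := C1_comp c0 c2.
have [c4 d4] := C1_mul c1 c3.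
have e (t : R) : derive1 (fun t => sin t * ((fun x => (x - 0) ^+ n.+1) \o cos) t) t =
    n.+2%:R * cos t ^+ n.+2 - n.+1%:R * cos t ^+ n.
  rewrite d4 d3 d1 d2 d0/= subr0 -[n.+2%:R]natr1 !exprS.
  have : sin t * sin t = 1 - cos t * cos t by have := cos2Dsin2 t; rewrite !expr2 => <-; ring.
  move=> h; transitivity (cos t * (cos t * cos t ^+ n) - n.+1%:R * cos t ^+ n * (sin t * sin t)); first by ring.
  by rewrite h; ring.
apply/eqP; rewrite -subr_eq0; apply/eqP.
have := angle_FTC c4; rewrite sinpi sin0 !mul0r subrr mul0r.
under eq_Rintegral do rewrite e.
rewrite (bmeas_intB (@angle_measurable R) (@angle_full R)); try by apply: bmeasZ; exact: bcos.
by rewrite !(bmeas_intZ (@angle_measurable R) (@angle_full R)).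
Qed.

Lemma cosmoment0 : cosmoment 0 = 1.
Proof. by rewrite /cosmoment; under eq_Rintegral do rewrite expr0; exact: Rint_cst. Qed.

Lemma cosmoment1 : cosmoment 1 = 0.
Proof.
rewrite -[RHS](angle_cos R 1); apply: eq_Rintegral => t _.
by rewrite expr1 mul1r.
Qed.

Lemma cosmoment_odd n : cosmoment n.*2.+1 = 0.
Proof.
elim: n => [|n ih]; first exact: cosmoment1.
apply/eqP; have /eqP := cosmomentSS n.*2.+1.
by rewrite ih mulr0 mulf_eq0 pnatr_eq0/= doubleS.
Qed.

Lemma cosmoment_even n : 4 ^+ n * cosmoment n.*2 = 'C(n.*2, n)%:R.
Proof.
elim: n => [|n ih]; first by rewrite expr0 mul1r cosmoment0 bin0.
have h : (n.+1%:R : R) != 0 by rewrite pnatr_eq0.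
have := cosmomentSS n.*2; rewrite doubleS => e.
have bE : (n.+1 * 'C(n.*2.+2, n.+1) = 2 * n.*2.+1 * 'C(n.*2, n))%N.
  have h1 := mul_bin_diag n.*2.+2 n; have := mul_bin_down n.*2.+1 n => /=.
  rewrite -h1/= (_ : n.*2.+1 - n = n.+1)%N; last by rewrite -addnn subSn ?leq_addr// addnK.
  by move=> h2; rewrite -mulnA h2 mulnA -muln2; ring.
apply: (mulfI h).
rewrite -[RHS]natrM bE !natrM -ih exprS.
transitivity (2 * 4 ^+ n * (n.*2.+2%:R * cosmoment n.*2.+2)).
  rewrite -doubleS -muln2 natrM; ring.
rewrite e; ring.
Qed.

Lemma cosmoment_ge0 n : 0 <= cosmoment n.
Proof.
rewrite -[n]odd_double_half; case: (odd n); first by rewrite add1n cosmoment_odd.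
rewrite add0n; have : 0 <= 4 ^+ n./2 * cosmoment n./2.*2 by rewrite cosmoment_even.
by rewrite pmulr_rge0// exprn_gt0.
Qed.

End reflection.

(** * Integrals against shrinking arcsine laws *)

Section arcsine_expectation.
Context (R : realType).
Local Notation mR := (measurableTypeR R).
Local Notation U := (angle_law R).

Lemma arcsine_continuous (f : R -> R) (c L : R) : continuous f -> continuous (fun t : R => f (c + L * cos t)).
Proof.
move=> cf t; apply: (@continuous_comp _ _ _ (fun t => c + L * cos t) f); last exact: cf.
apply: cvgD; first exact: cvg_cst.
by apply: cvgM; [exact: cvg_cst|exact: continuous_cos].
Qed.

Lemma Rintegral_arcsine_law (c L : R) (f : R -> R) : continuous f ->
  \int[arcsine_law c L]_x f x = \int[U]_t f (c + L * cos t).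
Proof.
move=> cf; rewrite /Rintegral; congr fine.
rewrite integral_distribution//.
- by apply/measurable_EFinP; exact: continuous_measurable_fun.
- apply: (bmeas_integrable (@angle_measurable R) (@angle_full R)).
  by apply: angle_bmeas; exact: arcsine_continuous.
Qed.

Lemma arcsine_bmeas (f : R -> R) (c L : R) : continuous f ->
  bmeas (`[0, pi]%classic : set mR) (fun t : mR => f (c + L * cos t)).
Proof. by move=> cf; apply: angle_bmeas; exact: arcsine_continuous. Qed.

(** Spreading the arcsine law increases the integral of a convex function: the point
    [c + s L cos t] is a barycentre of [c + L cos t] and [c - L cos t], which have
    the same law. *)
Lemma convex_arcsine_le (f : R -> R) (c L s : R) : continuous f -> 0 <= s <= 1 ->
  (forall l x y, 0 <= l <= 1 -> f (l * x + (1 - l) * y) <= l * f x + (1 - l) * f y) ->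
  \int[U]_t f (c + s * L * cos t) <= \int[U]_t f (c + L * cos t).
Proof.
move=> cf /andP[s0 s1] fconv.
have mA := @angle_measurable R; have A0 := @angle_full R.
have refl : \int[U]_t f (c + - L * cos t) = \int[U]_t f (c + L * cos t).
  have := @angle_reflect R (fun y => f (c + L * y)).
  under eq_Rintegral do rewrite mulrN -mulNr; apply.
  move=> t; apply: (@continuous_comp _ _ _ (fun t => c + L * t) f); last exact: cf.
  apply: cvgD; first exact: cvg_cst.
  by apply: cvgM; [exact: cvg_cst|exact: cvg_id].
have -> : \int[U]_t f (c + L * cos t) =
    \int[U]_t ((1 + s) / 2 * f (c + L * cos t) + (1 - (1 + s) / 2) * f (c + - L * cos t)).
  have b1 := arcsine_bmeas c L cf; have b2 := arcsine_bmeas c (- L) cf.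
  rewrite (bmeas_intD mA A0 (bmeasZ _ b1) (bmeasZ _ b2)) !(bmeas_intZ mA A0)// refl.
  by field.
apply: (bmeas_le mA A0).
- exact: arcsine_bmeas.
- by apply: bmeasD; apply: bmeasZ; exact: arcsine_bmeas.
move=> t _; have -> : c + s * L * cos t = (1 + s) / 2 * (c + L * cos t) + (1 - (1 + s) / 2) * (c + - L * cos t).
  by field.
by apply: fconv; apply/andP; split; lra.
Qed.

(** In the binomial expansion every term is nonnegative, the odd moments being zero;
    only the term of highest degree is kept. *)
Lemma power_arcsine_ge (c L s : R) (p : nat) : 0 <= s <= 1 -> 0 <= L ->
  L ^+ p.*2 * cosmoment R p.*2 * (1 - s ^+ p.*2) <=
  \int[U]_t (c + L * cos t) ^+ p.*2 - \int[U]_t (c + s * L * cos t) ^+ p.*2.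
Proof.
move=> /andP[s0 s1] L0.
have mA := @angle_measurable R; have A0 := @angle_full R.
have E r : \int[U]_t (c + r * cos t) ^+ p.*2 =
    \sum_(i < p.*2.+1) (c ^+ (p.*2 - i) * r ^+ i * cosmoment R i) *+ 'C(p.*2, i).
  under eq_Rintegral do rewrite exprDn.
  have bc (i : nat) : bmeas (`[0, pi]%classic : set mR) (fun t : mR => cos t ^+ i).
    by apply: bmeasX; apply: angle_bmeas; exact: continuous_cos.
  transitivity (\int[U]_t \sum_(i < p.*2.+1) ((c ^+ (p.*2 - i) * r ^+ i) *+ 'C(p.*2, i)) * cos t ^+ i).
    by apply: eq_Rintegral => t _; apply: eq_bigr => i _; rewrite exprMn mulrA mulrnAl.
  rewrite (bmeas_int_sum mA A0); last by move=> i _; exact: bmeasZ.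
  by apply: eq_bigr => i _; rewrite (bmeas_intZ mA A0)// mulrnAl.
rewrite !E -sumrB big_ord_recr/= subnn expr0 mul1r binn !mulr1n.
have -> : L ^+ p.*2 * cosmoment R p.*2 * (1 - s ^+ p.*2) =
    L ^+ p.*2 * cosmoment R p.*2 - 1 * (s * L) ^+ p.*2 * cosmoment R p.*2.
  by rewrite exprMn; ring.
rewrite lerDr; apply: sumr_ge0 => i _.
have -> : (c ^+ (p.*2 - i) * L ^+ i * cosmoment R i) *+ 'C(p.*2, i) -
      (c ^+ (p.*2 - i) * (s * L) ^+ i * cosmoment R i) *+ 'C(p.*2, i)
   = (c ^+ (p.*2 - i) * cosmoment R i * (L ^+ i * (1 - s ^+ i))) *+ 'C(p.*2, i).
  by rewrite -mulrnBl exprMn; congr (_ *+ _); ring.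
apply: mulrn_wge0; apply: mulr_ge0; last first.
  by rewrite mulr_ge0 ?exprn_ge0// subr_ge0 exprn_ile1.
have [od|ev] := boolP (odd i).
  have -> : cosmoment R i = 0; last by rewrite mulr0.
  by rewrite -[nat_of_ord i]odd_double_half od add1n cosmoment_odd.
apply: mulr_ge0; last exact: cosmoment_ge0.
rewrite exprn_even_ge0//; rewrite oddB ?odd_double ?(negbTE ev)//.
by rewrite ltnW.
Qed.

Lemma convex_even_power (p : nat) (l x y : R) : 0 <= l <= 1 ->
  (l * x + (1 - l) * y) ^+ p.*2 <= l * x ^+ p.*2 + (1 - l) * y ^+ p.*2.
Proof.
move=> /andP[l0 l1]; rewrite -!mul2n !exprM.
have ll : 0 <= 1 - l by lra.
have H (u v : R) : 0 <= u -> 0 <= v -> (l * u + (1 - l) * v) ^+ p <= l * u ^+ p + (1 - l) * v ^+ p.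
  move=> u0 v0; elim: p => [|n ih]; first by rewrite !expr0; lra.
  have uv0 : 0 <= l * u + (1 - l) * v by rewrite addr_ge0// mulr_ge0.
  rewrite exprS; apply: (le_trans (ler_wpM2l uv0 ih)).
  have mono : 0 <= (u - v) * (u ^+ n - v ^+ n).
    have [uv|vu] := lerP u v.
      by rewrite mulr_le0// subr_le0// lerXn2r ?nnegrE.
    by rewrite mulr_ge0// subr_ge0 ?(ltW vu)// lerXn2r ?nnegrE// ltW.
  rewrite -subr_ge0.
  have -> : l * u ^+ n.+1 + (1 - l) * v ^+ n.+1 - (l * u + (1 - l) * v) * (l * u ^+ n + (1 - l) * v ^+ n)
     = l * (1 - l) * ((u - v) * (u ^+ n - v ^+ n)) by rewrite !exprS; ring.
  by rewrite mulr_ge0// mulr_ge0.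
apply: le_trans (H _ _ (sqr_ge0 x) (sqr_ge0 y)).
apply: lerXn2r; rewrite ?nnegrE ?sqr_ge0//.
  by rewrite addr_ge0// mulr_ge0// sqr_ge0.
rewrite -subr_ge0.
have -> : l * x ^+ 2 + (1 - l) * y ^+ 2 - (l * x + (1 - l) * y) ^+ 2 = l * (1 - l) * (x - y) ^+ 2 by ring.
by rewrite mulr_ge0 ?sqr_ge0// mulr_ge0.
Qed.

(** Both sides vanish at [s = 1], where their slopes are compared by setting
    [s = exp (- h)] with [h] small. *)
Lemma log_scaling_le (A : R) (n : nat) :
  (forall s, 0 < s -> s <= 1 -> A * (1 - s ^+ n) <= - 2 * ln s) -> n%:R * A <= 2.
Proof.
move=> H; have [A0|A0] := lerP A 0.
  by apply: (@le_trans _ _ 0) => //; rewrite mulr_ge0_le0.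
apply/ler_addgt0Pr => e e0.
pose h := e / (2 * n.+1%:R); have n1 : 0 < n.+1%:R :> R by [].
have h0 : 0 < h by rewrite divr_gt0// mulr_gt0.
have := H (expR (- h)) (expR_gt0 _).
have u0 : 0 <= n%:R * h by rewrite mulr_ge0// ltW.
have s1 : expR (- h) <= 1 by rewrite -[leRHS]expR0 ler_expR; lra.
(* [exp u >= 1 + u] at [u = n h] bounds [1 - s ^ n] from below *)
move=> /(_ s1); rewrite expRK -expRM_natl mulrN expRN.
have : (expR (n%:R * h))^-1 <= (1 + n%:R * h)^-1.
  by rewrite lef_pV2 ?posrE ?expR_gt0 ?expR_ge1Dx//; lra.
have hn : n%:R * h <= e / 2.
  have -> : n%:R * h = e / 2 * (n%:R / n.+1%:R) by rewrite /h; move: n.+1%:R n1 => N1 /gt_eqF/negbT N10; field.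
  by rewrite ler_piMr ?divr_ge0 ?(ltW e0)// ler_pdivrMr// mul1r ler_nat.
set X := _^-1; set N := n%:R in u0 hn *; set Y := _^-1 => XY AX.
have Yu : Y * (1 + N * h) = 1 by rewrite mulVf// gt_eqF//; lra.
have h1 : A * (1 - Y) <= 2 * h.
  apply: (@le_trans _ _ (A * (1 - X))); last lra.
  by rewrite ler_pM2l//; lra.
have h2 : A * (1 - Y) * (1 + N * h) <= 2 * h * (1 + N * h).
  by rewrite ler_wpM2r//; lra.
have h3 : h * (N * A) <= h * (2 * (1 + N * h)).
  have -> : h * (N * A) = A * (1 - Y) * (1 + N * h).
    transitivity (A * (1 + N * h) - A * (Y * (1 + N * h))); last by ring.
    by rewrite Yu; ring.
  by apply: (le_trans h2); rewrite -subr_ge0 [X in 0 <= X](_ : _ = 0)//; ring.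
by move: h3; rewrite ler_pM2l//; lra.
Qed.

End arcsine_expectation.

(** * The length of the support of the minimizer *)

Section equilibrium_support.
Context (R : realType) (mu : probR R) (V : R -> R) (p : nat) (rho : R).
Hypothesis mu_compact : compact (supp mu).
Hypothesis mu_not_dirac : ~ exists a : R, mu [set a] = 1%E.
Hypotheses (cV : continuous V) (p0 : (0 < p)%N) (rho0 : 0 < rho).
Hypothesis Vconv : forall l x y, 0 <= l <= 1 ->
  V (l * x + (1 - l) * y) - rho * (l * x + (1 - l) * y) ^+ p.*2 <=
  l * (V x - rho * x ^+ p.*2) + (1 - l) * (V y - rho * y ^+ p.*2).
Hypothesis Vmin : energy_minimizer V mu.
Local Notation mR := (measurableTypeR R).
Local Notation K := (supp mu : set mR).
Local Notation a := (inf K).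
Local Notation b := (sup K).
Local Notation c := ((a + b) / 2).
Local Notation L := ((b - a) / 2).

Let V_convex l x y : 0 <= l <= 1 -> V (l * x + (1 - l) * y) <= l * V x + (1 - l) * V y.
Proof.
move=> l01; have := Vconv x y l01; have := convex_even_power p x y l01.
have r0 := rho0; move: (l * x + (1 - l) * y) => z h.
have : rho * z ^+ p.*2 <= rho * (l * x ^+ p.*2 + (1 - l) * y ^+ p.*2) by rewrite ler_pM2l.
lra.
Qed.

Let continuous_power : continuous (fun x : R => x ^+ p.*2).
Proof. by move=> x; exact: exprn_continuous. Qed.

Lemma equilibrium_radius_le : p%:R * rho * 'C(p.*2, p)%:R * L ^+ p.*2 <= 4 ^+ p.
Proof.
have [C HC] := continuous_bounded_itv (`|a| + `|b|) cV.
have VC x : a <= x <= b -> 0 <= V x + C.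
  move=> /andP[ax xb]; have : `|x| <= `|a| + `|b|.
    have := ler_norm (- a); have := ler_norm b; rewrite normrN ler_norml => h1 h2.
    by have := normr_ge0 a; have := normr_ge0 b => *; apply/andP; split; lra.
  by move=> /HC; rewrite ler_norml => /andP[? _]; lra.
have L0 : 0 < L by rewrite divr_gt0// subr_gt0; exact: inf_lt_sup.
pose W (x : R) := V x - rho * x ^+ p.*2.
have cP : continuous (fun x : R => rho * x ^+ p.*2).
  by move=> x; apply: cvgM; [exact: cvg_cst|exact: continuous_power].
have cW : continuous W by move=> x; apply: cvgB; [exact: cV|exact: cP].
(* [A] is the contribution of the leading power to the slope at [s = 1] *)
pose A := rho * L ^+ p.*2 * cosmoment R p.*2.
have : p.*2%:R * A <= 2.
  apply: log_scaling_le => s s0 s1; have s01 : 0 <= s <= 1 by rewrite ltW.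
  have := arcsine_comparison mu_compact mu_not_dirac cV V_convex Vmin VC s0 s1.
  rewrite !Rintegral_arcsine_law// mul1r; apply: le_trans.
  have mA := @angle_measurable R; have A0 := @angle_full R.
  have split r : \int[angle_law R]_t V (c + r * cos t) =
      \int[angle_law R]_t W (c + r * cos t) + rho * \int[angle_law R]_t (c + r * cos t) ^+ p.*2.
    rewrite -(bmeas_intZ mA A0); last exact: (arcsine_bmeas _ _ continuous_power).
    rewrite -(bmeas_intD mA A0); first by apply: eq_Rintegral => t _; rewrite /W subrK.
    - exact: (arcsine_bmeas _ _ cW).
    - exact: (bmeasZ _ (arcsine_bmeas _ _ continuous_power)).
  have h1 := convex_arcsine_le c L cW s01 Vconv.
  have := power_arcsine_ge c p s01 (ltW L0).
  rewrite -(ler_pM2l rho0) !split /A; lra.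
have -> : p.*2%:R * A = 2 * (p%:R * rho * 'C(p.*2, p)%:R * L ^+ p.*2) / 4 ^+ p.
  rewrite /A -cosmoment_even -muln2 natrM; field.
  by rewrite expf_neq0// pnatr_eq0.
by rewrite ler_pdivrMr ?exprn_gt0// ler_pM2l.
Qed.

Lemma equilibrium_diam_le :
  (p%:R * rho * 'C(p.*2, p)%:R) `^ (1 / p%:R) / 8 <= 2 / diam (supp mu) ^+ 2.
Proof.
have X0 : 0 < p%:R * rho * 'C(p.*2, p)%:R :> R.
  by rewrite !mulr_gt0// ?ltr0n// bin_gt0 -addnn leq_addr.
have := equilibrium_radius_le; move: X0; set X := _ * _ * _ => X0 XL.
have ab : a < b := inf_lt_sup mu_compact mu_not_dirac.
rewrite diam_supp//; set Y := X `^ _.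
have YX : Y ^+ p = X.
  rewrite /Y -powR_mulrn ?powR_ge0// -powRrM mul1r mulVf ?powRr1 ?(ltW X0)//.
  by rewrite pnatr_eq0 -lt0n.
have YL : Y * L ^+ 2 <= 4.
  rewrite -(@ler_pXn2r _ p)// ?nnegrE//; last by rewrite mulr_ge0 ?powR_ge0// sqr_ge0.
  by rewrite exprMn YX -exprM mul2n.
have d0 : 0 < (b - a) ^+ 2 by rewrite exprn_gt0// subr_gt0.
rewrite ler_pdivlMr//.
have -> : Y / 8 * (b - a) ^+ 2 = Y * L ^+ 2 / 2 by field.
lra.
Qed.

End equilibrium_support.
(** * Sharp bounds on the Poincaré constant *)

Theorem theorem9 (R : realType) (mu : probR R)
    (mu_compact : compact (supp mu))
    (mu_not_dirac : ~ exists a : R, mu [set a] = 1%E) :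
  [/\ poincare_inequality mu (Poin mu),
      2 / (diam (supp mu)) ^+ 2 <= Poin mu <= 1 / Var mu id,
      2 / (diam (supp mu)) ^+ 2 = Poin mu <->
        (exists alpha a b : R, [/\ a < b, 0 < alpha < 1 &
           forall A : set (measurableTypeR R), measurable A ->
             mu A = two_point_law alpha a b A]),
      Poin mu = 1 / Var mu id <->
        (exists a r : R, 0 < r /\
           forall A : set (measurableTypeR R), measurable A ->
             mu A = semicircle_law a r A) &
      forall (V : R -> R) (p : nat) (rho : R),
        C2 V -> (0 < p)%N -> 0 < rho ->
        convex_function [set: R^o]
          (fun x : R^o => V x - rho * x ^+ (2 * p)) ->
        energy_minimizer V mu ->
        (p%:R * rho * 'C(2 * p, p)%:R) `^ (1 / p%:R) / 8 <= Poin mu /\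
        (p = 1%N -> rho / 4 <= Poin mu)].
Proof.
split.
- exact: poincare_Poin.
- apply/andP; split; last exact: Poin_le_Var.
  by apply: poincare_le_Poin => //; exact: poincare_diam.
- split; first exact: Poin_diam_two_point.
  by move=> [al [x [y [xy al01 muE]]]]; exact: (two_point_Poin mu_compact mu_not_dirac xy al01 muE).
- split; first exact: Poin_Var_semicircle.
  by move=> [x [r [r0 muE]]]; exact: (semicircle_Poin r0 muE).
move=> V p rho [dV _] p0 rho0 Wconv Vmin.
have cV : continuous V by exact: derivable_all_continuous.
have Vconv l x y : 0 <= l <= 1 ->
    V (l * x + (1 - l) * y) - rho * (l * x + (1 - l) * y) ^+ p.*2 <=
    l * (V x - rho * x ^+ p.*2) + (1 - l) * (V y - rho * y ^+ p.*2).
  move=> /andP[l0 l1]; rewrite -mul2n.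
  by have := Wconv (Itv01 l0 l1) x y (mem_setT _) (mem_setT _); rewrite !convRE.
have := equilibrium_diam_le mu_compact mu_not_dirac cV p0 rho0 Vconv Vmin.
have := poincare_le_Poin mu_compact mu_not_dirac (poincare_diam mu_compact mu_not_dirac).
rewrite -mul2n => h1 h2; have h := le_trans h2 h1; split => // p1.
move: h; rewrite p1 divr1 mul1r powRr1 ?mulr_ge0 ?(ltW rho0)// (_ : 'C(2 * 1, 1) = 2)%N//.
lra.
Qed.
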